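(* Let $R$ be a ring with idempotent local units and $\mathfrak C$ an $A$-coring. Suppose that functors $F:\mathcal M_R\to\mathcal M^{\mathfrak C}$ and $G:\mathcal M^{\mathfrak C}\to\mathcal M_R$ form an equivalence of categories. Put $\Sigma=F(R)$. Then the following statements hold: (i) $\Sigma\cong\mathrm{colim}\,\underline P$ for a split direct system $\underline P^s:\mathcal Z\to(\mathcal M^{\mathfrak C}_{\rm fgp})^s$; (ii) $F\cong-\otimes_R\Sigma$ and $G\cong-\otimes^{\mathfrak C}\Sigma^\dagger$, with $\Sigma^\dagger=\mathrm{colim}\,\underline{P^*}$; (iii) there is a comatrix coring context $(R,A,\Sigma,\Sigma^\dagger,\sigma,\tau)$, and $\mathfrak C$ is isomorphic to the comatrix coring $\Sigma^*\otimes_R\Sigma$; (iv) $R\cong\mathrm{colim}\,\underline T$ for a direct system $\underline T:\mathcal Z\to\mathcal F_k$, where $T_i=\mathrm{End}^{\mathfrak C}(P_i)$ for $i\in\mathcal Z$. If $\mathfrak C$ is flat as a left $A$-module, then the following statement holds as well: (v) $\Sigma$ is faithfully flat as a left $R$-module. Conversely, (i), (iii) and (v) imply that $\mathfrak C$ is flat as a left $A$-module and $(-\otimes_R\Sigma,\ \mathrm{Hom}^{\mathfrak C}(\Sigma,-)\otimes_RR)$ is a pair of inverse equivalences.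
   Context: $A$ is an associative unital ring; $A$-modules are unital. An $A$-coring is an $A$-bimodule $\mathfrak C$ with coassociative, counital $A$-bilinear maps $\Delta:\mathfrak C\to\mathfrak C\otimes_A\mathfrak C$ and $\varepsilon_{\mathfrak C}:\mathfrak C\to A$. $\mathcal M^{\mathfrak C}$ is the category of right $\mathfrak C$-comodules (right $A$-modules $M$ with a coassociative counital right $A$-linear coaction $\rho_M(m)=m_{[0]}\otimes_Am_{[1]}\in M\otimes_A\mathfrak C$) and colinear maps; $\mathrm{Hom}^{\mathfrak C},\mathrm{End}^{\mathfrak C}$ denote colinear maps. $\mathcal M^{\mathfrak C}_{\rm fgp}$ is the full subcategory of comodules that are finitely generated and projective as right $A$-modules. A ring $R$ (not necessarily unital) has idempotent local units if for every finite subset $X\subset R$ there is an idempotent $e\in R$ with $ex=x=xe$ for all $x\in X$; such a ring is firm. A right $R$-module $M$ is firm if $M\otimes_RR\to M$, $m\otimes r\mapsto mr$, is an isomorphism (similarly on the left); $\mathcal M_R$ is the category of firm right $R$-modules; a firm ring is a ring that is firm as a module over itself. A firm left $R$-module $\Sigma$ is flat if $-\otimes_R\Sigma$ is exact on all (possibly non-firm) right $R$-modules, and faithfully flat if moreover $-\otimes_R\Sigma$ is faithful on $\mathcal M_R$. ${}_R\mathcal M^{\mathfrak C}$ consists of right $\mathfrak C$-comodules that are firm left $R$-modules with commuting $A$-action such that the coaction is left $R$-linear. $\Sigma=F(R)$ carries the left $R$-action $r\cdot u=F(\lambda_r)(u)$, $\lambda_r$ being left multiplication by $r$ on $R$, and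 so lies in ${}_R\mathcal M^{\mathfrak C}$; in the converse $\Sigma$ is likewise an object of ${}_R\mathcal M^{\mathfrak C}$, so that the two functors (between $\mathcal M_R$ and $\mathcal M^{\mathfrak C}$) are defined. $\Sigma^*=\mathrm{Hom}_A(\Sigma,A)$ has right $R$-action $(f\cdot r)(u)=f(ru)$. Split direct systems. For a category $\mathcal D$, $\mathcal D^s$ is the category with the same objects, whose morphisms $P\to Q$ are pairs $(\sigma,\tau)$ with $\sigma:P\to Q$, $\tau:Q\to P$ in $\mathcal D$ and $\tau\circ\sigma=\mathrm{id}_P$, composed as $(\sigma',\tau')\circ(\sigma,\tau)=(\sigma'\sigma,\tau\tau')$. A split direct system is a functor $\underline P^s:\mathcal Z\to\mathcal D^s$ with $\mathcal Z$ a directed partially ordered set regarded as a category; it consists of objects $P_i$ and morphisms $\sigma_{ji}:P_i\to P_j$, $\tau_{ij}:P_j\to P_i$ for $i\le j$. $\underline P$ denotes the underlying direct system $(P_i,\sigma_{ji})$; $\underline{P^*}$ is the direct system of the left $A$-modules $P_i^*=\mathrm{Hom}_A(P_i,A)$ with transition maps $P_i^*\to P_j^*$, $f\mapsto f\circ\tau_{ij}$; $\underline T$ is the direct system of the algebras $T_i=\mathrm{End}^{\mathfrak C}(P_i)$ with transition maps $t\mapsto\sigma_{ji}\circ t\circ\tau_{ij}$. $\mathcal F_k$ is the category of $k$-algebras with $k$-linear multiplicative (not necessarily unit preserving) maps, where $k$ is the commutative ground ring (which may be taken to be $\mathbb Z$). Comatrix coring context. A tuple $(R,A,\Sigma,\Sigma^\dagger,\eta,\varepsilon)$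 where $R,A$ are firm rings, $\Sigma$ is an $R$-$A$-bimodule and $\Sigma^\dagger$ an $A$-$R$-bimodule, both firm on both sides, $\eta:R\to\Sigma\otimes_A\Sigma^\dagger$ is $R$-bilinear, $\varepsilon:\Sigma^\dagger\otimes_R\Sigma\to A$ is $A$-bilinear, and, writing $\eta(r)=e_r\otimes_Af_r$ (summation understood), $e_r\,\varepsilon(f_r\otimes_Ru)=ru$ and $\varepsilon(\varphi\otimes_Re_r)f_r=\varphi r$ for all $r\in R,u\in\Sigma,\varphi\in\Sigma^\dagger$. The associated comatrix coring is $\Sigma^\dagger\otimes_R\Sigma$ with counit $\varepsilon$ and comultiplication $\varphi\otimes_Ru\mapsto\varphi\otimes_R\eta(r)\otimes_Ru^r$, where $r\otimes_Ru^r\in R\otimes_R\Sigma$ corresponds to $u$. In such a context $\Sigma^\dagger\cong\Sigma^*\otimes_RR$ and $\Sigma^\dagger\otimes_R\Sigma\cong\Sigma^*\otimes_R\Sigma$. Cotensor product. $N\otimes^{\mathfrak C}L=\ker(\rho_N\otimes_AL-N\otimes_A\rho_L)$ for a right comodule $N$ and left comodule $L$. The left $\mathfrak C$-coaction on $\Sigma^\dagger\cong\Sigma^*\otimes_RR$ is $\varphi\otimes_Rr\mapsto\varphi(e_{s[0]})e_{s[1]}\otimes_A(f_s\cdot r^s)$, where $s\otimes_Rr^s\in R\otimes_RR$ corresponds to $r$, $\sigma(s)=e_s\otimes_Af_s\in\Sigma\otimes_A\Sigma^\dagger$, and $e_{s[0]}\otimes_Ae_{s[1]}$ is the coaction of $\mathfrak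 C$ on $e_s\in\Sigma$.
   Formalization: In the converse, the isomorphism of (iii) between the comatrix coring Σ*⊗_RΣ and C is required to be the canonical map f⊗u ↦ f(u_[0])u_[1]; with an arbitrary coring isomorphism the converse is false. *)

(* Defs.v *)
From HB Require Import structures.
From mathcomp Require Import all_boot all_order all_algebra.
From mathcomp Require Import boolp.

Set Implicit Arguments.
Unset Strict Implicit.
Unset Printing Implicit Defensive.

Import GRing.Theory.
Local Open Scope ring_scope.

(* Rings without unit and modules over them are not in MathComp, and two       *)
(* [lmodType] structures cannot live on one carrier, as bimodules require;    *)
(* hence the records below. The ground ring k is the ring of integers, so     *)
(* that a k-algebra is an [rng].                                              *)

Record rng := Rng {
  rng_sort :> zmodType;
  rmul : rng_sort -> rng_sort -> rng_sort;
  rmulA : associative rmul;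
  rmulDl : left_distributive rmul +%R;
  rmulDr : right_distributive rmul +%R }.

Declare Scope rng_scope.
Delimit Scope rng_scope with rng.
Local Open Scope rng_scope.

Notation "x ⋆ y" := (rmul x y) (at level 40, left associativity) : rng_scope.

Coercion rng_of_pzRing (A : pzRingType) : rng :=
  @Rng A *%R (@mulrA A) (@mulrDl A) (@mulrDr A).

Record rng_hom (R S : rng) := RngHom {
  rng_fun :> R -> S;
  rng_homD : {morph rng_fun : x y / x + y};
  rng_homM : {morph rng_fun : x y / x ⋆ y} }.

Definition has_idempotent_local_units (R : rng) : Prop :=
  forall X : seq R, exists2 e : R, e ⋆ e = e &
    forall x, x \in X -> e ⋆ x = x /\ x ⋆ e = x.

Definition right_action (R : rng) (M : zmodType) (act : M -> R -> M) : Prop :=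
  [/\ forall r, {morph act^~ r : x y / x + y},
      forall m, {morph act m : r s / r + s}
    & forall m r s, act (act m r) s = act m (r ⋆ s)].

Definition left_action (R : rng) (M : zmodType) (act : R -> M -> M) : Prop :=
  [/\ forall r, {morph act r : x y / x + y},
      forall m, {morph act^~ m : r s / r + s}
    & forall m r s, act r (act s m) = act (r ⋆ s) m].

Record rmod (R : rng) := Rmod {
  rm_sort :> zmodType;
  ract : rm_sort -> R -> rm_sort;
  ractP : right_action ract }.

Record lmod (R : rng) := Lmod {
  lm_sort :> zmodType;
  lact : R -> lm_sort -> lm_sort;
  lactP : left_action lact }.

Notation "m <* r" := (ract m r) (at level 40, left associativity) : rng_scope.
Notation "r *> m" := (lact r m) (at level 38, right associativity) : rng_scope.

Record bimod (R S : rng) := Bimod {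
  bm_rmod :> rmod S;
  bm_lact : R -> bm_rmod -> bm_rmod;
  bm_lactP : left_action bm_lact;
  bm_actC : forall r (m : bm_rmod) s, bm_lact r (m <* s) = bm_lact r m <* s }.

Canonical bimod_lmod (R S : rng) (M : bimod R S) : lmod R := Lmod (bm_lactP M).
Coercion bimod_lmod : bimod >-> lmod.

Lemma reg_ractP (R : rng) : right_action (@rmul R).
Proof. by split=> [r x y|m r s|m r s]; rewrite ?rmulDl ?rmulDr ?rmulA. Qed.
Lemma reg_lactP (R : rng) : left_action (@rmul R).
Proof. by split=> [r x y|m r s|m r s]; rewrite ?rmulDl ?rmulDr ?rmulA. Qed.

Canonical reg_rmod (R : rng) : rmod R := Rmod (reg_ractP R).
Canonical reg_lmod (R : rng) : lmod R := Lmod (reg_lactP R).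
Definition reg (R : rng) : bimod R R :=
  @Bimod R R (reg_rmod R) (@rmul R) (reg_lactP R) (@rmulA R).

Definition runital (A : pzRingType) (M : rmod A) : Prop :=
  forall m : M, m <* (1 : A) = m.
Definition lunital (A : pzRingType) (M : lmod A) : Prop :=
  forall m : M, @lact A M (1 : A) m = m.

Definition rlinear (R : rng) (M N : rmod R) (f : M -> N) : Prop :=
  {morph f : x y / x + y} /\ forall m r, f (m <* r) = f m <* r.
Definition llinear (R : rng) (M N : lmod R) (f : M -> N) : Prop :=
  {morph f : x y / x + y} /\ forall r m, f (r *> m) = r *> f m.
Definition bilinear_map (R S : rng) (M N : bimod R S) (f : M -> N) : Prop :=
  @llinear R M N f /\ @rlinear S M N f.

Record rhom (R : rng) (M N : rmod R) := RHom {
  rh_fun :> M -> N;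
  rhP : rlinear rh_fun }.
Record lhom (R : rng) (M N : lmod R) := LHom {
  lh_fun :> M -> N;
  lhP : llinear lh_fun }.

(* M ⊗_R N consists of formal sums of pairs, as finite sequences, modulo the  *)
(* congruence generated by biadditivity and balancedness.                     *)

Section Tensor.
Variables (R : rng) (M : rmod R) (N : lmod R).

Inductive tens_rel : seq (M * N) -> seq (M * N) -> Prop :=
| tens_refl s : tens_rel s s
| tens_sym s t : tens_rel s t -> tens_rel t s
| tens_trans s t u : tens_rel s t -> tens_rel t u -> tens_rel s u
| tens_cat s s' t t' :
    tens_rel s s' -> tens_rel t t' -> tens_rel (s ++ t) (s' ++ t')
| tens_comm s t : tens_rel (s ++ t) (t ++ s)
| tens_zero n : tens_rel [:: (0, n)] [::]
| tens_addl m m' n : tens_rel [:: (m + m', n)] [:: (m, n); (m', n)]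
| tens_addr m n n' : tens_rel [:: (m, n + n')] [:: (m, n); (m, n')]
| tens_bal m r n : tens_rel [:: (m <* r, n)] [:: (m, r *> n)].

Definition tens_relb (s t : seq (M * N)) : bool := `[< tens_rel s t >].

Lemma tens_relb_refl : reflexive tens_relb.
Proof. by move=> s; apply/asboolP; apply: tens_refl. Qed.
Lemma tens_relb_sym : symmetric tens_relb.
Proof. by move=> s t; apply/asboolP/asboolP => /tens_sym. Qed.
Lemma tens_relb_trans : transitive tens_relb.
Proof. by move=> t s u /asboolP st /asboolP tu; apply/asboolP; apply: tens_trans st tu. Qed.

Canonical tens_equiv :=
  EquivRel tens_relb tens_relb_refl tens_relb_sym tens_relb_trans.

Definition tens_quot := {eq_quot tens_equiv}%qT.
HB.instance Definition _ := Quotient.on tens_quot.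
HB.instance Definition _ := Choice.on tens_quot.

Definition tclass (s : seq (M * N)) : tens_quot := \pi_tens_quot%qT s.

Lemma tclassP s t : tclass s = tclass t <-> tens_rel s t.
Proof.
split; first by move/eqmodP/asboolP.
by move=> st; apply/eqmodP/asboolP.
Qed.

Lemma tclassK (x : tens_quot) : tclass (repr x) = x.
Proof. exact: reprK. Qed.

Lemma tclass_ind (P : tens_quot -> Prop) : (forall s, P (tclass s)) -> forall x, P x.
Proof. by move=> h x; rewrite -(tclassK x). Qed.

Lemma repr_tclass s : tens_rel (repr (tclass s)) s.
Proof. by apply/tclassP; rewrite tclassK. Qed.

Definition tens_add (x y : tens_quot) := tclass (repr x ++ repr y).
Definition tens_opp (x : tens_quot) :=
  tclass [seq (- p.1, p.2) | p <- repr x].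

Lemma tens_addE s t : tens_add (tclass s) (tclass t) = tclass (s ++ t).
Proof. by apply/tclassP; apply: tens_cat; apply: repr_tclass. Qed.

Lemma tens_addA : associative tens_add.
Proof.
by elim/tclass_ind=> s; elim/tclass_ind=> t; elim/tclass_ind=> u; rewrite !tens_addE catA.
Qed.
Lemma tens_addC : commutative tens_add.
Proof.
elim/tclass_ind=> s; elim/tclass_ind=> t; rewrite !tens_addE.
by apply/tclassP; apply: tens_comm.
Qed.
Lemma tens_add0 : left_id (tclass [::]) tens_add.
Proof. by elim/tclass_ind=> s; rewrite tens_addE. Qed.
Lemma tens_addN : left_inverse (tclass [::]) tens_opp tens_add.
Proof.
move=> x; rewrite -{2}(tclassK x) tens_addE; apply/tclassP.
elim: (repr x) => [|[m n] s ih] /=; first exact: tens_refl.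
apply: (tens_trans (t := [:: (- m, n); (m, n)] ++ ([seq (- p.1, p.2) | p <- s] ++ s))).
  rewrite -[_ :: _]/([:: (- m, n)] ++ (_ ++ _)).
  rewrite -[[:: (- m, n); _] ++ _]/([:: (- m, n)] ++ ([:: (m, n)] ++ _)).
  apply: tens_cat; first exact: tens_refl.
  rewrite -[(m, n) :: s]/([:: (m, n)] ++ s) !catA.
  by apply: tens_cat; [apply: tens_comm | apply: tens_refl].
rewrite -[[::]]/([::] ++ [::] : seq (M * N)); apply: tens_cat => //.
apply: tens_trans (tens_sym (tens_addl _ _ _)) _.
by rewrite addNr; apply: tens_zero.
Qed.

HB.instance Definition _ :=
  GRing.isZmodule.Build tens_quot tens_addA tens_addC tens_add0 tens_addN.

Definition tens : zmodType := tens_quot.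

Definition pure (m : M) (n : N) : tens := tclass [:: (m, n)].

(* The map out of the tensor product sending m ⊠ n to b m n; it is evaluated  *)
(* on a representative, hence only meaningful when [balanced b].              *)
Definition tlift (X : zmodType) (b : M -> N -> X) (t : tens) : X :=
  \sum_(p <- repr (t : tens_quot)) b p.1 p.2.

Definition balanced (X : zmodType) (b : M -> N -> X) : Prop :=
  [/\ forall n, {morph b^~ n : x y / x + y},
      forall m, {morph b m : x y / x + y}
    & forall m r n, b (m <* r) n = b m (r *> n)].

Lemma pureDl n : {morph pure^~ n : x y / x + y}.
Proof. by move=> x y; rewrite [RHS]tens_addE; apply/tclassP; apply: tens_addl. Qed.
Lemma pureDr m : {morph pure m : x y / x + y}.
Proof. by move=> x y; rewrite [RHS]tens_addE; apply/tclassP; apply: tens_addr. Qed.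
Lemma pure_bal m r n : pure (m <* r) n = pure m (r *> n).
Proof. by apply/tclassP; apply: tens_bal. Qed.
Lemma pure_balanced : balanced pure.
Proof. split; [exact: pureDl | exact: pureDr | exact: pure_bal]. Qed.

Lemma tclass_sum s : tclass s = \sum_(p <- s) pure p.1 p.2 :> tens.
Proof.
elim: s => [|[m n] s ih]; first by rewrite big_nil.
by rewrite big_cons -ih /=; symmetry; apply: (tens_addE [:: (m, n)] s).
Qed.

Lemma tens_sum (t : tens) :
  t = \sum_(p <- repr (t : tens_quot)) pure p.1 p.2.
Proof. by rewrite -tclass_sum tclassK. Qed.

Lemma morph0 (U V : zmodType) (f : U -> V) : {morph f : x y / x + y} -> f 0 = 0.
Proof. by move=> fD; apply: (@addrI _ (f 0)); rewrite -fD !addr0. Qed.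

Lemma morph_sumr (U V : zmodType) (f : U -> V) (I : Type) (s : seq I) (g : I -> U) :
  {morph f : x y / x + y} -> f (\sum_(i <- s) g i) = \sum_(i <- s) f (g i).
Proof. by move=> fD; apply: big_morph => //; apply: morph0. Qed.

Lemma tens_ind (P : tens -> Prop) :
  P 0 -> (forall x y, P x -> P y -> P (x + y)) -> (forall m n, P (pure m n)) ->
  forall t, P t.
Proof.
move=> P0 PD Pp t; rewrite (tens_sum t).
by elim/big_ind: _ => // -[].
Qed.

Lemma tlift_rel (X : zmodType) (b : M -> N -> X) s t : balanced b -> tens_rel s t ->
  \sum_(p <- s) b p.1 p.2 = \sum_(p <- t) b p.1 p.2.
Proof.
case=> bl br bb; elim=> {s t} //.
- by move=> s t u _ -> _ ->.
- by move=> s s' t t' _ e _ e'; rewrite !big_cat /= e e'.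
- by move=> s t; rewrite !big_cat /= addrC.
- by move=> n; rewrite big_seq1 big_nil /= (morph0 (bl n)).
- by move=> m m' n; rewrite !big_cons !big_nil /= !addr0 bl.
- by move=> m n n'; rewrite !big_cons !big_nil /= !addr0 br.
- by move=> m r n; rewrite !big_seq1 /= bb.
Qed.

Section Lift.
Variables (X : zmodType) (b : M -> N -> X).
Hypothesis bP : balanced b.

Lemma tliftE m n : tlift b (pure m n) = b m n.
Proof. by rewrite /tlift (tlift_rel bP (repr_tclass _)) big_seq1. Qed.

Lemma tliftD : {morph tlift b : x y / x + y}.
Proof.
by move=> x y; rewrite {1}/tlift (tlift_rel bP (repr_tclass _)) big_cat.
Qed.
End Lift.

Lemma eq_tlift (X : zmodType) (b b' : M -> N -> X) :
  (forall m n, b m n = b' m n) -> tlift b =1 tlift b'.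
Proof. by move=> e t; apply: eq_bigr. Qed.

Lemma tens_ext (X : zmodType) (f g : tens -> X) :
  {morph f : x y / x + y} -> {morph g : x y / x + y} ->
  (forall m n, f (pure m n) = g (pure m n)) -> f =1 g.
Proof.
move=> fD gD e; elim/tens_ind => [|x y fx fy|//]; first by rewrite !morph0.
by rewrite fD gD fx fy.
Qed.

End Tensor.

Lemma pure0l (R : rng) (M : rmod R) (N : lmod R) (n : N) : pure (0 : M) n = 0.
Proof. exact: morph0 (@pureDl R M N n). Qed.
Lemma pure0r (R : rng) (M : rmod R) (N : lmod R) (m : M) : pure m (0 : N) = 0.
Proof. exact: morph0 (@pureDr R M N m). Qed.

Notation "M ⊗ N" := (tens M N) (at level 40, left associativity) : rng_scope.
Notation "m ⊠ n" := (pure m n) (at level 40, left associativity) : rng_scope.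

Definition tmap (R : rng) (M M' : rmod R) (N N' : lmod R) (f : M -> M') (g : N -> N')
  : M ⊗ N -> M' ⊗ N' := tlift (fun m n => f m ⊠ g n).

Section TensorMap.
Variables (R : rng) (M M' : rmod R) (N N' : lmod R) (f : M -> M') (g : N -> N').
Hypotheses (fP : rlinear f) (gP : llinear g).

Lemma tmap_balanced : balanced (fun m n => f m ⊠ g n).
Proof.
case: fP gP => fD fM [gD gM]; split=> [n x y|m x y|m r n] /=.
- by rewrite fD pureDl.
- by rewrite gD pureDr.
- by rewrite fM gM pure_bal.
Qed.

Lemma tmapE m n : tmap f g (m ⊠ n) = f m ⊠ g n.
Proof. exact: tliftE tmap_balanced _ _. Qed.

Lemma tmapD : {morph tmap f g : x y / x + y}.
Proof. exact: tliftD tmap_balanced. Qed.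
End TensorMap.

Lemma rlinear_id (R : rng) (M : rmod R) : rlinear (@id M). Proof. by []. Qed.
Lemma llinear_id (R : rng) (M : lmod R) : llinear (@id M). Proof. by []. Qed.
Hint Resolve rlinear_id llinear_id rhP lhP : core.

Lemma eq_tmap (R : rng) (M M' : rmod R) (N N' : lmod R) (f f' : M -> M') (g g' : N -> N') :
  f =1 f' -> g =1 g' -> tmap f g =1 tmap f' g'.
Proof. by move=> ef eg; apply: eq_tlift => m n; rewrite ef eg. Qed.

Lemma tmap_id (R : rng) (M : rmod R) (N : lmod R) : tmap (@id M) (@id N) =1 id.
Proof.
apply: tens_ext => [||m n] //; last exact: tmapE.
exact: tmapD.
Qed.

Lemma tmap_comp (R : rng) (M M' M'' : rmod R) (N N' N'' : lmod R)
    (f : M -> M') (f' : M' -> M'') (g : N -> N') (g' : N' -> N'') :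
  rlinear f -> rlinear f' -> llinear g -> llinear g' ->
  forall t, tmap f' g' (tmap f g t) = tmap (f' \o f) (g' \o g) t.
Proof.
move=> fP f'P gP g'P.
have cP : rlinear (f' \o f).
  by case: fP f'P => fD fM [f'D f'M]; split=> [x y|x r] /=; rewrite ?fD ?f'D ?fM ?f'M.
have dP : llinear (g' \o g).
  by case: gP g'P => gD gM [g'D g'M]; split=> [x y|x r] /=; rewrite ?gD ?g'D ?gM ?g'M.
apply: tens_ext => [x y|x y|m n].
- by rewrite !tmapD.
- by rewrite tmapD.
- by rewrite !tmapE.
Qed.

Lemma lact_rlinear (R S : rng) (M : bimod R S) (r : R) :
  @rlinear S M M (fun m : M => r *> m).
Proof. by case: (bm_lactP M) => lD _ _; split=> [x y|m s]; [apply: lD | apply: bm_actC]. Qed.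
Lemma ract_llinear (R S : rng) (M : bimod R S) (s : S) :
  @llinear R M M (fun m : M => m <* s).
Proof.
by case: (ractP M) => rD _ _; split=> [x y|r m]; [apply: rD | rewrite /= bm_actC].
Qed.

Section TensorActions.
Variables (Q R S : rng).

Definition tens_ract (M : rmod R) (N : bimod R S) (t : M ⊗ N) (s : S) : M ⊗ N :=
  tmap id (fun n : N => n <* s) t.
Definition tens_lact (M : bimod Q R) (N : lmod R) (q : Q) (t : M ⊗ N) : M ⊗ N :=
  tmap (fun m : M => q *> m) id t.

Lemma tens_ractP (M : rmod R) (N : bimod R S) : right_action (@tens_ract M N).
Proof.
case: (ractP N) => rD rD' rA.
split=> [s|t r s|t r s].
- by apply: tmapD => //; apply: ract_llinear.
- elim/tens_ind: t => [|x y hx hy|m n]; rewrite /tens_ract.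
  + by rewrite !(morph0 (tmapD _ _)) ?addr0 //; apply: ract_llinear.
  + rewrite !tmapD //; try exact: ract_llinear.
    by rewrite [tmap _ _ x]hx [tmap _ _ y]hy addrACA.
  + by rewrite !tmapE //; try exact: ract_llinear; rewrite /= rD' pureDr.
- rewrite /tens_ract tmap_comp //; try exact: ract_llinear.
  by apply: eq_tmap => // n /=; rewrite rA.
Qed.

Lemma tens_lactP (M : bimod Q R) (N : lmod R) : left_action (@tens_lact M N).
Proof.
case: (bm_lactP M) => lD lD' lA.
split=> [s|t r s|t r s].
- by apply: tmapD => //; apply: lact_rlinear.
- elim/tens_ind: t => [|x y hx hy|m n]; rewrite /tens_lact.
  + by rewrite !(morph0 (tmapD _ _)) ?addr0 //; apply: lact_rlinear.
  + rewrite !tmapD //; try exact: lact_rlinear.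
    by rewrite [tmap _ _ x]hx [tmap _ _ y]hy addrACA.
  + by rewrite !tmapE //; try exact: lact_rlinear; rewrite /= lD' pureDl.
- rewrite /tens_lact tmap_comp //; try exact: lact_rlinear.
  by apply: eq_tmap => // n /=; rewrite lA.
Qed.

Lemma tens_actC (M : bimod Q R) (N : bimod R S) q (t : M ⊗ N) s :
  tens_lact q (tens_ract t s) = tens_ract (tens_lact q t) s.
Proof.
rewrite /tens_lact /tens_ract !tmap_comp //;
  by [exact: ract_llinear | exact: lact_rlinear].
Qed.

Canonical tens_rmod (M : rmod R) (N : bimod R S) : rmod S := Rmod (tens_ractP M N).
Canonical tens_lmod (M : bimod Q R) (N : lmod R) : lmod Q := Lmod (tens_lactP M N).
Definition tens_bimod (M : bimod Q R) (N : bimod R S) : bimod Q S :=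
  @Bimod Q S (tens_rmod M N) (@tens_lact M N) (tens_lactP M N) (@tens_actC M N).

Lemma tens_ractE (M : rmod R) (N : bimod R S) (m : M) (n : N) (s : S) :
  (m ⊠ n : tens_rmod M N) <* s = m ⊠ (n <* s).
Proof. by apply: tmapE => //; apply: ract_llinear. Qed.
Lemma tens_lactE (M : bimod Q R) (N : lmod R) (m : M) (n : N) (q : Q) :
  q *> (m ⊠ n : tens_lmod M N) = (q *> m) ⊠ n.
Proof. by apply: tmapE => //; apply: lact_rlinear. Qed.

End TensorActions.

Notation "M ⊗r N" := (tens_rmod M N) (at level 40, left associativity) : rng_scope.
Notation "M ⊗l N" := (tens_lmod M N) (at level 40, left associativity) : rng_scope.
Notation "M ⊗b N" := (tens_bimod M N) (at level 40, left associativity) : rng_scope.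

Section TensorAssoc.
Variables (R S : rng) (M : rmod R) (N : bimod R S) (P : lmod S).

Definition tassoc (t : (M ⊗r N) ⊗ P) : M ⊗ (N ⊗l P) :=
  tlift (fun (x : M ⊗r N) (p : P) =>
    tlift (fun (m : M) (n : N) => m ⊠ (n ⊠ p : N ⊗l P)) x) t.
Definition tassoc_inv (t : M ⊗ (N ⊗l P)) : (M ⊗r N) ⊗ P :=
  tlift (fun (m : M) (x : N ⊗l P) =>
    tlift (fun (n : N) (p : P) => (m ⊠ n : M ⊗r N) ⊠ p) x) t.

Let bal1 (p : P) : balanced (fun (m : M) (n : N) => m ⊠ (n ⊠ p : N ⊗l P)).
Proof.
split=> [n x y|m x y|m r n] /=.
- by rewrite pureDl.
- by rewrite !pureDl -pureDr.
- by rewrite pure_bal tens_lactE.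
Qed.

Let bal1' : balanced (fun (x : M ⊗r N) (p : P) =>
   tlift (fun (m : M) (n : N) => m ⊠ (n ⊠ p : N ⊗l P)) x).
Proof.
split=> [p|x p q|x s p] /=; first exact: tliftD.
- elim/tens_ind: x => [|x y hx hy|m n].
  + by rewrite !(morph0 (tliftD (bal1 _))) addr0.
  + by rewrite !(tliftD (bal1 _)) hx hy addrACA.
  + by rewrite !tliftE // !pureDr.
- elim/tens_ind: x => [|x y hx hy|m n].
  + case: (ractP (M ⊗r N)) => aD _ _.
    by rewrite (morph0 (aD _)) !(morph0 (tliftD (bal1 _))).
  + case: (ractP (M ⊗r N)) => aD _ _.
    by rewrite aD !(tliftD (bal1 _)) hx hy.
  + by rewrite tens_ractE !tliftE // pure_bal.
Qed.

Lemma tassocE (m : M) (n : N) (p : P) : tassoc ((m ⊠ n : M ⊗r N) ⊠ p) = m ⊠ (n ⊠ p : N ⊗l P).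
Proof. by rewrite /tassoc tliftE // tliftE. Qed.

Lemma tassocD : {morph tassoc : x y / x + y}.
Proof. exact: tliftD. Qed.

Let bal2 (m : M) : balanced (fun (n : N) (p : P) => (m ⊠ n : M ⊗r N) ⊠ p).
Proof.
split=> [p x y|n x y|n s p] /=.
- by rewrite pureDr -pureDl.
- by rewrite pureDr.
- by rewrite -tens_ractE pure_bal.
Qed.

Let bal2' : balanced (fun (m : M) (x : N ⊗l P) =>
   tlift (fun (n : N) (p : P) => (m ⊠ n : M ⊗r N) ⊠ p) x).
Proof.
split=> [x m m'|m|m r x] /=; last 1 first.
- elim/tens_ind: x => [|x y hx hy|n p].
  + case: (lactP (N ⊗l P)) => aD _ _.
    by rewrite (morph0 (aD _)) !(morph0 (tliftD (bal2 _))).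
  + case: (lactP (N ⊗l P)) => aD _ _.
    by rewrite aD !(tliftD (bal2 _)) hx hy.
  + by rewrite tens_lactE !tliftE // pure_bal.
- elim/tens_ind: x => [|x y hx hy|n p].
  + by rewrite !(morph0 (tliftD (bal2 _))) addr0.
  + by rewrite !(tliftD (bal2 _)) hx hy addrACA.
  + by rewrite !tliftE // !pureDl.
- exact: tliftD.
Qed.

Lemma tassoc_invE (m : M) (n : N) (p : P) : tassoc_inv (m ⊠ (n ⊠ p : N ⊗l P)) = (m ⊠ n : M ⊗r N) ⊠ p.
Proof. by rewrite /tassoc_inv tliftE // tliftE. Qed.

Lemma tassoc_invD : {morph tassoc_inv : x y / x + y}.
Proof. exact: tliftD. Qed.

Lemma tassocK : cancel tassoc tassoc_inv.
Proof.
elim/tens_ind=> [|x y hx hy|x p].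
- by rewrite (morph0 tassocD) (morph0 tassoc_invD).
- by rewrite tassocD tassoc_invD hx hy.
elim/tens_ind: x => [|x y hx hy|m n].
- by rewrite pure0l (morph0 tassocD) (morph0 tassoc_invD).
- by rewrite pureDl tassocD tassoc_invD hx hy.
- by rewrite tassocE tassoc_invE.
Qed.

Lemma tassoc_invK : cancel tassoc_inv tassoc.
Proof.
elim/tens_ind=> [|x y hx hy|m x].
- by rewrite (morph0 tassoc_invD) (morph0 tassocD).
- by rewrite tassoc_invD tassocD hx hy.
elim/tens_ind: x => [|x y hx hy|n p].
- by rewrite pure0r (morph0 tassoc_invD) (morph0 tassocD).
- by rewrite pureDr tassoc_invD tassocD hx hy.
- by rewrite tassoc_invE tassocE.
Qed.
End TensorAssoc.

Section TensorAssocNat.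
Variables (R S : rng) (M M' : rmod R) (N N' : bimod R S) (P P' : lmod S).
Variables (f : M -> M') (g : N -> N') (h : P -> P').
Hypotheses (fP : rlinear f) (gP : bilinear_map g) (hP : llinear h).

Lemma tmap_rlinear : @rlinear S (M ⊗r N) (M' ⊗r N') (tmap f g).
Proof.
case: gP => gl gr; split; first exact: tmapD.
move=> t s; elim/tens_ind: t => [|x y hx hy|m n].
- case: (ractP (M ⊗r N)) (ractP (M' ⊗r N')) => aD _ _ [bD _ _].
  by rewrite (morph0 (aD _)) !(morph0 (tmapD fP gl)) (morph0 (bD _)).
- case: (ractP (M ⊗r N)) (ractP (M' ⊗r N')) => aD _ _ [bD _ _].
  by rewrite aD !(tmapD fP gl) bD hx hy.
- by rewrite tens_ractE !tmapE // tens_ractE; case: gr => _ ->.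
Qed.

Lemma tmap_llinear : @llinear R (N ⊗l P) (N' ⊗l P') (tmap g h).
Proof.
case: gP => gl gr; split; first exact: tmapD.
move=> s t; elim/tens_ind: t => [|x y hx hy|m n].
- case: (lactP (N ⊗l P)) (lactP (N' ⊗l P')) => aD _ _ [bD _ _].
  by rewrite (morph0 (aD _)) !(morph0 (tmapD gr hP)) (morph0 (bD _)).
- case: (lactP (N ⊗l P)) (lactP (N' ⊗l P')) => aD _ _ [bD _ _].
  by rewrite aD !(tmapD gr hP) bD hx hy.
- by rewrite tens_lactE !tmapE // tens_lactE; case: gl => _ ->.
Qed.
End TensorAssocNat.

Lemma tassoc_nat (R S : rng) (M M' : rmod R) (N N' : bimod R S) (P P' : lmod S)
    (f : M -> M') (g : N -> N') (h : P -> P') (t : (M ⊗r N) ⊗ P) :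
  rlinear f -> bilinear_map g -> llinear h ->
  tassoc (tmap (tmap f g : M ⊗r N -> M' ⊗r N') h t)
  = tmap f (tmap g h : N ⊗l P -> N' ⊗l P') (tassoc t).
Proof.
move=> fP gP hP; case: (gP) => gl gr.
have fgP : @rlinear S (M ⊗r N) (M' ⊗r N') (tmap f g) by exact: tmap_rlinear.
have ghP : @llinear R (N ⊗l P) (N' ⊗l P') (tmap g h) by exact: tmap_llinear.
elim/tens_ind: t => [|x y hx hy|x p].
- by rewrite (morph0 (tmapD fgP hP)) !(morph0 (@tassocD _ _ _ _ _)) (morph0 (tmapD fP ghP)).
- by rewrite (tmapD fgP hP) !tassocD (tmapD fP ghP) hx hy.
rewrite tmapE //; elim/tens_ind: x => [|x y hx hy|m n].
- rewrite (morph0 (tmapD fP gl)) !pure0l !(morph0 (@tassocD _ _ _ _ _)).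
  by rewrite (morph0 (tmapD fP ghP)).
- by rewrite (tmapD fP gl) !pureDl !tassocD (tmapD fP ghP) hx hy.
- by rewrite tmapE // !tassocE tmapE // tmapE.
Qed.


Definition rmul_map (R : rng) (M : rmod R) (t : M ⊗ reg R) : M :=
  tlift (fun (m : M) (r : R) => m <* r) t.
Definition lmul_map (R : rng) (M : lmod R) (t : reg R ⊗ M) : M :=
  tlift (fun (r : R) (m : M) => r *> m) t.

Definition rfirm (R : rng) (M : rmod R) : Prop := bijective (@rmul_map R M).
Definition lfirm (R : rng) (M : lmod R) : Prop := bijective (@lmul_map R M).
Definition firm_rng (R : rng) : Prop := rfirm (reg R).

Lemma rmul_balanced (R : rng) (M : rmod R) :
  @balanced R M (reg R) M (fun (m : M) (r : R) => m <* r).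
Proof. by case: (ractP M) => aD aD' aA; split=> // m r s /=; rewrite aA. Qed.

Lemma rmul_mapE (R : rng) (M : rmod R) (m : M) (r : R) :
  rmul_map (m ⊠ (r : reg R)) = m <* r.
Proof. exact: tliftE (@rmul_balanced R M) _ _. Qed.

Lemma rmul_mapD (R : rng) (M : rmod R) : {morph @rmul_map R M : x y / x + y}.
Proof. exact: tliftD (@rmul_balanced R M). Qed.

Lemma inj_surj_bij (T U : Type) (f : T -> U) :
  injective f -> (forall y, exists x, f x = y) -> bijective f.
Proof.
move=> fI fS; exists (fun y => proj1_sig (cid (fS y))) => [x|y].
  by apply: fI; exact: (proj2_sig (cid (fS (f x)))).
exact: (proj2_sig (cid (fS y))).
Qed.

Lemma additive_inj (U V : zmodType) (f : U -> V) : {morph f : x y / x + y} ->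
  (forall x, f x = 0 -> x = 0) -> injective f.
Proof.
move=> fD fk x y e; apply/eqP; rewrite -subr_eq0; apply/eqP; apply: fk.
apply: (@addIr _ (f y)).
by rewrite -fD subrK e add0r.
Qed.

Lemma rfirmP (R : rng) (M : rmod R) : has_idempotent_local_units R ->
  rfirm M <-> forall m : M, exists2 e : R, e ⋆ e = e & m <* e = m.
Proof.
case: (ractP M) => aD aD' aA hR; split=> [[g gK Kg] m|h].
  rewrite -(Kg m); move: (g m) => t.
  have [e ee he] := hR [seq p.2 | p <- repr (t : tens_quot M (reg R))].
  exists e => //; rewrite /rmul_map /tlift (morph_sumr _ _ (aD e)).
  rewrite big_seq [RHS]big_seq; apply: eq_bigr => p pt.
  by rewrite aA (proj2 (he _ (map_f _ pt))).
apply: inj_surj_bij => [|m]; last first.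
  by have [e _ he] := h m; exists (m ⊠ (e : reg R)); rewrite rmul_mapE.
apply: additive_inj => [|t]; first exact: rmul_mapD.
have [e ee he] := hR [seq p.2 | p <- repr (t : tens_quot M (reg R))].
move=> t0; rewrite (tens_sum t).
transitivity (rmul_map t ⊠ (e : reg R)); last by rewrite t0 pure0l.
rewrite /rmul_map /tlift (morph_sumr _ _ (pureDl _)).
rewrite big_seq [RHS]big_seq; apply: eq_bigr => p pt.
by rewrite pure_bal -[in LHS](proj2 (he _ (map_f _ pt))).
Qed.

Lemma reg_firm (R : rng) : has_idempotent_local_units R -> firm_rng R.
Proof.
by move=> hR; apply/rfirmP => // r; have [e ee he] := hR [:: r]; exists e => //;
   case: (he r); rewrite // inE.
Qed.

Lemma tens_reg_firm (R : rng) (M : rmod R) :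
  has_idempotent_local_units R -> rfirm (M ⊗r reg R).
Proof.
move=> hR; apply/rfirmP => // t.
have [e ee he] := hR [seq p.2 | p <- repr (t : tens_quot M (reg R))].
exists e => //; case: (ractP (M ⊗r reg R)) => aD _ _.
move: he (tens_sum t); move: (repr _) => s he ->.
rewrite (morph_sumr _ _ (aD e)).
rewrite big_seq [RHS]big_seq; apply: eq_bigr => p pt.
by rewrite tens_ractE -[in RHS](proj2 (he _ (map_f _ pt))).
Qed.

Lemma rhom_eq (R : rng) (M N : rmod R) (f g : rhom M N) : f =1 g -> f = g.
Proof.
case: f g => f fP [g gP] /= /funext e; case: _ / e in gP *.
by rewrite (Prop_irrelevance fP gP).
Qed.
Lemma lhom_eq (R : rng) (M N : lmod R) (f g : lhom M N) : f =1 g -> f = g.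
Proof.
case: f g => f fP [g gP] /= /funext e; case: _ / e in gP *.
by rewrite (Prop_irrelevance fP gP).
Qed.
Lemma rng_hom_eq (R S : rng) (f g : rng_hom R S) : f =1 g -> f = g.
Proof.
case: f g => f fP fQ [g gP gQ] /= /funext e; case: _ / e in gP gQ *.
by rewrite (Prop_irrelevance fP gP) (Prop_irrelevance fQ gQ).
Qed.

Section RHomZmod.
Variables (R : rng) (M N : rmod R).
Implicit Types f g : rhom M N.

HB.instance Definition _ := gen_eqMixin (rhom M N).
HB.instance Definition _ := gen_choiceMixin (rhom M N).

Lemma rhom0P : @rlinear R M N (fun=> 0).
Proof.
by case: (ractP N) => aD _ _; split=> [x y|x r]; rewrite ?addr0 // (morph0 (aD r)).
Qed.
Lemma rhomDP f g : rlinear (fun m => f m + g m).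
Proof.
case: (ractP N) (rhP f) (rhP g) => aD _ _ [fD fM] [gD gM]; split=> [x y|x r].
  by rewrite fD gD addrACA.
by rewrite fM gM aD.
Qed.
Lemma rhomNP f : rlinear (fun m => - f m).
Proof.
case: (ractP N) (rhP f) => aD _ _ [fD fM]; split=> [x y|x r].
  by rewrite fD opprD.
by rewrite fM; apply: (@addIr _ (f x <* r)); rewrite -aD !addNr (morph0 (aD r)).
Qed.

Definition rhom_zero : rhom M N := RHom rhom0P.
Definition rhom_add f g : rhom M N := RHom (rhomDP f g).
Definition rhom_opp f : rhom M N := RHom (rhomNP f).

Lemma rhom_addA : associative rhom_add.
Proof. by move=> f g h; apply: rhom_eq => m /=; rewrite addrA. Qed.
Lemma rhom_addC : commutative rhom_add.
Proof. by move=> f g; apply: rhom_eq => m /=; rewrite addrC. Qed.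
Lemma rhom_add0 : left_id rhom_zero rhom_add.
Proof. by move=> f; apply: rhom_eq => m /=; rewrite add0r. Qed.
Lemma rhom_addN : left_inverse rhom_zero rhom_opp rhom_add.
Proof. by move=> f; apply: rhom_eq => m /=; rewrite addNr. Qed.

HB.instance Definition _ :=
  GRing.isZmodule.Build (rhom M N) rhom_addA rhom_addC rhom_add0 rhom_addN.
End RHomZmod.

Lemma rlinear_comp (R : rng) (M N P : rmod R) (g : N -> P) (f : M -> N) :
  rlinear g -> rlinear f -> rlinear (g \o f).
Proof. by case=> gD gM [fD fM]; split=> [x y|x r] /=; rewrite ?fD ?gD ?fM ?gM. Qed.
Lemma llinear_comp (R : rng) (M N P : lmod R) (g : N -> P) (f : M -> N) :
  llinear g -> llinear f -> llinear (g \o f).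
Proof. by case=> gD gM [fD fM]; split=> [x y|x r] /=; rewrite ?fD ?gD ?fM ?gM. Qed.

Definition rhom_id (R : rng) (M : rmod R) : rhom M M := RHom (@rlinear_id R M).
Definition rhom_comp (R : rng) (M N P : rmod R) (g : rhom N P) (f : rhom M N) :
  rhom M P := RHom (rlinear_comp (rhP g) (rhP f)).
Definition lhom_id (R : rng) (M : lmod R) : lhom M M := LHom (@llinear_id R M).
Definition lhom_comp (R : rng) (M N P : lmod R) (g : lhom N P) (f : lhom M N) :
  lhom M P := LHom (llinear_comp (lhP g) (lhP f)).

Section Dual.
Variable A : pzRingType.

Definition dual_car (M : rmod A) : zmodType := rhom M (reg A).

Section DualLeft.
Variable M : rmod A.

Lemma dual_lact_subproof (a : A) (f : dual_car M) :
  @rlinear A M (reg A) (fun m => (a : rng_of_pzRing A) ⋆ f m).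
Proof.
case: (rhP f) => fD fM; split=> [x y|x r].
  by rewrite fD rmulDr.
by rewrite fM /= mulrA.
Qed.
Definition dual_lact (a : rng_of_pzRing A) (f : dual_car M) : dual_car M :=
  RHom (dual_lact_subproof a f).

Lemma dual_lactP : left_action dual_lact.
Proof.
split=> [a f g|f a b|f a b]; apply: rhom_eq => m /=.
- by rewrite mulrDr.
- by rewrite mulrDl.
- by rewrite mulrA.
Qed.

Definition dual : lmod A := Lmod dual_lactP.

Lemma dual_unital : lunital dual.
Proof. by move=> f; apply: rhom_eq => m /=; rewrite mul1r. Qed.
End DualLeft.

Section DualRight.
Variables (R : rng) (S : bimod R A).

Definition dual_ract (f : dual_car S) (r : R) : dual_car S :=
  RHom (rlinear_comp (rhP f) (lact_rlinear S r)).

Lemma dual_ractP : right_action dual_ract.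
Proof.
case: (bm_lactP S) => lD lD' lA.
split=> [r f g|f r s|f r s]; apply: rhom_eq => m //=; case: (rhP f) => fD fM.
- by rewrite lD' fD.
- by rewrite lA.
Qed.

Lemma dual_actC a f r : dual_lact a (dual_ract f r) = dual_ract (dual_lact a f) r.
Proof. by apply: rhom_eq. Qed.

Definition dual_rmod : rmod R := Rmod dual_ractP.
Definition dual_bimod : bimod A R :=
  @Bimod A R dual_rmod (@dual_lact S) (@dual_lactP S) dual_actC.
End DualRight.
End Dual.

Record category := Category {
  obj :> Type;
  hom : obj -> obj -> Type;
  idm : forall X, hom X X;
  comp : forall X Y Z, hom Y Z -> hom X Y -> hom X Z;
  comp1m : forall X Y (f : hom X Y), comp (idm Y) f = f;
  compm1 : forall X Y (f : hom X Y), comp f (idm X) = f;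
  compA : forall X Y Z T (h : hom Z T) (g : hom Y Z) (f : hom X Y),
    comp h (comp g f) = comp (comp h g) f }.

Notation "g ∘ f" := (comp g f) (at level 40, left associativity) : rng_scope.

Record functor (C D : category) := Functor {
  fobj :> C -> D;
  fmap : forall X Y, hom X Y -> hom (fobj X) (fobj Y);
  fmap1 : forall X, fmap (idm X) = idm (fobj X);
  fmapM : forall X Y Z (g : hom Y Z) (f : hom X Y), fmap (g ∘ f) = fmap g ∘ fmap f }.

Definition fun_id (C : category) : functor C C :=
  @Functor C C id (fun _ _ f => f) (fun _ => erefl) (fun _ _ _ _ _ => erefl).

Lemma fun_comp1 (C D E : category) (G : functor D E) (F : functor C D) (X : C) :
  fmap G (fmap F (idm X)) = idm (G (F X)).
Proof. by rewrite !fmap1. Qed.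
Lemma fun_compM (C D E : category) (G : functor D E) (F : functor C D) (X Y Z : C)
    (g : hom Y Z) (f : hom X Y) :
  fmap G (fmap F (g ∘ f)) = fmap G (fmap F g) ∘ fmap G (fmap F f).
Proof. by rewrite !fmapM. Qed.
Definition fun_comp (C D E : category) (G : functor D E) (F : functor C D) : functor C E :=
  @Functor C E (fun X => G (F X)) (fun X Y f => fmap G (fmap F f))
    (@fun_comp1 C D E G F) (@fun_compM C D E G F).

Definition is_iso (C : category) (X Y : C) (f : hom X Y) : Prop :=
  exists2 g : hom Y X, g ∘ f = idm X & f ∘ g = idm Y.

Definition nat_iso (C D : category) (F G : functor C D) : Prop :=
  exists2 t : forall X, hom (F X) (G X),
    forall X Y (f : hom X Y), t Y ∘ fmap F f = fmap G f ∘ t X &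
    forall X, is_iso (t X).

Definition inverse_equivalences (C D : category) (F : functor C D) (G : functor D C) :=
  nat_iso (fun_comp G F) (fun_id C) /\ nat_iso (fun_comp F G) (fun_id D).

Definition is_colim (J D : category) (P : functor J D) (L : D) : Prop :=
  exists2 leg : forall i, hom (P i) L,
    forall i j (a : hom i j), leg j ∘ fmap P a = leg i &
    forall (X : D) (x : forall i, hom (P i) X),
      (forall i j (a : hom i j), x j ∘ fmap P a = x i) ->
      exists! h : hom L X, forall i, h ∘ leg i = x i.

Section FullSubcategory.
Variables (D : category) (p : D -> Prop).

Record full_obj := FullObj { full_val :> D; full_prop : p full_val }.

Definition full_subcategory : category :=
  @Category full_obj (fun X Y => hom X Y) (fun X => idm X)
    (fun X Y Z g f => g ∘ f) (fun X Y f => comp1m f) (fun X Y f => compm1 f)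
    (fun X Y Z T h g f => compA h g f).

Definition full_incl : functor full_subcategory D :=
  @Functor full_subcategory D full_val (fun _ _ f => f)
    (fun _ => erefl) (fun _ _ _ _ _ => erefl).
End FullSubcategory.

Section SplitCategory.
Variable D : category.

Record split_hom (P Q : D) := SplitHom {
  sh_sect : hom P Q;
  sh_retr : hom Q P;
  sh_retrK : sh_retr ∘ sh_sect = idm P }.

Lemma split_hom_eq (P Q : D) (f g : split_hom P Q) :
  sh_sect f = sh_sect g -> sh_retr f = sh_retr g -> f = g.
Proof.
case: f g => s t e [s' t' e'] /= es et; case: _ / es in e' *.
by case: _ / et in e' *; rewrite (Prop_irrelevance e e').
Qed.

Definition split_id (P : D) : split_hom P P := SplitHom (comp1m (idm P)).

Lemma split_comp_subproof (P Q T : D) (g : split_hom Q T) (f : split_hom P Q) :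
  (sh_retr f ∘ sh_retr g) ∘ (sh_sect g ∘ sh_sect f) = idm P.
Proof. by rewrite compA -(compA (sh_retr f)) sh_retrK compm1 sh_retrK. Qed.
Definition split_comp (P Q T : D) (g : split_hom Q T) (f : split_hom P Q) :
  split_hom P T := SplitHom (split_comp_subproof g f).

Lemma split_comp1m P Q (f : split_hom P Q) : split_comp (split_id Q) f = f.
Proof. by apply: split_hom_eq; rewrite /= ?comp1m ?compm1. Qed.
Lemma split_compm1 P Q (f : split_hom P Q) : split_comp f (split_id P) = f.
Proof. by apply: split_hom_eq; rewrite /= ?comp1m ?compm1. Qed.
Lemma split_compA P Q S T (h : split_hom S T) (g : split_hom Q S) (f : split_hom P Q) :
  split_comp h (split_comp g f) = split_comp (split_comp h g) f.
Proof. by apply: split_hom_eq; rewrite /= compA. Qed.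

Definition split_category : category :=
  @Category D split_hom split_id split_comp split_comp1m split_compm1 split_compA.

Definition split_forget : functor split_category D :=
  @Functor split_category D id (fun _ _ f => sh_sect f)
    (fun _ => erefl) (fun _ _ _ _ _ => erefl).
End SplitCategory.

Section PosetCategory.
Variables (d : Order.disp_t) (Z : porderType d).

Definition directed : Prop :=
  inhabited Z /\ forall i j : Z, exists2 k : Z, (i <= k)%O & (j <= k)%O.

Definition poset_category : category :=
  @Category Z (fun i j => is_true (i <= j)%O) (fun i => Order.POrderTheory.lexx i)
    (fun i j k jk ij => Order.POrderTheory.le_trans ij jk)
    (fun _ _ _ => bool_irrelevance _ _) (fun _ _ _ => bool_irrelevance _ _)
    (fun _ _ _ _ _ _ _ => bool_irrelevance _ _).
End PosetCategory.

Definition rng_hom_id (R : rng) : rng_hom R R :=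
  @RngHom R R id (fun _ _ => erefl) (fun _ _ => erefl).
Lemma rng_hom_compD (R S T : rng) (g : rng_hom S T) (f : rng_hom R S) :
  {morph (g \o f) : x y / x + y}.
Proof. by move=> x y /=; rewrite !rng_homD. Qed.
Lemma rng_hom_compM (R S T : rng) (g : rng_hom S T) (f : rng_hom R S) :
  {morph (g \o f) : x y / x ⋆ y}.
Proof. by move=> x y /=; rewrite !rng_homM. Qed.
Definition rng_hom_comp (R S T : rng) (g : rng_hom S T) (f : rng_hom R S) :=
  RngHom (rng_hom_compD g f) (rng_hom_compM g f).

Definition RngCat : category.
Proof.
refine (@Category rng rng_hom rng_hom_id rng_hom_comp _ _ _);
  by move=> *; apply: rng_hom_eq.
Defined.

Record ulmod (A : pzRingType) := ULmod {
  ul_lmod :> lmod A;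
  ul_unital : lunital ul_lmod }.
Definition LModCat (A : pzRingType) : category.
Proof.
refine (@Category (ulmod A) (fun M N => lhom M N) (fun M => lhom_id M)
  (fun M N P g f => lhom_comp g f) _ _ _); by move=> *; apply: lhom_eq.
Defined.

Record frmod (R : rng) := FRmod {
  fr_rmod :> rmod R;
  fr_firm : rfirm fr_rmod }.
Definition FirmModCat (R : rng) : category.
Proof.
refine (@Category (frmod R) (fun M N => rhom M N) (fun M => rhom_id M)
  (fun M N P g f => rhom_comp g f) _ _ _); by move=> *; apply: rhom_eq.
Defined.

Record precoring (A : rng) := Precoring {
  pc_bimod :> bimod A A;
  comult : pc_bimod -> pc_bimod ⊗ pc_bimod;
  counit : pc_bimod -> A }.

Record is_coring (A : pzRingType) (C : precoring A) : Prop := IsCoring {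
  cg_lunital : @lunital A C;
  cg_runital : @runital A C;
  comultP : @bilinear_map A A C (C ⊗b C) (@comult A C);
  counitP : @bilinear_map A A C (reg A) (@counit A C);
  comultA : forall c : C,
    tassoc (tmap (@comult A C : C -> C ⊗r C) id (comult c))
    = tmap id (@comult A C : C -> C ⊗l C) (comult c);
  counitl : forall c : C, tlift (fun x y : C => @lact A C (counit x) y) (comult c) = c;
  counitr : forall c : C, tlift (fun x y : C => @ract A C x (counit y)) (comult c) = c }.

Record coring (A : pzRingType) := Coring {
  cg_precoring :> precoring A;
  coringP : is_coring cg_precoring }.

Definition precoring_iso (A : rng) (D C : precoring A) (f : D -> C) : Prop :=
  [/\ bijective f, @bilinear_map A A D C f,
      forall x, counit (f x) = counit x
    & forall x, comult (f x) = tmap (f : D -> C) (f : D -> C) (comult x)].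

Record is_comod (A : pzRingType) (C : coring A) (M : rmod A) (rho : M -> M ⊗ C) : Prop :=
  IsComod {
  cm_unital : runital M;
  rho_linear : @rlinear A M (M ⊗r C) rho;
  rho_coassoc : forall m : M,
    tassoc (tmap (rho : M -> M ⊗r C) id (rho m))
    = tmap id (@comult A C : C -> C ⊗l C) (rho m);
  rho_counit : forall m : M,
    tlift (fun (x : M) (c : C) => x <* counit c) (rho m) = m }.

Record comod (A : pzRingType) (C : coring A) := Comod {
  cm_rmod :> rmod A;
  rho : cm_rmod -> cm_rmod ⊗ C;
  comodP : is_comod rho }.

Definition colinear (A : pzRingType) (C : coring A) (M N : comod C) (f : M -> N) : Prop :=
  forall m : M, rho (f m) = tmap f (@id C) (rho m).

Record chom (A : pzRingType) (C : coring A) (M N : comod C) := CHom {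
  ch_rhom :> rhom M N;
  chP : colinear ch_rhom }.

Section ComodCategory.
Variables (A : pzRingType) (C : coring A).
Implicit Types M N P : comod C.

Lemma chom_eq M N (f g : chom M N) : f =1 g -> f = g.
Proof.
case: f g => f fP [g gP] /= /rhom_eq e; case: _ / e in gP *.
by rewrite (Prop_irrelevance fP gP).
Qed.

Lemma colinear_id M : colinear (rhom_id M).
Proof. by move=> m; rewrite tmap_id. Qed.
Lemma colinear_comp M N P (g : chom N P) (f : chom M N) :
  colinear (rhom_comp g f).
Proof.
move=> m; rewrite /= (chP g) (chP f) tmap_comp //.
Qed.

Definition chom_id M : chom M M := CHom (@colinear_id M).
Definition chom_comp M N P (g : chom N P) (f : chom M N) : chom M P :=
  CHom (colinear_comp g f).

Definition ComodCat : category.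
Proof.
refine (@Category (comod C) (fun M N => chom M N) chom_id chom_comp _ _ _);
  by move=> *; apply: chom_eq.
Defined.

Section CHomZmod.
Variables M N : comod C.
Implicit Types f g : chom M N.

HB.instance Definition _ := gen_eqMixin (chom M N).
HB.instance Definition _ := gen_choiceMixin (chom M N).

Lemma chom0P : colinear (rhom_zero M N).
Proof.
move=> m /=; rewrite (morph0 (proj1 (rho_linear (comodP N)))).
by rewrite /tmap /tlift big1 // => p _; rewrite /= pure0l.
Qed.
Lemma chomDP f g : colinear (rhom_add f g).
Proof.
move=> m /=; rewrite (proj1 (rho_linear (comodP N))) (chP f) (chP g).
rewrite /tmap /tlift -big_split; apply: eq_bigr => p _ /=.
by rewrite pureDl.
Qed.
Lemma chomNP f : colinear (rhom_opp f).
Proof.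
move=> m; apply: (@addIr _ (rho (f m))).
rewrite -(proj1 (rho_linear (comodP N))) /= addNr.
rewrite (morph0 (proj1 (rho_linear (comodP N)))) (chP f).
rewrite /tmap /tlift -big_split big1 // => p _ /=.
by rewrite -pureDl /= addNr pure0l.
Qed.

Definition chom_zero : chom M N := CHom chom0P.
Definition chom_add f g : chom M N := CHom (chomDP f g).
Definition chom_opp f : chom M N := CHom (chomNP f).

Lemma chom_addA : associative chom_add.
Proof. by move=> f g h; apply: chom_eq => m /=; rewrite addrA. Qed.
Lemma chom_addC : commutative chom_add.
Proof. by move=> f g; apply: chom_eq => m /=; rewrite addrC. Qed.
Lemma chom_add0 : left_id chom_zero chom_add.
Proof. by move=> f; apply: chom_eq => m /=; rewrite add0r. Qed.
Lemma chom_addN : left_inverse chom_zero chom_opp chom_add.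
Proof. by move=> f; apply: chom_eq => m /=; rewrite addNr. Qed.

HB.instance Definition _ :=
  GRing.isZmodule.Build (chom M N) chom_addA chom_addC chom_add0 chom_addN.
End CHomZmod.

Section EndRing.
Variable M : comod C.

Lemma end_mulA : associative (@chom_comp M M M).
Proof. by move=> f g h; apply: chom_eq. Qed.
Lemma end_mulDl : @left_distributive (chom M M) (chom M M) (@chom_comp M M M) +%R.
Proof. by move=> f g h; apply: chom_eq. Qed.
Lemma end_mulDr : @right_distributive (chom M M) (chom M M) (@chom_comp M M M) +%R.
Proof. by move=> f g h; apply: chom_eq => m /=; case: (rhP f) => ->. Qed.

Definition End_rng : rng := Rng end_mulA end_mulDl end_mulDr.
End EndRing.

Definition finitely_generated (M : rmod A) : Prop :=
  exists (n : nat) (g : 'I_n -> M), forall m : M,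
    exists c : 'I_n -> A, m = \sum_(i < n) g i <* c i.

Definition projective (M : rmod A) : Prop :=
  forall (X Y : rmod A) (p : rhom X Y) (f : rhom M Y),
    runital X -> runital Y -> (forall y, exists x, p x = y) ->
    exists g : rhom M X, forall m, p (g m) = f m.

Definition FgpComodCat : category :=
  @full_subcategory ComodCat
    (fun M : comod C => finitely_generated M /\ projective M).

(* A split direct system composed with [split_dual], (s, t) |-> (f |-> f t),   *)
(* gives the system of the P_i^*, and with [split_end],                       *)
(* (s, t) |-> (x |-> s x t), the system of the T_i = End^C(P_i).              *)

Definition fgp_val (M : FgpComodCat) : comod C := full_val M.
Definition fgp_sect (M N : FgpComodCat) (f : @hom (split_category FgpComodCat) M N) :
  chom (fgp_val M) (fgp_val N) := sh_sect f.
Definition fgp_retr (M N : FgpComodCat) (f : @hom (split_category FgpComodCat) M N) :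
  chom (fgp_val N) (fgp_val M) := sh_retr f.

Definition udual (M : rmod A) : ulmod A := ULmod (@dual_unital A M).

Lemma dual_map_subproof (M N : rmod A) (h : rhom N M) :
  @llinear A (dual M) (dual N) (fun f : dual M => rhom_comp f h : dual N).
Proof. by split=> [f g|a f]; apply: rhom_eq. Qed.
Definition dual_map (M N : rmod A) (h : rhom N M) : lhom (dual M) (dual N) :=
  LHom (dual_map_subproof h).

Definition split_dual : functor (split_category FgpComodCat) (LModCat A).
Proof.
refine (@Functor (split_category FgpComodCat) (LModCat A)
  (fun X => udual (fgp_val X)) (fun X Y f => dual_map (fgp_retr f)) _ _).
- by move=> M; apply: lhom_eq => f; apply: rhom_eq.
- by move=> M N P g f; apply: lhom_eq => x; apply: rhom_eq.
Defined.

Section SplitEndMap.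
Variables (M N : FgpComodCat) (f : @hom (split_category FgpComodCat) M N).

Definition split_end_fun (t : End_rng (fgp_val M)) : End_rng (fgp_val N) :=
  chom_comp (fgp_sect f) (chom_comp t (fgp_retr f)).

Lemma split_end_funD : {morph split_end_fun : x y / x + y}.
Proof.
by move=> s t; apply: chom_eq => m /=; case: (rhP (fgp_sect f)) => ->.
Qed.
Lemma split_end_funM : {morph split_end_fun : x y / x ⋆ y}.
Proof.
move=> s t; apply: chom_eq => m /=.
congr (fgp_sect f (s _)); symmetry.
have /(congr1 (fun h : chom (fgp_val M) (fgp_val M) => h (t (fgp_retr f m)))) := sh_retrK f.
by [].
Qed.
Definition split_end_map : rng_hom (End_rng (fgp_val M)) (End_rng (fgp_val N)) :=
  RngHom split_end_funD split_end_funM.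
End SplitEndMap.

Definition split_end : functor (split_category FgpComodCat) RngCat.
Proof.
refine (@Functor (split_category FgpComodCat) RngCat
  (fun X => End_rng (fgp_val X)) split_end_map _ _).
- by move=> M; apply: rng_hom_eq => t; apply: chom_eq.
- by move=> M N P g f; apply: rng_hom_eq => t; apply: chom_eq.
Defined.

Definition split_underlying : functor (split_category FgpComodCat) ComodCat :=
  fun_comp (@full_incl ComodCat _) (split_forget FgpComodCat).

End ComodCategory.


Record is_bicomod (R : rng) (A : pzRingType) (C : coring A) (M : comod C)
    (act : R -> M -> M) : Prop := IsBicomod {
  bc_left_action : left_action act;
  bc_firm : lfirm (Lmod bc_left_action);
  bc_actC : forall r (m : M) (a : A), act r (@ract A M m a) = @ract A M (act r m) a;
  bc_rho : forall r (m : M), rho (act r m) = tmap (act r) (@id C) (rho m) }.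

Record bicomod (R : rng) (A : pzRingType) (C : coring A) := Bicomod {
  bc_comod :> comod C;
  bc_act : R -> bc_comod -> bc_comod;
  bicomodP : is_bicomod bc_act }.

Canonical bicomod_bimod (R : rng) (A : pzRingType) (C : coring A) (M : bicomod R C) :
    bimod R A :=
  @Bimod R A (cm_rmod (bc_comod M)) (@bc_act R A C M)
    (bc_left_action (bicomodP M)) (bc_actC (bicomodP M)).
Coercion bicomod_bimod : bicomod >-> bimod.

Record is_lbicomod (A : pzRingType) (C : coring A) (R : rng) (L : bimod A R)
    (lam : L -> C ⊗ L) : Prop := IsLbicomod {
  lb_unital : @lunital A L;
  lb_firm : @rfirm R L;
  lam_linear : @bilinear_map A R L (C ⊗b L) lam;
  lam_coassoc : forall l : L,
    tassoc (tmap (@comult A C : C -> C ⊗r C) id (lam l))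
    = tmap id (lam : L -> C ⊗l L) (lam l);
  lam_counit : forall l : L,
    tlift (fun (c : C) (x : L) => @lact A L (counit c) x) (lam l) = l }.

Record lbicomod (A : pzRingType) (C : coring A) (R : rng) := Lbicomod {
  lb_bimod :> bimod A R;
  lam : lb_bimod -> C ⊗ lb_bimod;
  lbicomodP : is_lbicomod lam }.

Definition lbicomod_ulmod (A : pzRingType) (C : coring A) (R : rng) (L : lbicomod C R) :
  ulmod A := @ULmod A L (lb_unital (lbicomodP L)).

Section TensorFunctor.
Variables (R : rng) (A : pzRingType) (C : coring A) (S : bicomod R C).

Lemma rho_llinear : @llinear R S (S ⊗l C) (@rho A C S).
Proof.
split; first by case: (rho_linear (comodP S)).
by move=> r m; rewrite [LHS](bc_rho (bicomodP S)).
Qed.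

Section TensorComod.
Variable M : rmod R.

Definition tens_rho (t : M ⊗ S) : (M ⊗r S) ⊗ C :=
  tassoc_inv (tmap (@id M) (@rho A C S : S -> S ⊗l C) t).

Definition pure_map (m : M) (u : S) : M ⊗r S := m ⊠ u.

Lemma pure_map_linear m : @rlinear A S (M ⊗r S) (pure_map m).
Proof. by split=> [x y|x a]; [apply: pureDr | rewrite tens_ractE]. Qed.

Lemma tassoc_inv_pure m (x : S ⊗ C) :
  tassoc_inv (m ⊠ (x : S ⊗l C)) = tmap (pure_map m) (@id C) x.
Proof.
elim/tens_ind: x => [|x y hx hy|u c].
- by rewrite pure0r (morph0 (@tassoc_invD _ _ _ _ _)) (morph0 (tmapD (pure_map_linear m) _)).
- by rewrite pureDr tassoc_invD hx hy (tmapD (pure_map_linear m)).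
- by rewrite tassoc_invE tmapE //; apply: pure_map_linear.
Qed.

Lemma tens_rhoE m (u : S) : tens_rho (m ⊠ u) = tmap (pure_map m) (@id C) (rho u).
Proof. by rewrite /tens_rho tmapE; [rewrite tassoc_inv_pure | | exact: rho_llinear]. Qed.

Lemma tens_rhoD : {morph tens_rho : x y / x + y}.
Proof. by move=> x y; rewrite /tens_rho tmapD ?tassoc_invD //; exact: rho_llinear. Qed.

Lemma tens_rho_linear : @rlinear A (M ⊗r S) ((M ⊗r S) ⊗r C) tens_rho.
Proof.
split; first exact: tens_rhoD.
move=> t a; elim/tens_ind: t => [|x y hx hy|m u].
- case: (ractP (M ⊗r S)) (ractP ((M ⊗r S) ⊗r C)) => aD _ _ [bD _ _].
  by rewrite (morph0 (aD _)) !(morph0 tens_rhoD) (morph0 (bD _)).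
- case: (ractP (M ⊗r S)) (ractP ((M ⊗r S) ⊗r C)) => aD _ _ [bD _ _].
  by rewrite aD !tens_rhoD hx hy bD.
- rewrite tens_ractE !tens_rhoE.
  have [_ ->] := rho_linear (comodP S).
  have [_ h] := @tmap_rlinear A A S (M ⊗r S) C C (pure_map m) id (pure_map_linear m)
    (conj (@llinear_id _ _) (@rlinear_id _ _)).
  exact: h.
Qed.

Lemma comult_llinear : @llinear A C (C ⊗l C) (@comult A C).
Proof. by case: (comultP (coringP C)). Qed.

Lemma tens_is_comod : @is_comod A C (M ⊗r S) tens_rho.
Proof.
have idC : @bilinear_map A A C C id by split.
split; last 2 first.
- move=> t; have cD := tmapD (@rlinear_id _ (M ⊗r S)) comult_llinear.
  have rD := tmapD tens_rho_linear (@llinear_id _ C).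
  elim/tens_ind: t => [|x y hx hy|m u].
  + by rewrite !(morph0 tens_rhoD) (morph0 rD) (morph0 cD) (morph0 (@tassocD _ _ _ _ _)).
  + by rewrite !tens_rhoD rD cD tassocD hx hy.
  rewrite !tens_rhoE tmap_comp //; [|exact: pure_map_linear|exact: tens_rho_linear].
  rewrite (eq_tmap (f' := (tmap (pure_map m) (@id C) : S ⊗r C -> (M ⊗r S) ⊗r C) \o
     (@rho A C S : S -> S ⊗r C)) (g' := @id C \o @id C)) //; last first.
    by move=> v /=; rewrite tens_rhoE.
  rewrite -tmap_comp //; last first.
  + by apply: tmap_rlinear => //; apply: pure_map_linear.
  + by case: (comodP S).
  rewrite tassoc_nat //; last exact: pure_map_linear.
  rewrite (rho_coassoc (comodP S)) !tmap_comp //;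
    try by [exact: pure_map_linear | exact: comult_llinear].
  + by apply: eq_tmap => // c /=; rewrite tmap_id.
  + by apply: tmap_llinear.
- move=> t.
  have bal (X : comod C) :
      @balanced A X C X (fun (x : X) (c : C) => x <* (counit c : A)).
    case: (ractP X) (counitP (coringP C)) => aD aD' aA [[eD el] _].
    split=> [c x y|x c c'|x a c] /=; first exact: aD.
      by rewrite eD aD'.
    by rewrite aA el.
  have bal' : @balanced A (M ⊗r S) C (M ⊗r S)
      (fun (x : M ⊗r S) (c : C) => x <* (counit c : A)).
    case: (ractP (M ⊗r S)) (counitP (coringP C)) => aD aD' aA [[eD el] _].
    split=> [c x y|x c c'|x a c] /=; first exact: aD.
      by rewrite eD aD'.
    by rewrite aA el.
  elim/tens_ind: t => [|x y hx hy|m u].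
  + by rewrite (morph0 tens_rhoD) (morph0 (tliftD bal')).
  + by rewrite tens_rhoD (tliftD bal') hx hy.
  rewrite tens_rhoE -{2}(rho_counit (comodP S) u).
  elim/tens_ind: (rho u) => [|x y hx hy|v c].
  + rewrite (morph0 (tmapD (pure_map_linear m) (@llinear_id _ C))).
    by rewrite (morph0 (tliftD bal')) (morph0 (tliftD (bal S))) pure0r.
  + rewrite (tmapD (pure_map_linear m) (@llinear_id _ C)).
    by rewrite (tliftD bal') (tliftD (bal S)) pureDr hx hy.
  + rewrite tmapE //; last exact: pure_map_linear.
    by rewrite (tliftE bal') (tliftE (bal S)) /pure_map tens_ractE.
- case: (ractP (M ⊗r S)) => aD _ _ t.
  elim/tens_ind: t => [|x y hx hy|m u].
  + by rewrite (morph0 (aD _)).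
  + by rewrite aD hx hy.
  + by rewrite tens_ractE; congr (_ ⊠ _); apply: (cm_unital (comodP S)).
- exact: tens_rho_linear.
Qed.

Definition tens_comod : comod C := Comod tens_is_comod.
End TensorComod.

Section TensorComodMap.
Variables (M N : rmod R) (f : rhom M N).

Definition tens_map (t : M ⊗r S) : N ⊗r S := tmap f (@id S) t.

Lemma tens_map_linear : @rlinear A (M ⊗r S) (N ⊗r S) tens_map.
Proof. by apply: tmap_rlinear => //; split. Qed.

Definition tens_rhom : rhom (tens_comod M) (tens_comod N) :=
  @RHom A (tens_comod M) (tens_comod N) tens_map tens_map_linear.

Lemma tens_map_colinear : colinear tens_rhom.
Proof.
move=> t /=; have mP : rlinear tens_map := tens_map_linear.
elim/tens_ind: t => [|x y hx hy|m u].
- by rewrite (morph0 (proj1 mP)) !(morph0 (@tens_rhoD _)) (morph0 (tmapD mP (@llinear_id _ C))).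
- by rewrite (proj1 mP) !tens_rhoD (tmapD mP (@llinear_id _ C)) hx hy.
- rewrite {1}/tens_map tmapE // !tens_rhoE tmap_comp //; last exact: pure_map_linear.
  by apply: eq_tmap => // v /=; rewrite /pure_map /tens_map tmapE.
Qed.

Definition tens_chom : chom (tens_comod M) (tens_comod N) := CHom tens_map_colinear.
End TensorComodMap.

Definition tens_functor : functor (FirmModCat R) (ComodCat C).
Proof.
refine (@Functor (FirmModCat R) (ComodCat C) (fun M => tens_comod (fr_rmod M))
  (fun M N f => tens_chom (f : rhom (fr_rmod M) (fr_rmod N))) _ _).
- by move=> M; apply: chom_eq => t /=; rewrite /tens_map tmap_id.
- by move=> M N P g f; apply: chom_eq => t /=; rewrite /tens_map tmap_comp.
Defined.

Definition hom_ract (N : comod C) (f : chom S N) (r : R) : chom S N.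
Proof.
refine (@CHom A C S N (RHom (rlinear_comp (rhP f) (lact_rlinear S r))) _).
move=> m /=; have [/= _ _ _ h] := bicomodP S.
rewrite (chP f) [rho _]h tmap_comp //; exact: (lact_rlinear S r).
Defined.

Lemma hom_ractP (N : comod C) : right_action (@hom_ract N).
Proof.
case: (bm_lactP S) => lD lD' lA.
split=> [r f g|f r s|f r s]; apply: chom_eq => m //=; case: (rhP f) => fD fM.
- by rewrite [bc_act _ _]lD' fD.
- by congr (f _); rewrite -[RHS]lA.
Qed.

Definition hom_rmod (N : comod C) : rmod R := Rmod (hom_ractP N).

Lemma hom_map_linear (N P : comod C) (g : chom N P) :
  @rlinear R (hom_rmod N) (hom_rmod P) (chom_comp g : chom S N -> chom S P).
Proof.
split=> [f h|f r]; apply: chom_eq => m //=; by case: (rhP g) => ->.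
Qed.

Definition hom_functor (hR : has_idempotent_local_units R) :
  functor (ComodCat C) (FirmModCat R).
Proof.
refine (@Functor (ComodCat C) (FirmModCat R)
  (fun N => FRmod (tens_reg_firm (hom_rmod N) hR))
  (fun N P g => @RHom R (hom_rmod N ⊗r reg R) (hom_rmod P ⊗r reg R)
      (tmap (chom_comp g : hom_rmod N -> hom_rmod P) (@id (reg R)))
      (tmap_rlinear (hom_map_linear g) (conj (@llinear_id _ _) (@rlinear_id _ _)))) _ _).
- move=> N; apply: rhom_eq => t /=; rewrite -[RHS](tmap_id t).
  by apply: eq_tmap => // f; apply: chom_eq.
- move=> N P Q g f; apply: rhom_eq => t /=; rewrite tmap_comp //;
    try exact: hom_map_linear.
  by apply: eq_tmap => // h; apply: chom_eq.
Defined.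
End TensorFunctor.

Lemma rfirm_common (R : rng) (M : rmod R) (s : seq M) :
  has_idempotent_local_units R -> rfirm M ->
  exists2 e : R, e ⋆ e = e & forall m, m \in s -> m <* e = m.
Proof.
move=> hR /(rfirmP _ hR) h; case: (ractP M) => _ _ aA.
suff [x hx] : exists x : seq R, forall m, m \in s -> exists2 e, e \in x & m <* e = m.
  have [e ee he] := hR x; exists e => // m /hx [f fx fm].
  by rewrite -{1}fm aA (proj2 (he f fx)).
elim: s => [|m s [x hx]]; first by exists [::].
have [e _ em] := h m; exists (e :: x) => n; rewrite inE => /orP[/eqP->|/hx[f fx fn]].
  by exists e; rewrite ?inE ?eqxx.
by exists f; rewrite ?inE ?fx ?orbT.
Qed.

Lemma tens_firm_unit (Q R : rng) (M : rmod Q) (N : bimod Q R) (t : M ⊗r N) :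
  has_idempotent_local_units R -> rfirm N -> exists2 e : R, e ⋆ e = e & t <* e = t.
Proof.
move=> hR hN.
have [e ee he] := rfirm_common [seq p.2 | p <- repr (t : tens_quot M N)] hR hN.
case: (ractP (M ⊗r N)) => aD _ _; exists e => //.
move: he (tens_sum t); move: (repr _) => s he ->.
rewrite (morph_sumr _ _ (aD e)) big_seq [RHS]big_seq; apply: eq_bigr => p pt.
by rewrite tens_ractE (he _ (map_f _ pt)).
Qed.

Section CotensorFunctor.
Variables (A : pzRingType) (C : coring A) (R : rng) (L : lbicomod C R).

Section Cotensor.
Variable N : comod C.

Definition in_cotensor (t : N ⊗ L) : Prop :=
  tassoc (tmap (@rho A C N : N -> N ⊗r C) id t)
  = tmap id (@lam A C R L : L -> C ⊗l L) t.

Record cotensor := Cotensor {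
  ct_val : N ⊗r L;
  ctP : in_cotensor ct_val }.

HB.instance Definition _ := gen_eqMixin cotensor.
HB.instance Definition _ := gen_choiceMixin cotensor.

Lemma cotensor_eq (x y : cotensor) : ct_val x = ct_val y -> x = y.
Proof.
case: x y => x hx [y hy] /= e; case: _ / e in hy *.
by rewrite (Prop_irrelevance hx hy).
Qed.

Lemma lam_llinear : @llinear A L (C ⊗l L) (@lam A C R L).
Proof. by case: (lam_linear (lbicomodP L)). Qed.
Lemma lam_rlinear : @rlinear R L (C ⊗r L) (@lam A C R L).
Proof. by case: (lam_linear (lbicomodP L)). Qed.

Definition ct_left (t : N ⊗r L) : N ⊗ (C ⊗l L) :=
  tassoc (tmap (@rho A C N : N -> N ⊗r C) id t).
Definition ct_right (t : N ⊗r L) : N ⊗ (C ⊗l L) :=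
  tmap id (@lam A C R L : L -> C ⊗l L) t.

Lemma ct_leftD : {morph ct_left : x y / x + y}.
Proof.
move=> x y; rewrite /ct_left -tassocD; congr tassoc.
by apply: tmapD => //; exact: rho_linear (comodP N).
Qed.
Lemma ct_rightD : {morph ct_right : x y / x + y}.
Proof. by apply: tmapD => //; exact: lam_llinear. Qed.

Lemma ct_left_ract (t : N ⊗r L) r :
  ct_left (t <* r) = tmap id (fun x : C ⊗b L => x <* r) (ct_left t).
Proof.
have aL := @ract_llinear A R L r; have aCL := @ract_llinear A R (C ⊗b L) r.
have rN := rho_linear (comodP N).
rewrite /ct_left tmap_comp //.
rewrite (eq_tmap (f' := (@id (N ⊗r C)) \o (@rho A C N : N -> N ⊗r C))
   (g' := (fun x : L => x <* r) \o @id L)) //.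
rewrite -tmap_comp //.
rewrite -[RHS](tassoc_nat (f := @id N) (g := @id C)) //.
by congr tassoc; apply: eq_tmap => // x; rewrite tmap_id.
Qed.

Lemma ct_right_ract (t : N ⊗r L) r :
  ct_right (t <* r) = tmap id (fun x : C ⊗b L => x <* r) (ct_right t).
Proof.
have aL := @ract_llinear A R L r; have aCL := @ract_llinear A R (C ⊗b L) r.
rewrite /ct_right !tmap_comp //; try exact: lam_llinear.
apply: eq_tmap => // x /=; by case: lam_rlinear => _ ->.
Qed.

Lemma ct0P : in_cotensor (0 : N ⊗r L).
Proof. by rewrite /in_cotensor [LHS](morph0 ct_leftD) [RHS](morph0 ct_rightD). Qed.
Lemma ctDP (x y : cotensor) : in_cotensor (ct_val x + ct_val y).
Proof.
rewrite /in_cotensor [LHS]ct_leftD [RHS]ct_rightD.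
by congr (_ + _); exact: ctP.
Qed.
Lemma ctNP (x : cotensor) : in_cotensor (- ct_val x).
Proof.
apply: (@addIr _ (ct_left (ct_val x))).
rewrite -[LHS]ct_leftD [X in _ = _ + X](ctP x) -[RHS]ct_rightD.
by rewrite addNr (morph0 ct_leftD) (morph0 ct_rightD).
Qed.
Lemma ct_ractP' (x : cotensor) (r : R) : in_cotensor (ct_val x <* r).
Proof.
rewrite /in_cotensor [LHS]ct_left_ract [RHS]ct_right_ract.
by congr (tmap _ _ _); exact: ctP.
Qed.

Definition ct_zero : cotensor := Cotensor ct0P.
Definition ct_add x y : cotensor := Cotensor (ctDP x y).
Definition ct_opp x : cotensor := Cotensor (ctNP x).

Lemma ct_addA : associative ct_add.
Proof. by move=> x y z; apply: cotensor_eq; rewrite /= addrA. Qed.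
Lemma ct_addC : commutative ct_add.
Proof. by move=> x y; apply: cotensor_eq; rewrite /= addrC. Qed.
Lemma ct_add0 : left_id ct_zero ct_add.
Proof. by move=> x; apply: cotensor_eq; rewrite /= add0r. Qed.
Lemma ct_addN : left_inverse ct_zero ct_opp ct_add.
Proof. by move=> x; apply: cotensor_eq; rewrite /= addNr. Qed.

HB.instance Definition _ :=
  GRing.isZmodule.Build cotensor ct_addA ct_addC ct_add0 ct_addN.

Definition ct_ract (x : cotensor) (r : R) : cotensor := Cotensor (ct_ractP' x r).

Lemma ct_ractP : right_action ct_ract.
Proof.
case: (ractP (N ⊗r L)) => aD aD' aA.
by split=> [r x y|x r s|x r s]; apply: cotensor_eq; rewrite /= ?aD ?aD' ?aA.
Qed.

Definition cotensor_rmod : rmod R := Rmod ct_ractP.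

Lemma cotensor_firm : has_idempotent_local_units R -> rfirm cotensor_rmod.
Proof.
move=> hR; apply/rfirmP => // x.
have [e ee ex] := tens_firm_unit (ct_val x) hR (lb_firm (lbicomodP L)).
by exists e => //; apply: cotensor_eq.
Qed.
End Cotensor.

Section CotensorMap.
Variables (N P : comod C) (f : chom N P).

Lemma ct_map_subproof (x : cotensor N) : in_cotensor (tmap f (@id L) (ct_val x)).
Proof.
have lP := lam_llinear; have rN := rho_linear (comodP N).
have rP := rho_linear (comodP P).
have idP := @tmap_llinear A A C C L L id id (conj (@llinear_id _ _) (@rlinear_id _ _)) (@llinear_id _ _).
have fCP := @tmap_rlinear A A N P C C f id (rhP f) (conj (@llinear_id _ _) (@rlinear_id _ _)).
have E : tmap (@rho A C P : P -> P ⊗r C) id (tmap f (@id L) (ct_val x))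
    = tmap (tmap f (@id C) : N ⊗r C -> P ⊗r C) id
        (tmap (@rho A C N : N -> N ⊗r C) (@id L) (ct_val x)).
  by rewrite !tmap_comp //; apply: eq_tmap => // n /=; rewrite (chP f).
rewrite /in_cotensor E tassoc_nat // (ctP x) !tmap_comp //.
by apply: eq_tmap => [n|l] //=; exact: tmap_id.
Qed.

Definition ct_map (x : cotensor_rmod N) : cotensor_rmod P := Cotensor (ct_map_subproof x).

Lemma ct_map_linear : rlinear ct_map.
Proof.
split=> [x y|x r]; apply: cotensor_eq => /=; first exact: tmapD.
have [_ h] := @tmap_rlinear A R N P L L f id (rhP f)
  (conj (@llinear_id _ _) (@rlinear_id _ _)).
exact: h.
Qed.

Definition ct_rhom : rhom (cotensor_rmod N) (cotensor_rmod P) := RHom ct_map_linear.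
End CotensorMap.

Definition cotensor_functor (hR : has_idempotent_local_units R) :
  functor (ComodCat C) (FirmModCat R).
Proof.
refine (@Functor (ComodCat C) (FirmModCat R)
  (fun N => FRmod (cotensor_firm N hR)) (fun N P f => ct_rhom f) _ _).
- by move=> N; apply: rhom_eq => t; apply: cotensor_eq; rewrite /= tmap_id.
- by move=> N P Q g f; apply: rhom_eq => t; apply: cotensor_eq; rewrite /= tmap_comp.
Defined.
End CotensorFunctor.

Record comatrix_context (R A : rng) (S : bimod R A) (Sd : bimod A R)
    (eta : R -> S ⊗ Sd) (eps : Sd ⊗ S -> A) : Prop := ComatrixContext {
  ctx_firmR : firm_rng R;
  ctx_firmA : firm_rng A;
  ctx_lfirmS : @lfirm R S;
  ctx_rfirmS : @rfirm A S;
  ctx_lfirmSd : @lfirm A Sd;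
  ctx_rfirmSd : @rfirm R Sd;
  ctx_eta : @bilinear_map R R (reg R) (S ⊗b Sd) eta;
  ctx_eps : @bilinear_map A A (Sd ⊗b S) (reg A) eps;
  ctx_unitS : forall (r : R) (u : S),
    tlift (fun (e : S) (f : Sd) => @ract A S e (eps (f ⊠ u))) (eta r) = @lact R S r u;
  ctx_unitSd : forall (r : R) (x : Sd),
    tlift (fun (e : S) (f : Sd) => @lact A Sd (eps (x ⊠ e)) f) (eta r) = @ract R Sd x r }.

(* The element r ⊗ u^r of R ⊗_R M corresponding to u; meaningful for M firm.   *)
Definition firm_split (R : rng) (M : lmod R) (u : M) : reg R ⊗ M :=
  if pselect (exists t, lmul_map t = u) is left h then proj1_sig (cid h) else 0.

Section Comatrix.
Variables (R A : rng) (S : bimod R A) (Sd : bimod A R).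
Variables (eta : R -> S ⊗ Sd) (eps : Sd ⊗ S -> A).

Definition comatrix_comult (x : Sd ⊗b S) : (Sd ⊗b S) ⊗ (Sd ⊗b S) :=
  tlift (fun (p : Sd) (u : S) =>
    tlift (fun (r : R) (v : S) =>
      tlift (fun (e : S) (f : Sd) =>
        (p ⊠ e : Sd ⊗b S) ⊠ (f ⊠ v : Sd ⊗b S)) (eta r))
    (firm_split u)) x.

Definition comatrix_coring : precoring A :=
  @Precoring A (Sd ⊗b S) comatrix_comult eps.
End Comatrix.

Section Canonical.
Variables (R : rng) (A : pzRingType) (C : coring A) (S : bicomod R C) (Sd : bimod A R).
Variables (eta : R -> S ⊗ Sd) (eps : Sd ⊗ S -> A).

Lemma dagger_dual_subproof (h : comatrix_context eta eps) (x : Sd) :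
  @rlinear A S (reg A) (fun u : S => eps (x ⊠ u)).
Proof.
case: (ctx_eps h) => _ [eD eM]; split=> [u v|u a].
  by rewrite pureDr eD.
by rewrite -eM; congr eps; rewrite tens_ractE.
Qed.

(* Sd -> S^*, x |-> eps (x ⊗ -) *)
Definition dagger_dual (h : comatrix_context eta eps) (x : Sd) : dual_bimod S :=
  @RHom A S (reg A) _ (dagger_dual_subproof h x).

Definition dagger_tens (h : comatrix_context eta eps) (t : Sd ⊗b S) : dual_bimod S ⊗b S :=
  tmap (dagger_dual h) (@id S) t.

(* S^* ⊗_R S -> C, f ⊗ u |-> f(u_[0]) u_[1] *)
Definition can (t : dual_bimod S ⊗b S) : C :=
  tlift (fun (f : dual_bimod S) (u : S) =>
    tlift (fun (v : S) (c : C) => @lact A C ((f : rhom S (reg A)) v) c) (rho u)) t.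

(* The comatrix coring is carried from Sd ⊗_R S to S^* ⊗_R S along            *)
(* [dagger_tens]. The isomorphism with C has to be [can], i.e. the one that   *)
(* matches the coaction of C on S with the one of the comatrix coring; an     *)
(* unrelated isomorphism of corings would say nothing about the comodule S.   *)
Definition comatrix_iso : Prop :=
  exists h : comatrix_context eta eps,
    bijective (dagger_tens h) /\
    @precoring_iso A (comatrix_coring eta eps) C (fun t => can (dagger_tens h t)).
End Canonical.

(* The left coaction of C on Sd = S^* ⊗_R R, where f ⊗ r corresponds to       *)
(* f(e_r) f_r. It is given at r = s r'.                                       *)
Definition dagger_coaction (R : rng) (A : pzRingType) (C : coring A) (S : bicomod R C)
    (Sd : lbicomod C R) (eta : R -> S ⊗ Sd) : Prop :=
  forall (f : rhom S (reg A)) (s r : R),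
    lam (tlift (fun (e : S) (g : Sd) => @lact A Sd (f e) g) (eta (s ⋆ r)))
    = tlift (fun (e : S) (g : Sd) =>
        tlift (fun (v : S) (c : C) => @lact A C (f v) c) (rho e) ⊠ (g <* r)) (eta s).

Definition short_exact (U V W : zmodType) (f : U -> V) (g : V -> W) : Prop :=
  [/\ injective f, forall v, g v = 0 <-> exists u, f u = v
    & forall w, exists v, g v = w].

Definition flat_on (R : rng) (Q : rmod R -> Prop) (N : lmod R) : Prop :=
  forall (X Y Z : rmod R) (f : rhom X Y) (g : rhom Y Z), Q X -> Q Y -> Q Z ->
    short_exact f g -> short_exact (tmap f (@id N)) (tmap g (@id N)).

Definition left_flat (A : pzRingType) (N : lmod A) : Prop := flat_on (@runital A) N.

Definition faithfully_flat (R : rng) (N : lmod R) : Prop :=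
  flat_on (fun=> True) N /\
  forall (X Y : rmod R) (f g : rhom X Y), rfirm X -> rfirm Y ->
    tmap f (@id N) =1 tmap g (@id N) -> f =1 g.

Definition reg_frmod (R : rng) (hR : has_idempotent_local_units R) : FirmModCat R :=
  FRmod (reg_firm hR).

Lemma lmul_rhom_subproof (R : rng) (r : R) : @rlinear R (reg R) (reg R) (rmul r).
Proof. by split=> [x y|x s]; [apply: rmulDr | rewrite /= rmulA]. Qed.
Definition lmul_rhom (R : rng) (r : R) : rhom (reg R) (reg R) := RHom (lmul_rhom_subproof r).

(* F(R), with the candidate left R-action r · u = F(x |-> r x)(u) *)
Section RegImage.
Variables (A : pzRingType) (C : coring A) (R : rng) (hR : has_idempotent_local_units R).
Variable F : functor (FirmModCat R) (ComodCat C).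

Definition reg_image : comod C := F (reg_frmod hR).
Definition reg_image_act (r : R) (u : reg_image) : reg_image :=
  (@fmap _ _ F (reg_frmod hR) (reg_frmod hR) (lmul_rhom r) : chom reg_image reg_image) u.
End RegImage.

(* Main.v *)
(* Write S = F(R), and let c : FG -> id be the counit. Since m in M is a map R -> M,   *)
(* c and F give maps M ⊗ S -> F(M) and G(N) -> Hom^C(S, N); full faithfulness makes   *)
(* the first bijective and the second injective with image Hom^C(S, N) R. The maps    *)
(* n ⊗ - : C -> N ⊗ C are jointly surjective, so applying G to them shows that every  *)
(* A-linear map S -> N fixed by an idempotent e of R is a finite sum of maps          *)
(* n f(-) with f in S^*. For N = S this yields dual bases of the summands e S, which  *)
(* are F(eR), and hence the copairing R -> S ⊗ S^* R; all of S, S^* R and R are       *)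
(* unions over the idempotents e of e S, (e S)^* and e R e = End^C(e S). Moreover     *)
(* N ⊗ S^* R is Hom_A(S, N) R, which identifies the cotensor product with             *)
(* Hom^C(S, N) R, and the counit at N = C is the canonical map S^* R ⊗ S -> C.        *)
(* Conversely, C = S^* R ⊗ S makes C flat, and Hom^C(S, N) is the kernel of a map     *)
(* Hom_A(S, N) -> Hom_A(S, N ⊗ C) that becomes ρ ⊗ C - N ⊗ Δ on N ⊗ C after tensoring *)
(* with S; flatness gives the counit, and faithful flatness then gives the unit.      *)

Require Import Defs.
From HB Require Import structures.
From mathcomp Require Import all_boot all_order all_algebra.
From mathcomp Require Import boolp.

Set Implicit Arguments.
Unset Strict Implicit.
Unset Printing Implicit Defensive.

Import GRing.Theory.
Local Open Scope ring_scope.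
Local Open Scope rng_scope.

Local Notation hom := Defs.hom.

(** * Equivalences, submodules and flatness *)

(** An equivalence preserves what is expressible by arrows alone: full faithfulness, jointly epic
    families ([equiv_jointly_epi]) and monomorphisms ([equiv_monic]). In the forward direction each
    module-theoretic claim is reduced to a statement of this kind, with idempotents of [R] standing
    in for the missing unit.

    Write [S = F R]. Since left multiplications by idempotents are jointly epic on [R], [S] is firm
    ([reg_image_unit]); since the maps [R -> M] are jointly epic, the Eilenberg-Watts map
    [M ⊗ S -> F M] is bijective ([watts_bij]); since the maps [C -> N ⊗ C] are jointly epic and [G]
    preserves this, there are finite dual bases ([dual_basis]). The latter make [F (e R)], which is
    [e S], finitely generated projective ([corner_fgp]) and provide the copairing [R -> S ⊗ S^* R].
    Evaluation then embeds [N ⊗ S^* R] into [Hom_A(S, N)] ([ev_inj]), so that the laws of the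
    context and of the left coaction become identities between maps on [S] ([dagger_context],
    [dagger_is_lbicomod]), and the cotensor product becomes the set of colinear maps [S -> N] fixed
    by an idempotent, which is [G N] ([in_cotensorP], [cotensor_iso]). The counit of the equivalence
    at [C], read through [watts], is the canonical map ([reg_image_can_bij]). The three colimits are
    unions over the idempotents ([system_colim], [system_dual_colim], [system_end_colim]). When [C]
    is flat, monomorphisms of comodules are injective, and flatness of [S] follows
    ([reg_image_faithfully_flat]).

    Conversely, [C ≅ Sd ⊗ S] gives [Hom_A(S, N) ⊗ S ≅ N ⊗ C] ([hom_coact_bij]). As [S] is flat,
    [Hom^C(S, N) ⊗ S] is then the kernel of [ρ ⊗ C - N ⊗ Δ], that is [N] ([hom_counit_bij]);
    faithfulness turns this into bijectivity of the unit ([adj_unit_bij]). *)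

Lemma nat_iso_sym (C D : category) (F G : functor C D) : nat_iso F G -> nat_iso G F.
Proof.
case=> t tn ti.
have s X : {s : hom (G X) (F X) | s ∘ t X = idm _ /\ t X ∘ s = idm _}.
  by apply: cid; have [s st ts] := ti X; exists s.
exists (fun X => proj1_sig (s X)) => [X Y f|X]; last first.
  by case: (s X) => sX [st ts]; exists (t X).
case: (s X) (s Y) => sX [stX tsX] [sY [stY tsY]] /=.
by rewrite -[LHS]compm1 -tsX Defs.compA -(Defs.compA sY) -tn Defs.compA stY comp1m.
Qed.

(** The arrow-theoretic form of generation by images, hence transportable along an equivalence. It
    is exploited by showing that a quotient by a union or sum of images vanishes. *)
Definition jointly_epi (D : category) (I : Type) (X : I -> D) (Y : D)
    (f : forall i, hom (X i) Y) : Prop :=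
  forall (Z : D) (g h : hom Y Z), (forall i, g ∘ f i = h ∘ f i) -> g = h.

Definition monomorphism (D : category) (X Y : D) (f : hom X Y) : Prop :=
  forall (Z : D) (g h : hom Z X), f ∘ g = f ∘ h -> g = h.

Lemma is_iso_epi (D : category) (X Y Z : D) (f : hom X Y) (g h : hom Y Z) :
  is_iso f -> g ∘ f = h ∘ f -> g = h.
Proof. by case=> k _ fk e; rewrite -[g]compm1 -[h]compm1 -fk !Defs.compA e. Qed.

Lemma is_iso_monic (D : category) (X Y : D) (f : hom X Y) : is_iso f -> monomorphism f.
Proof. by case=> k kf _ Z g h e; rewrite -[g]comp1m -[h]comp1m -kf -!Defs.compA e. Qed.

Section Equivalence.
Variables (C D : category) (F : functor C D) (G : functor D C).

(** Stated from one natural isomorphism only, so that it serves both [F] and [G]. *)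
Lemma nat_iso_faithful : nat_iso (fun_comp G F) (fun_id C) ->
  forall (X Y : C) (f g : hom X Y), fmap F f = fmap F g -> f = g.
Proof.
case=> t tn ti X Y f g e; apply: (is_iso_epi (ti X)).
have := tn X Y f; have := tn X Y g => /= <- <-.
by rewrite e.
Qed.
End Equivalence.

Section Equivalence.
Variables (C D : category) (F : functor C D) (G : functor D C).
Hypothesis FG : inverse_equivalences F G.

Lemma equiv_faithful (X Y : C) (f g : hom X Y) : fmap F f = fmap F g -> f = g.
Proof. exact: (nat_iso_faithful (proj1 FG)). Qed.

(** The preimage is [G h] conjugated by [G F ≅ id]; that [F] maps it to [h] is tested after the
    faithful functor [G]. *)
Lemma equiv_full (X Y : C) (h : hom (F X) (F Y)) : exists f, fmap F f = h.
Proof.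
have [[t tn ti] i2] := FG.
have [s st ts] := ti X.
exists (t Y ∘ fmap G h ∘ s); apply: (nat_iso_faithful i2).
apply: (is_iso_monic (ti Y)).
have := tn X Y (t Y ∘ fmap G h ∘ s) => /= ->.
by rewrite -Defs.compA st compm1.
Qed.

(** The test object [Z] is replaced by the isomorphic [F (G Z)], after which fullness pulls the two
    maps back to the source category. *)
Lemma equiv_jointly_epi (I : Type) (X : I -> C) (Y : C) (f : forall i, hom (X i) Y) :
  jointly_epi f -> jointly_epi (fun i => fmap F (f i)).
Proof.
have [_ [c cn ci]] := FG.
move=> fe Z g h e.
have [d dc cd] := ci Z.
have [g' Eg] := equiv_full (d ∘ g); have [h' Eh] := equiv_full (d ∘ h).
have E : g' = h'.
  apply: fe => i; apply: equiv_faithful.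
  by rewrite !fmapM Eg Eh -!Defs.compA e.
apply: (is_iso_monic (f := d)); first by exists (c Z).
by rewrite -Eg -Eh E.
Qed.

Lemma equiv_monic (X Y : C) (f : hom X Y) : monomorphism f -> monomorphism (fmap F f).
Proof.
have [_ [c cn ci]] := FG.
move=> fm Z g h e.
have [g' Eg] := equiv_full (g ∘ c Z); have [h' Eh] := equiv_full (h ∘ c Z).
have E : g' = h'.
  apply: fm; apply: equiv_faithful.
  by rewrite !fmapM Eg Eh !Defs.compA e.
by apply: (is_iso_epi (ci Z)); rewrite -Eg -Eh E.
Qed.
End Equivalence.

(** [D j v] reads: the value at [v] may be computed at index [j]. Maps out of firm objects are built
    this way, [j] being an idempotent that fixes [v]; linearity is checked afterwards. *)
Lemma glue (V X J : Type) (D : J -> V -> Prop) (h : J -> V -> X) :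
  (forall v, exists j, D j v) ->
  (forall i j v, D i v -> D j v -> h i v = h j v) ->
  exists g : V -> X, forall j v, D j v -> g v = h j v.
Proof.
move=> Dv hE; exists (fun v => h (proj1_sig (cid (Dv v))) v) => j v Djv.
by apply: hE => //; case: cid.
Qed.

(** * Submodules, quotients, kernels and images *)

Record submod (R : rng) (M : rmod R) := Submod {
  sm_pred :> M -> Prop;
  sm0 : sm_pred 0;
  smB : forall x y, sm_pred x -> sm_pred y -> sm_pred (x - y);
  smM : forall x r, sm_pred x -> sm_pred (x <* r) }.

Definition sm_mem (R : rng) (M : rmod R) (K : submod M) : {pred M} := fun x => `[< K x >].

Lemma sm_memP (R : rng) (M : rmod R) (K : submod M) x : reflect (K x) (x \in sm_mem K).
Proof. exact: asboolP. Qed.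

Lemma sm_zmod_closed (R : rng) (M : rmod R) (K : submod M) : zmod_closed (sm_mem K).
Proof.
split=> [|x y /sm_memP Kx /sm_memP Ky]; first exact/sm_memP/sm0.
exact/sm_memP/smB.
Qed.

HB.instance Definition _ (R : rng) (M : rmod R) (K : submod M) :=
  GRing.isZmodClosed.Build M (sm_mem K) (sm_zmod_closed K).

Lemma ract0 (R : rng) (M : rmod R) (r : R) : (0 : M) <* r = 0.
Proof. by case: (ractP M) => aD _ _; rewrite (morph0 (aD r)). Qed.
Lemma ractDl (R : rng) (M : rmod R) (x y : M) (r : R) : (x + y) <* r = x <* r + y <* r.
Proof. by case: (ractP M) => aD _ _; rewrite aD. Qed.
Lemma ractDr (R : rng) (M : rmod R) (x : M) (r s : R) : x <* (r + s) = x <* r + x <* s.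
Proof. by case: (ractP M) => _ aD _; rewrite aD. Qed.
Lemma ractA (R : rng) (M : rmod R) (x : M) (r s : R) : x <* r <* s = x <* (r ⋆ s).
Proof. by case: (ractP M). Qed.
Lemma lactDl (R : rng) (M : lmod R) (x y : M) (r : R) : r *> (x + y) = r *> x + r *> y.
Proof. by case: (lactP M) => aD _ _; rewrite aD. Qed.
Lemma lactDr (R : rng) (M : lmod R) (x : M) (r s : R) : (r + s) *> x = r *> x + s *> x.
Proof. by case: (lactP M) => _ aD _; rewrite aD. Qed.
Lemma lactA (R : rng) (M : lmod R) (x : M) (r s : R) : r *> (s *> x) = (r ⋆ s) *> x.
Proof. by case: (lactP M). Qed.

Lemma morphN (U V : zmodType) (f : U -> V) (x : U) : {morph f : x y / x + y} -> f (- x) = - f x.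
Proof. by move=> fD; apply: (@addIr _ (f x)); rewrite -fD !addNr morph0. Qed.
Lemma morphB (U V : zmodType) (f : U -> V) (x y : U) :
  {morph f : x y / x + y} -> f (x - y) = f x - f y.
Proof. by move=> fD; rewrite fD morphN. Qed.

Lemma ractN (R : rng) (M : rmod R) (x : M) (r : R) : (- x) <* r = - (x <* r).
Proof. by case: (ractP M) => aD _ _; apply: (morphN _ (aD r)). Qed.

Section Submodule.
Variables (R : rng) (M : rmod R) (K : submod M).

Definition sub_car := {x : M | x \in sm_mem K}.
HB.instance Definition _ := SubChoice.on sub_car.
HB.instance Definition _ := [SubChoice_isSubZmodule of sub_car by <:].

Definition sub_ract (x : sub_car) (r : R) : sub_car :=
  Sub (val x <* r) (introT (sm_memP K _) (smM r (elimT (sm_memP K _) (valP x)))).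

Lemma sub_ractP : right_action sub_ract.
Proof.
case: (ractP M) => aD aD' aA.
by split=> [r x y|x r s|x r s]; apply: val_inj; rewrite /= ?raddfD /= ?aD ?aD' ?aA.
Qed.

Definition sub_rmod : rmod R := Rmod sub_ractP.

Definition sub_incl : rhom sub_rmod M :=
  @RHom R sub_rmod M val (conj (fun _ _ => erefl) (fun _ _ => erefl)).

Lemma sub_incl_inj : injective sub_incl.
Proof. exact: val_inj. Qed.
Lemma sub_inclP (x : sub_rmod) : K (sub_incl x).
Proof. exact/sm_memP/(valP x). Qed.

Definition sub_elt x (Kx : K x) : sub_rmod := Sub x (introT (sm_memP K x) Kx).
Lemma sub_eltK x (Kx : K x) : sub_incl (sub_elt Kx) = x.
Proof. by []. Qed.

Lemma sub_corestr (N : rmod R) (f : rhom N M) : (forall x, K (f x)) ->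
  exists g : rhom N sub_rmod, forall x, sub_incl (g x) = f x.
Proof.
move=> Kf; case: (rhP f) => fD fM.
have gP : @rlinear R N sub_rmod (fun x => sub_elt (Kf x)).
  by split=> [x y|x r]; apply: sub_incl_inj; rewrite ?fD ?fM /= ?fD ?fM.
by exists (RHom gP).
Qed.

Local Notation pi := (\pi_(Quotient.quot (sm_mem K)))%qT.

Definition quot_car : zmodType := Quotient.quot (sm_mem K).
Definition quot_pi (x : M) : quot_car := pi x.

Lemma quot_piD : {morph quot_pi : x y / x + y}.
Proof. exact: (raddfD pi). Qed.

Lemma quot_pi_eq x y : quot_pi x = quot_pi y <-> K (x - y).
Proof.
split=> [/eqP e|Kxy]; first by apply/sm_memP; rewrite Quotient.idealrBE.
by apply/eqP; rewrite -Quotient.idealrBE; apply/sm_memP.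
Qed.

Lemma quot_pi_eq0 x : quot_pi x = 0 <-> K x.
Proof. by rewrite -(morph0 quot_piD) quot_pi_eq subr0. Qed.

Lemma quot_pi_surj (q : quot_car) : exists x, quot_pi x = q.
Proof. by elim/quotW: q => x; exists x. Qed.

(** The target is a bare type: both the action and, later, the coaction on a quotient descend
    through this lemma before their laws are known. *)
Lemma quot_desc (X : Type) (f : M -> X) : (forall x y, K (x - y) -> f x = f y) ->
  exists g : quot_car -> X, forall x, g (quot_pi x) = f x.
Proof.
move=> fK; exists (fun q => f (proj1_sig (cid (quot_pi_surj q)))) => x.
by case: cid => y /= /quot_pi_eq /fK.
Qed.

Definition quot_ract_ex (r : R) :
  exists g : quot_car -> quot_car, forall x, g (quot_pi x) = quot_pi (x <* r).
Proof.
apply: quot_desc => x y /(smM r) Kxy; apply/quot_pi_eq.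
by rewrite -ractN -ractDl.
Qed.

Definition quot_ract (q : quot_car) (r : R) : quot_car := proj1_sig (cid (quot_ract_ex r)) q.

Lemma quot_ractE x r : quot_ract (quot_pi x) r = quot_pi (x <* r).
Proof. by rewrite /quot_ract; case: cid. Qed.

Lemma quot_ractP : right_action quot_ract.
Proof.
split=> [r q q'|q r s|q r s]; have [x <-] := quot_pi_surj q.
- have [y <-] := quot_pi_surj q'.
  by rewrite -quot_piD !quot_ractE -quot_piD ractDl.
- by rewrite !quot_ractE -quot_piD ractDr.
- by rewrite !quot_ractE ractA.
Qed.

Definition quot_rmod : rmod R := Rmod quot_ractP.

Lemma quot_proj_linear : @rlinear R M quot_rmod quot_pi.
Proof. by split=> [x y|x r]; rewrite ?quot_piD //= [in RHS]quot_ractE. Qed.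

Definition quot_proj : rhom M quot_rmod := RHom quot_proj_linear.

Lemma quot_proj_surj (q : quot_rmod) : exists x, quot_proj x = q.
Proof. exact: quot_pi_surj. Qed.
Lemma quot_proj_eq0 x : quot_proj x = 0 <-> K x.
Proof. exact: quot_pi_eq0. Qed.
End Submodule.

Section KernelImage.
Variables (R : rng) (M N : rmod R) (f : rhom M N).

Lemma rhomD x y : f (x + y) = f x + f y. Proof. by case: (rhP f) => ->. Qed.
Lemma rhom0 : f 0 = 0. Proof. exact: morph0 rhomD. Qed.
Lemma rhomB x y : f (x - y) = f x - f y. Proof. exact: morphB rhomD. Qed.
Lemma rhomM x r : f (x <* r) = f x <* r. Proof. by case: (rhP f) => _ ->. Qed.
Lemma rhom_sum (I : Type) (s : seq I) (g : I -> M) :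
  f (\sum_(i <- s) g i) = \sum_(i <- s) f (g i).
Proof. exact: morph_sumr rhomD. Qed.

Lemma rker_subproof (x : M) (r : R) : f x = 0 -> f (x <* r) = 0.
Proof. by move=> e; rewrite rhomM e ract0. Qed.
Definition rker : submod M :=
  @Submod R M (fun x => f x = 0) rhom0
    (fun x y ex ey => etrans (rhomB x y) (etrans (congr2 (fun a b => a - b) ex ey) (subr0 0)))
    rker_subproof.

Lemma rim0 : exists x, f x = 0. Proof. by exists 0; exact: rhom0. Qed.
Lemma rimB y z : (exists x, f x = y) -> (exists x, f x = z) -> exists x, f x = y - z.
Proof. by case=> x <- [x' <-]; exists (x - x'); rewrite rhomB. Qed.
Lemma rimM y r : (exists x, f x = y) -> exists x, f x = y <* r.
Proof. by case=> x <-; exists (x <* r); rewrite rhomM. Qed.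
Definition rim : submod N := Submod rim0 rimB rimM.
End KernelImage.

(** * Right exactness of the tensor product, and flatness *)

Section Exactness.
Variables (R : rng) (N : lmod R).

Lemma tmap_surj (X Y : rmod R) (f : rhom X Y) : (forall y, exists x, f x = y) ->
  forall t : Y ⊗ N, exists s, tmap f (@id N) s = t.
Proof.
move=> fs; elim/tens_ind=> [|_ _ [x <-] [y <-]|y n].
- by exists 0; rewrite (morph0 (tmapD _ _)).
- by exists (x + y); rewrite tmapD.
- by have [x <-] := fs y; exists (x ⊠ n); rewrite tmapE.
Qed.

(* With the zero action, every subgroup is a submodule. *)
Lemma zero_ractP (V : zmodType) : @right_action R V (fun _ _ => 0).
Proof. by split=> [r x y|x r s|x r s] //=; rewrite addr0. Qed.
Definition zero_rmod (V : zmodType) : rmod R := Rmod (zero_ractP V).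

(** With [I] the image of [f ⊗ N], lifting elements of [Z] to [Y] is unambiguous modulo [I] and
    gives a map [Z ⊗ N -> (Y ⊗ N) / I]. Composed with [g ⊗ N] it is the projection, so the kernel of
    [g ⊗ N] lies in [I]. *)
Lemma tens_right_exact (X Y Z : rmod R) (f : rhom X Y) (g : rhom Y Z) :
  (forall z, exists y, g y = z) -> (forall y, g y = 0 -> exists x, f x = y) ->
  forall t, tmap g (@id N) t = 0 -> exists s, tmap f (@id N) s = t.
Proof.
move=> gs ge.
have fD := tmapD (rhP f) (@llinear_id _ N).
have I0 : exists s, tmap f (@id N) s = 0 by exists 0; rewrite (morph0 fD).
have IB t t' : (exists s, tmap f (@id N) s = t) -> (exists s, tmap f (@id N) s = t') ->
    exists s, tmap f (@id N) s = t - t'.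
  by case=> s <- [s' <-]; exists (s - s'); rewrite (morphB _ _ fD).
pose I : submod (zero_rmod (Y ⊗ N)) :=
  @Submod R (zero_rmod (Y ⊗ N)) _ I0 IB (fun _ _ _ => I0).
have [h hE] : exists h : Z -> N -> quot_car I,
    forall y n, h (g y) n = quot_pi I (y ⊠ n : Y ⊗ N).
  exists (fun z n => quot_pi I (proj1_sig (cid (gs z)) ⊠ n : Y ⊗ N)) => y n.
  case: cid => y' /= e; apply/(@quot_pi_eq _ _ I).
  have [x ex] : exists x, f x = y' - y by apply: ge; rewrite rhomB e subrr.
  exists (x ⊠ n); rewrite tmapE // ex.
  by rewrite (morphB _ _ (pureDl n)).
have hb : balanced h.
  split=> [n z z'|z n n'|z r n]; have [y <-] := gs z; rewrite ?hE.
  - by have [y' <-] := gs z'; rewrite -rhomD !hE pureDl (@quot_piD _ _ I).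
  - by rewrite pureDr (@quot_piD _ _ I).
  - by rewrite -rhomM hE pure_bal.
have E t : tlift h (tmap g (@id N) t) = quot_pi I t.
  move: t; apply: tens_ext => [x y|x y|y n].
  - by rewrite tmapD // tliftD.
  - exact: (@quot_piD _ _ I).
  - by rewrite tmapE // tliftE.
move=> t t0; apply/(@quot_pi_eq0 _ _ I).
by rewrite -E t0 (morph0 (tliftD hb)).
Qed.

Variable Q : rmod R -> Prop.
Hypothesis Nflat : flat_on Q N.
Hypothesis Qsub : forall (X : rmod R) (K : submod X), Q X -> Q (sub_rmod K).
Hypothesis Qquot : forall (X : rmod R) (K : submod X), Q X -> Q (quot_rmod K).

(** An injection is completed by its cokernel to a short exact sequence. The class [Q] will be all
    modules over [R], or the unital ones over [A]. *)
Lemma flat_inj (X Y : rmod R) (f : rhom X Y) : Q X -> Q Y -> injective f ->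
  injective (tmap f (@id N)).
Proof.
move=> QX QY fI.
suff [] : short_exact (tmap f (@id N)) (tmap (quot_proj (rim f)) (@id N)) by [].
apply: Nflat => //; first exact: Qquot.
split=> //; last exact: quot_proj_surj.
by move=> y; rewrite quot_proj_eq0.
Qed.

(** Factor [f] through its image: right exactness handles the surjection onto the image, flatness
    the inclusion of the image. *)
Lemma flat_ker (X Y : rmod R) (f : rhom X Y) (t : X ⊗ N) : Q X -> Q Y ->
  tmap f (@id N) t = 0 -> exists s, tmap (sub_incl (rker f)) (@id N) s = t.
Proof.
move=> QX QY e.
have [g gE] := @sub_corestr _ _ (rim f) _ f (fun x => ex_intro _ x erefl).
apply: (@tens_right_exact _ _ _ (sub_incl (rker f)) g) => [z|x gx|].
- have [x ex] := sub_inclP z.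
  by exists x; apply: sub_incl_inj; rewrite gE.
- have fx : rker f x by rewrite /= -gE gx rhom0.
  by exists (sub_elt fx).
- have iI := @flat_inj _ _ (sub_incl (rim f)) (Qsub _ QY) QY (@sub_incl_inj _ _ _).
  apply: iI; rewrite tmap_comp //.
  rewrite (eq_tmap (f' := f) (g' := @id N)) // e.
  by rewrite (morph0 (tmapD _ _)).
Qed.
End Exactness.

(** * Rings with local units *)

Lemma unital_local_units (A : pzRingType) : has_idempotent_local_units A.
Proof.
move=> X; exists (1 : A) => [|x _]; rewrite /= ?mul1r ?mulr1 //.
Qed.

Lemma runital_rfirm (A : pzRingType) (M : rmod A) : runital M -> rfirm M.
Proof.
move=> h; apply/rfirmP => [|m]; first exact: unital_local_units.
by exists (1 : A); [exact: mulr1 | exact: h].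
Qed.

Lemma lmul_balanced (R : rng) (M : lmod R) :
  @balanced R (reg R) M M (fun (r : R) (m : M) => r *> m).
Proof. by case: (lactP M) => aD aD' aA; split=> // m r s /=; rewrite aA. Qed.

Lemma lmul_mapE (R : rng) (M : lmod R) (r : R) (m : M) :
  lmul_map ((r : reg R) ⊠ m) = r *> m.
Proof. exact: tliftE (@lmul_balanced R M) _ _. Qed.

Lemma lmul_mapD (R : rng) (M : lmod R) : {morph @lmul_map R M : x y / x + y}.
Proof. exact: tliftD (@lmul_balanced R M). Qed.

Section LocalUnits.
Variable R : rng.
Hypothesis hR : has_idempotent_local_units R.

Lemma local_unit2 (e f : R) : exists2 g : R, g ⋆ g = g &
  [/\ g ⋆ e = e, e ⋆ g = e, g ⋆ f = f & f ⋆ g = f].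
Proof.
have [g gg h] := hR [:: e; f]; exists g => //.
by case: (h e); rewrite ?inE ?eqxx // => -> ->; case: (h f); rewrite ?inE ?eqxx ?orbT // => -> ->.
Qed.

Lemma local_unit1 (r : R) : exists2 e : R, e ⋆ e = e & e ⋆ r = r /\ r ⋆ e = r.
Proof. by have [g gg [h1 h2 _ _]] := local_unit2 r r; exists g. Qed.

(** The left-hand counterpart of [rfirmP]. Injectivity holds since [t = e ⊠ lmul_map t] for a common
    unit [e] of the first components of [t]. *)
Lemma lfirmP (M : lmod R) :
  lfirm M <-> forall m : M, exists2 e : R, e ⋆ e = e & e *> m = m.
Proof.
case: (lactP M) => aD aD' aA; split=> [[g gK Kg] m|h].
  rewrite -(Kg m); move: (g m) => t.
  have [e ee he] := hR [seq p.1 | p <- repr (t : tens_quot (reg R) M)].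
  exists e => //; rewrite /lmul_map /tlift (morph_sumr _ _ (aD e)).
  rewrite big_seq [RHS]big_seq; apply: eq_bigr => p pt.
  by rewrite aA (proj1 (he _ (map_f _ pt))).
apply: inj_surj_bij => [|m]; last first.
  by have [e _ he] := h m; exists ((e : reg R) ⊠ m); rewrite lmul_mapE.
apply: additive_inj => [|t]; first exact: lmul_mapD.
have [e ee he] := hR [seq p.1 | p <- repr (t : tens_quot (reg R) M)].
move=> t0; rewrite (tens_sum t).
transitivity ((e : reg R) ⊠ lmul_map t); last by rewrite t0 pure0r.
rewrite /lmul_map /tlift (morph_sumr _ _ (pureDr _)).
rewrite big_seq [RHS]big_seq; apply: eq_bigr => p pt.
by rewrite -pure_bal -[in LHS](proj1 (he _ (map_f _ pt))).
Qed.

Lemma lfirm_common (M : lmod R) (s : seq M) : lfirm M ->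
  exists2 e : R, e ⋆ e = e & forall m, m \in s -> e *> m = m.
Proof.
move/lfirmP=> h; elim: s => [|m s [f ff hf]].
  by have [e ee _] := local_unit1 0; exists e.
have [e ee em] := h m; have [g gg [ge _ gf _]] := local_unit2 e f.
exists g => // n; rewrite inE => /orP[/eqP->|/hf <-]; last by rewrite lactA gf.
by rewrite -em lactA ge.
Qed.

Lemma rfirm_sub (X : rmod R) (K : submod X) : rfirm X -> rfirm (sub_rmod K).
Proof.
move=> /(rfirmP _ hR) h; apply/(rfirmP _ hR) => x.
have [e ee ex] := h (sub_incl K x); exists e => //.
by apply: sub_incl_inj; rewrite rhomM.
Qed.

Lemma rfirm_quot (X : rmod R) (K : submod X) : rfirm X -> rfirm (quot_rmod K).
Proof.
move=> /(rfirmP _ hR) h; apply/(rfirmP _ hR) => q.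
have [x <-] := quot_proj_surj q.
by have [e ee ex] := h x; exists e; rewrite // -rhomM ex.
Qed.

Section FirmPart.
Variable X : rmod R.

Lemma firm_part0 : exists2 e : R, e ⋆ e = e & (0 : X) <* e = 0.
Proof. by have [e ee _] := local_unit1 0; exists e; rewrite // ract0. Qed.
Lemma firm_partB (x y : X) : (exists2 e : R, e ⋆ e = e & x <* e = x) ->
  (exists2 e : R, e ⋆ e = e & y <* e = y) -> exists2 e : R, e ⋆ e = e & (x - y) <* e = x - y.
Proof.
move=> [e ee ex] [f ff fy]; have [g gg [_ eg _ fg]] := local_unit2 e f.
by exists g => //; rewrite ractDl ractN -ex -fy !ractA eg fg.
Qed.
Lemma firm_partM (x : X) (r : R) : (exists2 e : R, e ⋆ e = e & x <* e = x) ->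
  exists2 e : R, e ⋆ e = e & x <* r <* e = x <* r.
Proof. by move=> _; have [e ee [_ re]] := local_unit1 r; exists e; rewrite // ractA re. Qed.

(** The submodule [X R], the largest firm submodule of [X]. *)
Definition firm_part : submod X := Submod firm_part0 firm_partB firm_partM.

Lemma firm_part_firm : rfirm (sub_rmod firm_part).
Proof.
apply/(rfirmP _ hR) => x; have [e ee ex] := sub_inclP x; exists e => //.
by apply: sub_incl_inj; rewrite rhomM.
Qed.

Variable S : lmod R.
Hypothesis hS : lfirm S.

(* The inverse sends x ⊠ u to (x e) ⊠ u, for any idempotent e fixing u. *)
Lemma firm_part_tens : bijective (tmap (sub_incl firm_part) (@id S)).
Proof.
have iD := tmapD (rhP (sub_incl firm_part)) (@llinear_id _ S).
have act (x : X) (e : R) : e ⋆ e = e -> firm_part (x <* e).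
  by move=> ee; exists e; rewrite // ractA ee.
pose b (x : X) (u : S) : sub_rmod firm_part ⊗ S :=
  let e := cid2 (proj1 (lfirmP S) hS u) in
  sub_elt (act x (s2val e) (s2valP e)) ⊠ u.
have bE x u e (ee : e ⋆ e = e) : e *> u = u -> b x u = sub_elt (act x e ee) ⊠ u.
  move=> eu; rewrite /b; case: cid2 => f ff fu /=.
  have [g gg [ge eg gf fg]] := local_unit2 e f.
  have E w ww : g ⋆ w = w -> w *> u = u ->
      sub_elt (act x w ww) ⊠ u = sub_elt (act x g gg) ⊠ u.
    move=> gw wu; rewrite -[in RHS]wu -pure_bal; congr (_ ⊠ _).
    by apply: sub_incl_inj; rewrite rhomM !sub_eltK ractA gw.
  by rewrite !E.
have bb : balanced b.
  split=> [u x y|x u v|x r u].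
  - have [e ee eu] := proj1 (lfirmP S) hS u.
    rewrite !(bE _ _ e ee eu) -pureDl; congr (_ ⊠ _); apply: sub_incl_inj.
    by rewrite rhomD !sub_eltK ractDl.
  - have [e ee he] := lfirm_common [:: u; v] hS.
    have eu : e *> u = u by apply: he; rewrite inE eqxx.
    have ev : e *> v = v by apply: he; rewrite !inE eqxx orbT.
    by rewrite !(bE _ _ e ee) ?lactDl ?eu ?ev // pureDr.
  - have [e0 ee0 eu0] := proj1 (lfirmP S) hS u.
    have [g gg [ge eg gr rg]] := local_unit2 e0 r.
    have gu : g *> u = u by rewrite -eu0 lactA ge.
    have gru : g *> (r *> u) = r *> u by rewrite lactA gr.
    rewrite !(bE _ _ g gg) // -pure_bal; congr (_ ⊠ _).
    by apply: sub_incl_inj; rewrite rhomM !sub_eltK !ractA rg gr.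
exists (tlift b).
  apply: tens_ext => [s t|s t|x u] //; first by rewrite iD tliftD.
  rewrite tmapE // tliftE //.
  have [e ee eu] := proj1 (lfirmP S) hS u.
  rewrite (bE _ _ e ee eu) -[in RHS]eu -pure_bal; congr (_ ⊠ _).
  by apply: sub_incl_inj; rewrite rhomM.
apply: tens_ext => [s t|s t|x u] //; first by rewrite tliftD // iD.
have [e ee eu] := proj1 (lfirmP S) hS u.
by rewrite tliftE // (bE _ _ e ee eu) tmapE // sub_eltK pure_bal eu.
Qed.
End FirmPart.

Lemma short_exact_tens (S : lmod R) (X Y Z : rmod R) (f : rhom X Y) (g : rhom Y Z) :
  short_exact f g -> injective (tmap f (@id S)) ->
  short_exact (tmap f (@id S)) (tmap g (@id S)).
Proof.
case=> _ fg gs fI; split=> //; last exact: tmap_surj.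
move=> t; split=> [|[s <-]].
  by apply: tens_right_exact => // y /fg.
rewrite tmap_comp // /tmap /tlift big1 // => p _ /=.
by rewrite (proj2 (fg _)) ?pure0l //; exists p.1.
Qed.

(** Because [X R ⊗ S] is [X ⊗ S], injectivity can be tested on firm parts. This is the form in which
    flatness is accessible to a functor defined on firm modules only. *)
Lemma flat_firm (S : lmod R) : lfirm S ->
  (forall (X Y : rmod R) (f : rhom X Y), rfirm X -> rfirm Y -> injective f ->
     injective (tmap f (@id S))) ->
  flat_on (fun=> True) S.
Proof.
move=> hS hf X Y Z f g _ _ _ fg; apply: short_exact_tens => //.
have fI : injective f by case: fg.
have Kf x : firm_part Y (f (sub_incl (firm_part X) x)).
  by have [e ee ex] := sub_inclP x; exists e; rewrite // -rhomM ex.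
have [f' f'E] := @sub_corestr _ _ (firm_part Y) _ (rhom_comp f (sub_incl _)) Kf.
have f'I : injective (tmap f' (@id S)).
  apply: hf; [exact: firm_part_firm|exact: firm_part_firm|] => x y e.
  by apply: sub_incl_inj; apply: fI; have := f'E x; rewrite e f'E.
have iD (X' : rmod R) := tmapD (rhP (sub_incl (firm_part X'))) (@llinear_id _ S).
apply: additive_inj => [|t ft0]; first exact: tmapD.
have [j jK Kj] := firm_part_tens X hS.
rewrite -(Kj t) in ft0 *; move: (j t) ft0 => s {j jK Kj} fs0.
suff -> : s = 0 by rewrite (morph0 (iD X)).
apply: f'I; rewrite (morph0 (tmapD (rhP f') (@llinear_id _ S))).
apply: (bij_inj (firm_part_tens Y hS)); rewrite (morph0 (iD Y)) -fs0 !tmap_comp //.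
by apply: eq_tmap => // x; apply: f'E.
Qed.
End LocalUnits.

(** * Pairings, quotient comodules and cofree comodules *)

(* For the copairing eta of a comatrix coring context, [ev] identifies N ⊗ Sd with    *)
(* the A-linear maps S -> N that are fixed by some idempotent of R.                   *)
Section Pairing.
Variables (R A : rng) (S : bimod R A) (Sd : bimod A R) (eps : Sd ⊗ S -> A).
Hypothesis epsP : @bilinear_map A A (Sd ⊗b S) (reg A) eps.

Lemma pairDl x y u : eps ((x + y) ⊠ u) = eps (x ⊠ u) + eps (y ⊠ u).
Proof. by case: epsP => [[eD _] _]; rewrite pureDl eD. Qed.
Lemma pairDr x u v : eps (x ⊠ (u + v)) = eps (x ⊠ u) + eps (x ⊠ v).
Proof. by case: epsP => [[eD _] _]; rewrite pureDr eD. Qed.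
Lemma pairZl a x u : eps ((a *> x : Sd) ⊠ u) = a ⋆ eps (x ⊠ u).
Proof. by case: epsP => [[_ eZ] _]; rewrite -[RHS]eZ tens_lactE. Qed.
Lemma pairZr x u a : eps (x ⊠ (u <* a : S)) = eps (x ⊠ u) ⋆ a.
Proof. by case: epsP => [_ [_ eZ]]; rewrite -[RHS]eZ tens_ractE. Qed.

Lemma ev_balanced (N : rmod A) (u : S) :
  @balanced A N Sd N (fun (n : N) (x : Sd) => n <* eps (x ⊠ u)).
Proof.
split=> [x m n|n x y|n a x] /=; first by rewrite ractDl.
- by rewrite pairDl ractDr.
- by rewrite pairZl ractA.
Qed.

Definition ev (N : rmod A) (t : N ⊗ Sd) (u : S) : N :=
  tlift (fun (n : N) (x : Sd) => n <* eps (x ⊠ u)) t.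

Section Ev.
Variable N : rmod A.
Implicit Types t : N ⊗ Sd.

Lemma evE (n : N) x u : ev (n ⊠ x) u = n <* eps (x ⊠ u).
Proof. exact: (tliftE (ev_balanced N u)). Qed.
Lemma evD u : {morph (fun t => ev t u) : s t / s + t}.
Proof. exact: (tliftD (ev_balanced N u)). Qed.

Lemma ev_rlinear t : rlinear (ev t).
Proof.
split=> [u v|u a].
  elim/tens_ind: t => [|s t hs ht|n x]; rewrite ?(morph0 (evD _)) ?addr0 //.
    by rewrite !evD hs ht addrACA.
  by rewrite !evE pairDr ractDr.
elim/tens_ind: t => [|s t hs ht|n x]; rewrite ?(morph0 (evD _)) ?ract0 //.
  by rewrite !evD hs ht ractDl.
by rewrite !evE pairZr ractA.
Qed.
Definition ev_rhom t : rhom S N := RHom (ev_rlinear t).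

Lemma ev_ract (t : N ⊗r Sd) r u : ev (t <* r) u = ev t (r *> u).
Proof.
elim/tens_ind: t => [|s t hs ht|n x].
- by rewrite ract0 !(morph0 (evD _)).
- by rewrite ractDl !evD hs ht.
- by rewrite tens_ractE !evE pure_bal.
Qed.
End Ev.

Lemma ev_tmap (N N' : rmod A) (f : N -> N') (t : N ⊗ Sd) u : rlinear f ->
  ev (tmap f (@id Sd) t) u = f (ev t u).
Proof.
move=> fP; have fD := tmapD fP (@llinear_id _ Sd).
elim/tens_ind: t => [|s t hs ht|n x].
- by rewrite (morph0 fD) !(morph0 (evD _)) (morph0 (proj1 fP)).
- by rewrite fD !evD (proj1 fP) hs ht.
- by rewrite tmapE // !evE (proj2 fP).
Qed.

Variable eta : R -> S ⊗ Sd.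
Hypothesis unitS : forall (r : R) (u : S),
  tlift (fun (e : S) (f : Sd) => @ract A S e (eps (f ⊠ u))) (eta r) = @lact R S r u.
Hypothesis unitSd : forall (r : R) (x : Sd),
  tlift (fun (e : S) (f : Sd) => @lact A Sd (eps (x ⊠ e)) f) (eta r) = @ract R Sd x r.

Lemma ev_eta_id r u : ev (eta r) u = r *> u.
Proof. exact: unitS. Qed.

Lemma ev_eta (N : rmod A) (g : rhom S N) r u :
  ev (tmap g (@id Sd) (eta r)) u = g (r *> u).
Proof. by rewrite ev_tmap // ev_eta_id. Qed.

Lemma dual_act_balanced (x : S -> A) : @rlinear A S (reg A) x ->
  @balanced A S Sd Sd (fun (e : S) (f : Sd) => @lact A Sd (x e) f).
Proof.
case=> xD xZ; split=> [f u v|e f g|e a f] /=.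
- by rewrite xD lactDr.
- by rewrite lactDl.
- by rewrite xZ lactA.
Qed.

(** On pure tensors this is the triangle identity of [Sd]. It recovers [t <* r] from the map [ev t]
    alone. *)
Lemma ev_unit (N : rmod A) (t : N ⊗r Sd) r : t <* r = tmap (ev_rhom t) (@id Sd) (eta r).
Proof.
elim/tens_ind: t => [|s t hs ht|n x].
- rewrite ract0 /tmap /tlift big1 // => p _ /=.
  by rewrite (morph0 (evD _)) pure0l.
- rewrite ractDl hs ht /tmap /tlift -big_split; apply: eq_bigr => p _ /=.
  by rewrite evD pureDl.
rewrite tens_ractE -unitSd.
have xP : @rlinear A S (reg A) (fun u : S => eps (x ⊠ u)).
  by split=> [u v|u a]; rewrite ?pairDr ?pairZr.
move: (eta r); apply: tens_ext => [s t|s t|e f].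
- by rewrite (tliftD (dual_act_balanced xP)) pureDr.
- exact: tmapD.
- by rewrite (tliftE (dual_act_balanced xP)) tmapE // [ev_rhom _ _]evE pure_bal.
Qed.

Hypothesis hR : has_idempotent_local_units R.
Hypothesis hSd : @rfirm R Sd.

(** Every element of [N ⊗ Sd] is fixed by an idempotent [e], and [ev_unit] at [e] rebuilds it from
    its evaluation. *)
Lemma ev_inj (N : rmod A) (s t : N ⊗ Sd) : ev s =1 ev t -> s = t.
Proof.
move=> e; apply/eqP; rewrite -subr_eq0; apply/eqP.
have {e} : ev (s - t) =1 (fun=> 0).
  by move=> u; rewrite (morphB _ _ (evD u)) e subrr.
move: (s - t : N ⊗r Sd) => {s}t e.
have [f _ <-] := tens_firm_unit t hR hSd.
by rewrite ev_unit /tmap /tlift big1 // => p _ /=; rewrite e pure0l.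
Qed.

Lemma dagger_flat (N N' : rmod A) (f : rhom N N') : injective f ->
  injective (tmap f (@id Sd)).
Proof.
move=> fI s t e; apply: ev_inj => u; apply: fI.
by rewrite -!ev_tmap // e.
Qed.
End Pairing.

Section Counit.
Variables (A : pzRingType) (C : coring A).

Definition tcounit (M : rmod A) (t : M ⊗ C) : M :=
  tlift (fun (x : M) (c : C) => x <* (counit c : A)) t.

Lemma tcounit_balanced (M : rmod A) :
  @balanced A M C M (fun (x : M) (c : C) => x <* (counit c : A)).
Proof.
case: (counitP (coringP C)) => [[eD eZ] _].
split=> [c x y|x c d|x a c] /=; rewrite ?ractDl ?eD ?ractDr //.
by rewrite eZ ractA.
Qed.

Lemma tcounitE (M : rmod A) (x : M) (c : C) : tcounit (x ⊠ c) = x <* (counit c : A).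
Proof. exact: tliftE (tcounit_balanced M) _ _. Qed.
Lemma tcounitD (M : rmod A) : {morph @tcounit M : x y / x + y}.
Proof. exact: tliftD (tcounit_balanced M). Qed.

Lemma tcounit_nat (M N : rmod A) (f : M -> N) (t : M ⊗ C) : rlinear f ->
  tcounit (tmap f (@id C) t) = f (tcounit t).
Proof.
move=> fP; have fD := tmapD fP (@llinear_id _ C).
elim/tens_ind: t => [|s t hs ht|n x].
- by rewrite (morph0 fD) !(morph0 (@tcounitD _)) (morph0 (proj1 fP)).
- by rewrite fD !tcounitD (proj1 fP) hs ht.
- by rewrite tmapE // !tcounitE (proj2 fP).
Qed.

Lemma rhoD (M : comod C) : {morph @rho A C M : x y / x + y}.
Proof. by case: (rho_linear (comodP M)). Qed.

Lemma tcounit_rho (M : comod C) (m : M) : tcounit (rho m) = m.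
Proof. exact: rho_counit (comodP M) m. Qed.
End Counit.

Section QuotComod.
Variables (A : pzRingType) (C : coring A) (M : comod C) (K : submod M).
Hypothesis KP : forall x, K x -> tmap (quot_proj K) (@id C) (rho x) = 0.
Let q := quot_proj K.

(** Hypothesis [KP] asks that the coaction of [K] vanish in [M/K ⊗ C]. It takes the place of a
    subcomodule condition, since [K ⊗ C -> M ⊗ C] may fail to be injective when [C] is not flat. *)
Lemma quot_rho_ex : exists g : quot_rmod K -> quot_rmod K ⊗ C,
  forall x, g (q x) = tmap q (@id C) (rho x).
Proof.
apply: quot_desc => x y /KP e; apply/eqP; rewrite -subr_eq0; apply/eqP.
have [rD _] := rho_linear (comodP M).
by rewrite -[RHS]e (morphB _ _ rD) (morphB _ _ (tmapD (rhP q) (@llinear_id _ C))).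
Qed.

Definition quot_rho : quot_rmod K -> quot_rmod K ⊗ C := proj1_sig (cid quot_rho_ex).
Lemma quot_rhoE x : quot_rho (q x) = tmap q (@id C) (rho x).
Proof. by rewrite /quot_rho; case: cid. Qed.

Lemma quot_is_comod : @is_comod A C (quot_rmod K) quot_rho.
Proof.
have rP := rho_linear (comodP M).
have idP : @bilinear_map A A C C id by split.
have qrP : @rlinear A (M ⊗r C) (quot_rmod K ⊗r C) (tmap q (@id C)).
  exact: tmap_rlinear.
have [cl _] := comultP (coringP C).
have qP : @rlinear A (quot_rmod K) (quot_rmod K ⊗r C) quot_rho.
  split=> [x y|x a]; have [{}x <-] := quot_proj_surj x.
    have [{}y <-] := quot_proj_surj y.
    by rewrite -rhomD !quot_rhoE (proj1 rP) (proj1 qrP).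
  by rewrite -rhomM !quot_rhoE (proj2 rP) (proj2 qrP).
split=> // x; have [{}x <-] := quot_proj_surj x.
- by rewrite -rhomM (cm_unital (comodP M)).
- rewrite quot_rhoE tmap_comp //.
  rewrite (eq_tmap (f' := (tmap q (@id C) : M ⊗r C -> quot_rmod K ⊗r C)
      \o (@rho A C M : M -> M ⊗r C))
    (g' := @id C \o @id C)) //; last by move=> v /=; rewrite quot_rhoE.
  rewrite -tmap_comp // tassoc_nat // (rho_coassoc (comodP M)) !tmap_comp //.
    by apply: eq_tmap => // c /=; rewrite tmap_id.
  exact: tmap_llinear.
- by rewrite quot_rhoE [LHS]tcounit_nat // tcounit_rho.
Qed.

Definition quot_comod : comod C := Comod quot_is_comod.
Lemma quot_proj_colinear : @colinear A C M quot_comod q.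
Proof. by move=> x; rewrite /= quot_rhoE. Qed.
Definition quot_chom : chom M quot_comod := CHom quot_proj_colinear.
End QuotComod.

Section PureChom.
Variables (R : rng) (A : pzRingType) (C : coring A) (S : bicomod R C) (M : rmod R) (m : M).

Lemma pure_map_colinear :
  @colinear A C S (tens_comod S M) (RHom (pure_map_linear S m)).
Proof. by move=> u; rewrite /= tens_rhoE. Qed.
Definition pure_chom : chom S (tens_comod S M) := CHom pure_map_colinear.
End PureChom.

Section Cofree.
Variables (A : pzRingType) (C : coring A).

Lemma reg_is_comod : @is_comod A C C (@comult A C).
Proof.
case: (coringP C) => h1 h2 [h3 h4] h5 h6 h7 h8.
by split.
Qed.
Definition reg_comod : comod C := Comod reg_is_comod.

Lemma unital_lfirm (M : lmod A) : lunital M -> lfirm M.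
Proof.
move=> h; apply/lfirmP => [|m]; first exact: unital_local_units.
by exists (1 : A); [exact: mulr1 | exact: h].
Qed.

Lemma reg_is_bicomod : @is_bicomod A A C reg_comod (@bm_lact A A C).
Proof.
have h : lfirm (Lmod (bm_lactP C)) by apply: unital_lfirm; apply: cg_lunital (coringP C).
exists (bm_lactP C) => //.
  exact: bm_actC.
by move=> a c; have [[_ h'] _] := comultP (coringP C); exact: h'.
Qed.
Definition reg_bicomod : bicomod A C := Bicomod reg_is_bicomod.

Variable N : rmod A.
Let D := reg_bicomod.
(** The right adjoint of the forgetful functor, obtained by viewing [C] as an [A]-[C]-bicomodule.
    [D] has the carrier and the actions of [C] but is another term, whence the explicit identities
    [C -> D]. *)
Definition cofree : comod C := tens_comod reg_bicomod N.

Lemma reg_id_bilinear : @bilinear_map A A C D id.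
Proof. by split; split. Qed.
Let idP := reg_id_bilinear.
Let idl : @llinear A C D id := proj1 reg_id_bilinear.

Section Lift.
Variables (M : comod C) (f : rhom M N).

Lemma cofree_lift_rlinear : @rlinear A M (N ⊗r D) (fun m => tmap f (id : C -> D) (rho m)).
Proof.
have rP := rho_linear (comodP M).
have [h1 h2] : @rlinear A (M ⊗r C) (N ⊗r D) (tmap f (id : C -> D)) by exact: tmap_rlinear.
by split=> [x y|x a]; rewrite ?(proj1 rP) ?(proj2 rP) ?h1 ?h2.
Qed.
Lemma cofree_lift_colinear : @colinear A C M cofree (RHom cofree_lift_rlinear).
Proof.
move=> m /=; have rP := rho_linear (comodP M).
have [cl _] := comultP (coringP C).
have idCD := @tmap_llinear A A C D C C id id idP (@llinear_id _ C).
have fdP : @rlinear A (M ⊗r C) (N ⊗r D) (tmap f (id : C -> D)) by exact: tmap_rlinear.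
transitivity (tassoc_inv (tmap f (tmap (id : C -> D) (@id C) : C ⊗l C -> D ⊗l C)
   (tmap (@id M) (@comult A C : C -> C ⊗l C) (rho m)))).
  rewrite /tens_rho !tmap_comp //.
  congr tassoc_inv; apply: eq_tmap => // c /=; symmetry; exact: tmap_id.
by rewrite -(rho_coassoc (comodP M)) -tassoc_nat // tassocK tmap_comp.
Qed.
Definition cofree_lift : chom M cofree := CHom cofree_lift_colinear.

End Lift.

Definition cofree_counit (t : cofree) : N :=
  tlift (fun (n : N) (c : D) => n <* (@counit A C c : A)) t.

Lemma cofree_counit_balanced :
  @balanced A N D N (fun (n : N) (c : D) => n <* (@counit A C c : A)).
Proof. by case: (tcounit_balanced C N). Qed.
Lemma cofree_counitE (n : N) (c : D) : cofree_counit (n ⊠ c) = n <* (@counit A C c : A).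
Proof. exact: tliftE cofree_counit_balanced _ _. Qed.
Lemma cofree_counitD : {morph cofree_counit : x y / x + y}.
Proof. exact: tliftD cofree_counit_balanced. Qed.

Lemma cofree_liftK (M : comod C) (f : rhom M N) m : cofree_counit (cofree_lift f m) = f m.
Proof.
rewrite /= -[RHS](congr1 f (tcounit_rho m)).
have fD := tmapD (rhP f) idl.
elim/tens_ind: (rho m) => [|s t hs ht|v c].
- by rewrite (morph0 fD) (morph0 cofree_counitD) (morph0 (@tcounitD _ C M)) rhom0.
- by rewrite fD cofree_counitD tcounitD rhomD hs ht.
- by rewrite tmapE // cofree_counitE tcounitE rhomM.
Qed.
End Cofree.

(** * The dual bicomodule and its comatrix coring *)

Section FirmBimod.
Variables (Q R : rng) (M : bimod Q R).
Hypothesis hR : has_idempotent_local_units R.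

Lemma firm_lact_subproof q (x : sub_rmod (firm_part hR M)) :
  firm_part hR M (q *> (sub_incl _ x : M)).
Proof.
have [e ee xe] := sub_inclP x; exists e => //.
by rewrite -[LHS]bm_actC; congr (bm_lact q _).
Qed.
Definition firm_lact (q : Q) (x : sub_rmod (firm_part hR M)) : sub_rmod (firm_part hR M) :=
  sub_elt (firm_lact_subproof q x).
Lemma firm_lactP : left_action firm_lact.
Proof.
split=> [q x y|x q r|x q r]; apply: sub_incl_inj; rewrite /= ?sub_eltK.
- exact: (@lactDl Q M).
- exact: (@lactDr Q M).
- exact: (@lactA Q M).
Qed.
Lemma firm_actC q x r : firm_lact q (x <* r) = firm_lact q x <* r.
Proof. apply: sub_incl_inj; exact: bm_actC. Qed.
Definition firm_bimod : bimod Q R := Bimod firm_lactP firm_actC.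
End FirmBimod.

Section DualCoaction.
Variables (A : pzRingType) (C : coring A) (M : comod C).
Implicit Types x y : rhom M (reg A).

(** The map [x ⊗ C] followed by [A ⊗ C ≅ C]. *)
Definition slice x (t : M ⊗ C) : C := tlift (fun (v : M) (c : C) => @lact A C (x v) c) t.

Lemma slice_balanced x : @balanced A M C C (fun (v : M) (c : C) => @lact A C (x v) c).
Proof.
split=> [c u v|v b c|v a c] /=.
- by rewrite rhomD lactDr.
- by rewrite lactDl.
- by rewrite rhomM [RHS]lactA.
Qed.
Lemma sliceE x v (c : C) : slice x (v ⊠ c) = @lact A C (x v) c.
Proof. exact: tliftE (slice_balanced x) _ _. Qed.
Lemma sliceD x : {morph slice x : s t / s + t}.
Proof. exact: tliftD (slice_balanced x). Qed.
Lemma slice_rlinear x : @rlinear A (M ⊗r C) C (slice x).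
Proof.
split=> [|t a]; first exact: sliceD.
elim/tens_ind: t => [|s t hs ht|v c].
- by rewrite ract0 (morph0 (sliceD x)) ract0.
- by rewrite ractDl !sliceD hs ht ractDl.
- by rewrite tens_ractE !sliceE [LHS]bm_actC.
Qed.

(** The comodule map [M -> C] matching [x] under [M^* ≅ Hom^C(M, C)]; the inverse is composition
    with the counit ([counit_dual_coact], [dual_coact_counit]), and colinearity is
    [comult_dual_coact]. *)
Definition dual_coact x (u : M) : C := slice x (rho u).

Lemma dual_coact_rlinear x : @rlinear A M C (dual_coact x).
Proof. by apply: (rlinear_comp (slice_rlinear x)); apply: rho_linear (comodP M). Qed.

Lemma dual_coactDl x y u : dual_coact (rhom_add x y) u = dual_coact x u + dual_coact y u.
Proof.
rewrite /dual_coact /slice /tlift -big_split; apply: eq_bigr => p _ /=.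
by rewrite lactDr.
Qed.
Lemma dual_coactZ (a : A) x u : dual_coact (dual_lact a x) u = @lact A C a (dual_coact x u).
Proof.
rewrite /dual_coact; elim/tens_ind: (rho u) => [|s t hs ht|v c].
- by rewrite !(morph0 (sliceD _)) (morph0 (fun b c => @lactDl A C b c a)).
- by rewrite !sliceD hs ht lactDl.
- by rewrite !sliceE [RHS]lactA.
Qed.

Lemma counit_dual_coact x u : counit (dual_coact x u) = x u.
Proof.
have [[eD eZ] _] := counitP (coringP C).
rewrite -[in RHS](tcounit_rho u) /dual_coact.
elim/tens_ind: (rho u) => [|s t hs ht|v c].
- by rewrite (morph0 (sliceD _)) (morph0 (@tcounitD _ _ _)) (morph0 eD) rhom0.
- by rewrite sliceD tcounitD eD rhomD hs ht.
- by rewrite sliceE tcounitE eZ rhomM.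
Qed.

Lemma slice_colinear x v (y : C ⊗ C) :
  tmap (slice x : M ⊗r C -> C) (@id C) (tassoc_inv (v ⊠ (y : C ⊗l C)))
  = @lact A (C ⊗l C) (x v) y.
Proof.
have sP := tmapD (slice_rlinear x) (@llinear_id _ C).
elim/tens_ind: y => [|s t hs ht|b c].
- rewrite pure0r (morph0 (@tassoc_invD _ _ _ _ _)) (morph0 sP).
  by rewrite (morph0 (fun b c => @lactDl A (C ⊗l C) b c (x v))).
- by rewrite pureDr tassoc_invD sP hs ht lactDl.
- rewrite tassoc_invE tmapE //; last exact: slice_rlinear.
  by rewrite sliceE tens_lactE.
Qed.

Lemma comult_dual_coact x u :
  comult (dual_coact x u) = tmap (dual_coact x) (@id C) (rho u).
Proof.
have [cl _] := comultP (coringP C).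
have sP := slice_rlinear x.
have rP := rho_linear (comodP M).
transitivity (tmap (slice x : M ⊗r C -> C) (@id C)
   (tassoc_inv (tmap (@id M) (@comult A C : C -> C ⊗l C) (rho u)))).
  rewrite /dual_coact; elim/tens_ind: (rho u) => [|s t hs ht|v c].
  - rewrite (morph0 (sliceD _)) (morph0 (tmapD _ cl)) // (morph0 (@tassoc_invD _ _ _ _ _)).
    by rewrite (morph0 (tmapD sP _)) // (morph0 (proj1 cl)).
  - rewrite sliceD (proj1 cl) hs ht (tmapD (@rlinear_id _ M) cl) tassoc_invD.
    by rewrite (tmapD sP (@llinear_id _ C)).
  - by rewrite sliceE tmapE // slice_colinear (proj2 cl).
by rewrite -(rho_coassoc (comodP M)) tassocK tmap_comp.
Qed.

Lemma dual_coact_counit (g : chom M (reg_comod C)) (x : rhom M (reg A)) :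
  (forall u, x u = counit (g u)) -> dual_coact x =1 g.
Proof.
move=> xE u; rewrite -[RHS](counitl (coringP C)).
have := chP g u; rewrite [rho (g u)]/= => ->.
rewrite /dual_coact.
have b : @balanced A C C C (fun a c : C => @lact A C (counit a) c).
  have [[eD eZ] [_ eZ']] := counitP (coringP C).
  split=> [c u' v|v b c|v a c] /=; rewrite ?eD ?lactDr ?lactDl //.
  by rewrite eZ' [RHS]lactA.
have gD := tmapD (rhP g) (@llinear_id _ C).
elim/tens_ind: (rho u) => [|s t hs ht|v c].
- by rewrite (morph0 (sliceD _)) (morph0 gD) (morph0 (tliftD b)).
- by rewrite sliceD hs ht [tmap _ _ (s + t)]gD (tliftD b).
- by rewrite sliceE tmapE // (tliftE b) xE.
Qed.
End DualCoaction.

Section CanonicalMap.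
Variables (A : pzRingType) (C : coring A) (R : rng) (S : bicomod R C).

Lemma dual_coact_act (x : rhom S (reg A)) (r : R) (u : S) :
  dual_coact (rhom_comp x (RHom (lact_rlinear S r))) u = dual_coact x (r *> u).
Proof.
rewrite /dual_coact; have := bc_rho (bicomodP S) r u => /= ->.
have lD := tmapD (lact_rlinear S r) (@llinear_id _ C).
elim/tens_ind: (rho u) => [|s t hs ht|v c].
- by rewrite (morph0 (sliceD _)) [tmap _ _ _](morph0 lD) (morph0 (sliceD _)).
- by rewrite sliceD hs ht [in RHS]lD sliceD.
- by rewrite sliceE [in RHS]tmapE ?sliceE //; apply: (lact_rlinear S r).
Qed.

Lemma can_balanced :
  @balanced R (dual_bimod S) S C (fun (f : dual_bimod S) (u : S) => dual_coact f u).
Proof.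
split=> [u f g|f u v|f r u] /=.
- by rewrite -dual_coactDl; congr (dual_coact _ u); apply: rhom_eq.
- exact: (proj1 (dual_coact_rlinear _)).
- by rewrite -dual_coact_act; congr (dual_coact _ u); apply: rhom_eq.
Qed.
Lemma canE (f : rhom S (reg A)) (u : S) : can ((f : dual_bimod S) ⊠ u) = dual_coact f u.
Proof. exact: tliftE can_balanced _ _. Qed.
Lemma canD : {morph @can R A C S : s t / s + t}.
Proof. exact: tliftD can_balanced. Qed.
End CanonicalMap.

Section Dagger.
Variables (A : pzRingType) (C : coring A) (R : rng) (S : bicomod R C).
Hypothesis hR : has_idempotent_local_units R.

(* S^* R instead of the isomorphic S^* ⊗ R, so that elements are functionals. *)
Definition dagger : bimod A R := firm_bimod (dual_bimod S) hR.
Implicit Types x y : dagger.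

Definition functional x : rhom S (reg A) := sub_incl (firm_part hR (dual_bimod S)) x.

Lemma functional_inj x y : functional x =1 functional y -> x = y.
Proof. by move/rhom_eq => e; apply: sub_incl_inj. Qed.
Lemma functionalD x y u : functional (x + y) u = functional x u + functional y u.
Proof. by []. Qed.
Lemma functional_lact (a : A) x u : functional (@lact A dagger a x) u = a * functional x u.
Proof. by []. Qed.
Lemma functional_ract x r u : functional (x <* r) u = functional x (r *> u).
Proof. by []. Qed.

Lemma dagger_elt_subproof (f : dual_rmod S) (r : R) : firm_part hR (dual_bimod S) (f <* r).
Proof. by have [e ee [_ re]] := local_unit1 hR r; exists e; rewrite // ractA re. Qed.
Definition dagger_elt (f : rhom S (reg A)) (r : R) : dagger :=
  sub_elt (dagger_elt_subproof f r).
Lemma dagger_eltE f r u : functional (dagger_elt f r) u = f (r *> u).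
Proof. by []. Qed.

Lemma dagger_firm : @rfirm R dagger.
Proof. exact: firm_part_firm. Qed.
Lemma dagger_unit x : exists2 e : R, e ⋆ e = e & x <* e = x.
Proof. exact: (proj1 (rfirmP _ hR) dagger_firm). Qed.
Lemma dagger_unital : @lunital A dagger.
Proof. by move=> x; apply: functional_inj => u; rewrite functional_lact mul1r. Qed.

Definition pairing (t : dagger ⊗ S) : A :=
  tlift (fun (x : dagger) (u : S) => functional x u : A) t.
Lemma pairing_balanced : @balanced R dagger S A (fun (x : dagger) (u : S) => functional x u : A).
Proof. by split=> // x u v; apply: rhomD. Qed.
Lemma pairingE x (u : S) : pairing (x ⊠ u) = functional x u.
Proof. exact: tliftE pairing_balanced _ _. Qed.
Lemma pairingD : {morph pairing : s t / s + t}.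
Proof. exact: tliftD pairing_balanced. Qed.

Lemma pairing_bilinear : @bilinear_map A A (dagger ⊗b S) (reg A) pairing.
Proof.
split; (split; first exact: pairingD).
- move=> a t; elim/tens_ind: t => [|s t hs ht|x u].
  + rewrite (morph0 (fun b c => @lactDl A (dagger ⊗l S) b c a)) (morph0 pairingD).
    by rewrite (morph0 (fun b c => @lactDl A (reg A) b c a)).
  + by rewrite lactDl !pairingD hs ht lactDl.
  + by rewrite tens_lactE !pairingE functional_lact.
- move=> t a; elim/tens_ind: t => [|s t hs ht|x u].
  + by rewrite ract0 (morph0 pairingD) ract0.
  + by rewrite ractDl !pairingD hs ht ractDl.
  + by rewrite tens_ractE !pairingE rhomM.
Qed.
Let epsP := pairing_bilinear.
Local Notation evt N := (@ev R A S dagger pairing N).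

Hypothesis basis : forall r : R, exists t : S ⊗ dagger, forall u : S, evt S t u = r *> u.

(** Chosen arbitrarily among the elements representing multiplication by [r], yet unique by
    [ev_inj]; its bilinearity follows from uniqueness. *)
Definition copairing (r : R) : S ⊗ dagger := proj1_sig (cid (basis r)).
Lemma copairingE r (u : S) : evt S (copairing r) u = r *> u.
Proof. by rewrite /copairing; case: cid. Qed.

Lemma functional_tlift (f : rhom S (reg A)) (t : S ⊗ dagger) u :
  functional (tlift (fun (e : S) (g : dagger) => @lact A dagger (f e) g) t) u = f (evt S t u).
Proof.
have b := dual_act_balanced dagger (rhP f).
elim/tens_ind: t => [|s t hs ht|e g].
- by rewrite (morph0 (tliftD b)) (morph0 (evD epsP u)) rhom0.
- by rewrite (tliftD b) functionalD hs ht evD // rhomD.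
- by rewrite (tliftE b) functional_lact evE // pairingE rhomM.
Qed.

(** As elements of [dagger] are functionals, this triangle identity is the one on [S] followed by
    [functional x]. *)
Lemma copairing_unitSd (r : R) (x : dagger) :
  tlift (fun (e : S) (g : dagger) => @lact A dagger (pairing (x ⊠ e)) g) (copairing r) = x <* r.
Proof.
apply: functional_inj => u; rewrite functional_ract -copairingE -functional_tlift.
congr (functional _ u); apply: eq_tlift => e g; by rewrite pairingE.
Qed.

Let evI := ev_inj epsP copairing_unitSd hR dagger_firm.

Lemma copairing_bilinear : @bilinear_map R R (reg R) (S ⊗b dagger) copairing.
Proof.
have cD : {morph copairing : r s / r + s}.
  by move=> r s; apply: evI => u; rewrite evD // !copairingE lactDr.
split; (split; first exact: cD) => r s; apply: evI => u.
  rewrite [RHS](ev_tmap epsP _ _ (lact_rlinear S r)) !copairingE.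
  by rewrite [RHS]lactA.
by rewrite ev_ract // !copairingE lactA.
Qed.

Lemma dagger_context : comatrix_context copairing pairing.
Proof.
split.
- exact: reg_firm.
- exact/runital_rfirm/mulr1.
- exact: bc_firm (bicomodP S).
- exact/runital_rfirm/cm_unital/comodP.
- exact/unital_lfirm/dagger_unital.
- exact: dagger_firm.
- exact: copairing_bilinear.
- exact: pairing_bilinear.
- exact: copairingE.
- exact: copairing_unitSd.
Qed.

(** The coaction of [x] is the element of [C ⊗ S^* R] that represents the comodule map
    [dual_coact x : S -> C]; it exists since [x] is fixed by an idempotent. *)
Lemma dagger_lam_ex x : exists l : C ⊗ dagger, evt C l =1 dual_coact (functional x).
Proof.
have [e ee xe] := dagger_unit x.
exists (tmap (dual_coact (functional x)) (@id dagger) (copairing e)) => u.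
rewrite ev_tmap //; last exact: dual_coact_rlinear.
rewrite copairingE -[in RHS]xe -dual_coact_act.
by congr (dual_coact _ u); apply: rhom_eq.
Qed.
Definition dagger_lam x : C ⊗ dagger := proj1_sig (cid (dagger_lam_ex x)).
Lemma dagger_lamE x u : evt C (dagger_lam x) u = dual_coact (functional x) u.
Proof. by rewrite /dagger_lam; case: cid => l /= ->. Qed.

Lemma dagger_lam_bilinear : @bilinear_map A R dagger (C ⊗b dagger) dagger_lam.
Proof.
have lD : {morph dagger_lam : r s / r + s}.
  move=> x y; apply: evI => u; rewrite evD // !dagger_lamE -dual_coactDl.
  by congr (dual_coact _ u); apply: rhom_eq.
split; (split; first exact: lD); [move=> a x|move=> x r]; apply: evI => u.
  rewrite [RHS](ev_tmap epsP _ _ (lact_rlinear C a)) !dagger_lamE -dual_coactZ.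
  by congr (dual_coact _ u); apply: rhom_eq.
rewrite ev_ract // !dagger_lamE -dual_coact_act.
by congr (dual_coact _ u); apply: rhom_eq.
Qed.

(** Under evaluation the left coaction on [S^* R] turns into precomposition with the right coaction
    on [S]. Coassociativity and the cotensor condition thereby become statements about maps. *)
Lemma ev_dagger_lam (N : rmod A) (t : N ⊗ dagger) (u : S) :
  evt (N ⊗r C) (tassoc_inv (tmap (@id N) (dagger_lam : dagger -> C ⊗l dagger) t)) u
  = tmap (evt N t) (@id C) (rho u).
Proof.
have [ll _] := dagger_lam_bilinear.
elim/tens_ind: t => [|s t hs ht|c x].
- rewrite (morph0 (tmapD (@rlinear_id _ N) ll)) (morph0 (@tassoc_invD _ _ _ _ _)).
  rewrite (morph0 (evD epsP u)).
  by rewrite /tmap /tlift big1 // => p _; rewrite (morph0 (evD epsP _)) pure0l.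
- rewrite (tmapD (@rlinear_id _ N) ll) tassoc_invD evD // hs ht.
  by rewrite /tmap /tlift -big_split; apply: eq_bigr => p _ /=; rewrite evD // pureDl.
rewrite tmapE //.
transitivity (c ⊠ evt C (dagger_lam x) u).
  elim/tens_ind: (dagger_lam x) => [|s t hs ht|b y].
  - by rewrite pure0r (morph0 (@tassoc_invD _ _ _ _ _)) !(morph0 (evD epsP u)) pure0r.
  - by rewrite pureDr tassoc_invD !evD // hs ht pureDr.
  - by rewrite tassoc_invE !evE // tens_ractE.
rewrite dagger_lamE /dual_coact.
have eP := ev_rlinear epsP (c ⊠ x : N ⊗ dagger).
elim/tens_ind: (rho u) => [|s t hs ht|v b].
- by rewrite (morph0 (sliceD _)) pure0r (morph0 (tmapD eP _)).
- by rewrite sliceD pureDr hs ht (tmapD eP).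
- by rewrite sliceE tmapE // evE // pairingE pure_bal.
Qed.

Lemma dagger_is_lbicomod : @is_lbicomod A C R dagger dagger_lam.
Proof.
split.
- exact: dagger_unital.
- exact: dagger_firm.
- exact: dagger_lam_bilinear.
- move=> x; have [_ cr] := comultP (coringP C).
  apply: (can_inj (@tassoc_invK _ _ _ _ _)); rewrite tassocK.
  apply: evI => u; rewrite ev_dagger_lam ev_tmap // dagger_lamE comult_dual_coact.
  by apply: eq_tmap => // v; rewrite dagger_lamE.
- move=> x; apply: functional_inj => u.
  have [[eD eZ] er] := counitP (coringP C).
  have b : @balanced A C dagger dagger (fun (c : C) (y : dagger) => @lact A dagger (counit c) y).
    split=> [y c c'|c y y'|c a y]; first by rewrite eD (@lactDr A dagger).
      exact: (@lactDl A dagger).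
    by rewrite (proj2 er) [RHS](@lactA A dagger).
  rewrite -(counit_dual_coact (functional x)) -dagger_lamE.
  elim/tens_ind: (dagger_lam x) => [|s t hs ht|c y].
  + by rewrite (morph0 (tliftD b)) (morph0 (evD epsP u)) (morph0 eD).
  + by rewrite (tliftD b) functionalD hs ht evD // eD.
  + by rewrite (tliftE b) functional_lact evE // (proj2 er) pairingE.
Qed.
Definition dagger_lbicomod : lbicomod C R := Lbicomod dagger_is_lbicomod.

(** Evaluation sends the two sides of the cotensor equation to the two sides of the colinearity
    equation. *)
Lemma in_cotensorP (N : comod C) (t : N ⊗ dagger) :
  @in_cotensor A C R dagger_lbicomod N t <->
  forall u, rho (evt N t u) = tmap (evt N t) (@id C) (rho u).
Proof.
have rP := rho_linear (comodP N).
split=> [e u|e].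
  rewrite -ev_dagger_lam -[X in tassoc_inv X]e tassocK.
  by rewrite ev_tmap.
apply: (can_inj (@tassoc_invK _ _ _ _ _)); rewrite tassocK.
apply: evI => u; rewrite [RHS]ev_dagger_lam -e.
by rewrite ev_tmap.
Qed.

Lemma dagger_coactionP : @dagger_coaction R A C S dagger_lbicomod copairing.
Proof.
move=> f s r; apply: evI => u.
rewrite [LHS]dagger_lamE.
transitivity (dual_coact f ((s ⋆ r) *> u)).
  rewrite -dual_coact_act; congr (dual_coact _ u); apply: rhom_eq => v.
  by rewrite functional_tlift copairingE.
have dP := dual_coact_rlinear f.
rewrite -lactA -copairingE.
have gP := ract_llinear dagger r; have tD := tmapD dP gP.
rewrite -[X in _ = evt C X u]/(tmap (dual_coact f) (fun g : dagger => g <* r) (copairing s)).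
elim/tens_ind: (copairing s) => [|t t' ht ht'|e g].
- by rewrite (morph0 tD) !(morph0 (evD epsP _)) (morph0 (proj1 dP)).
- by rewrite tD !evD // (proj1 dP) ht ht'.
- by rewrite tmapE // !evE // (proj2 dP) !pairingE.
Qed.

Definition dagger_can (t : dagger ⊗ S) : C :=
  tlift (fun (x : dagger) (u : S) => dual_coact (functional x) u) t.

Lemma dagger_can_balanced :
  @balanced R dagger S C (fun (x : dagger) (u : S) => dual_coact (functional x) u).
Proof.
split=> [u x y|x u v|x r u] /=.
- by rewrite -dual_coactDl; congr (dual_coact _ u); apply: rhom_eq.
- exact: (proj1 (dual_coact_rlinear _)).
- by rewrite -dual_coact_act; congr (dual_coact _ u); apply: rhom_eq.
Qed.
Lemma dagger_canE x (u : S) : dagger_can (x ⊠ u) = dual_coact (functional x) u.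
Proof. exact: tliftE dagger_can_balanced _ _. Qed.
Lemma dagger_canD : {morph dagger_can : s t / s + t}.
Proof. exact: tliftD dagger_can_balanced. Qed.

Lemma dagger_can_bilinear : @bilinear_map A A (dagger ⊗b S) C dagger_can.
Proof.
split; (split; first exact: dagger_canD).
- move=> a t; elim/tens_ind: t => [|s t hs ht|x u].
  + rewrite (morph0 (fun b c => @lactDl A (dagger ⊗l S) b c a)) (morph0 dagger_canD).
    by rewrite (morph0 (fun b c => @lactDl A C b c a)).
  + by rewrite lactDl !dagger_canD hs ht lactDl.
  + rewrite tens_lactE !dagger_canE -dual_coactZ.
    by congr (dual_coact _ u); apply: rhom_eq.
- move=> t a; elim/tens_ind: t => [|s t hs ht|x u].
  + by rewrite ract0 (morph0 dagger_canD) ract0.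
  + by rewrite ractDl !dagger_canD hs ht ractDl.
  + by rewrite tens_ractE !dagger_canE (proj2 (dual_coact_rlinear _)).
Qed.
Lemma counit_dagger_can t : counit (dagger_can t) = pairing t.
Proof.
have [[eD _] _] := counitP (coringP C).
elim/tens_ind: t => [|s t hs ht|x u].
- by rewrite (morph0 dagger_canD) (morph0 pairingD) (morph0 eD).
- by rewrite dagger_canD pairingD eD hs ht.
- by rewrite dagger_canE pairingE counit_dual_coact.
Qed.

Lemma comult_inner_balanced (x : dagger) (v : S) :
  @balanced A S dagger ((dagger ⊗b S) ⊗ (dagger ⊗b S))
    (fun (e : S) (f : dagger) => (x ⊠ e : dagger ⊗b S) ⊠ (f ⊠ v : dagger ⊗b S)).
Proof.
split=> [f e e'|e f f'|e a f].
- by rewrite pureDr pureDl.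
- by rewrite pureDl pureDr.
- by rewrite -tens_ractE pure_bal tens_lactE.
Qed.

(** Stated for an arbitrary [s] instead of [copairing r], so that [s] can be decomposed into pure
    tensors. *)
Lemma dagger_can_inner (x : dagger) (v : S) (s : S ⊗ dagger) :
  tmap (dagger_can : dagger ⊗b S -> C) (dagger_can : dagger ⊗b S -> C)
    (tlift (fun (e : S) (f : dagger) =>
       (x ⊠ e : dagger ⊗b S) ⊠ (f ⊠ v : dagger ⊗b S)) s)
  = tmap (fun w => dual_coact (functional x) (evt S s w)) (@id C) (rho v).
Proof.
have bI := comult_inner_balanced x v.
have [cl cr] := dagger_can_bilinear; have dP := dual_coact_rlinear (functional x).
have ccD := tmapD cr cl.
elim/tens_ind: s => [|s t hs ht|e f].
- rewrite (morph0 (tliftD bI)) (morph0 ccD) /tmap /tlift big1 // => p _.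
  by rewrite (morph0 (evD epsP _)) (morph0 (proj1 dP)) pure0l.
- rewrite (tliftD bI) ccD hs ht /tmap /tlift -big_split; apply: eq_bigr => p _ /=.
  by rewrite evD // (proj1 dP) pureDl.
rewrite (tliftE bI) tmapE // !dagger_canE {2}/dual_coact.
have eP : @rlinear A S C (fun w => dual_coact (functional x) (evt S (e ⊠ f) w)).
  exact: (rlinear_comp dP (ev_rlinear epsP _)).
have eD := tmapD eP (@llinear_id _ C).
elim/tens_ind: (rho v) => [|s t hs ht|w c].
- by rewrite (morph0 (sliceD _)) pure0r (morph0 eD).
- by rewrite sliceD pureDr hs ht eD.
- by rewrite sliceE tmapE // evE // pairingE (proj2 dP) pure_bal.
Qed.

Lemma firm_splitK (u : S) : lmul_map (firm_split u) = u.
Proof.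
rewrite /firm_split; case: pselect => [h|[]]; first by case: cid.
by have [g _ gK] := bc_firm (bicomodP S); exists (g u); apply: gK.
Qed.

Lemma comult_dagger_can (t : dagger ⊗b S) :
  comult (dagger_can t) = tmap (dagger_can : dagger ⊗b S -> C) (dagger_can : dagger ⊗b S -> C)
    (comatrix_comult copairing t).
Proof.
have [cl cr] := dagger_can_bilinear; have [comultl _] := comultP (coringP C).
have ccD := tmapD cr cl.
rewrite [in LHS](tens_sum t) (morph_sumr _ _ dagger_canD) (morph_sumr _ _ (proj1 comultl)).
rewrite /comatrix_comult {2}/tlift (morph_sumr _ _ ccD); apply: eq_bigr => -[x u] _ /=.
(* Write [u] as the sum of the [r v] given by [firm_split], the same sum along which
   [comatrix_comult] is defined. *)
rewrite dagger_canE comult_dual_coact -[in LHS](firm_splitK u).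
rewrite /lmul_map {1 2}/tlift (morph_sumr _ _ (@rhoD A C S)).
have dP := dual_coact_rlinear (functional x).
rewrite (morph_sumr _ _ (tmapD dP (@llinear_id _ C))) (morph_sumr _ _ ccD).
apply: eq_bigr => -[r v] _ /=; rewrite dagger_can_inner.
have := bc_rho (bicomodP S) r v => /= ->; rewrite tmap_comp //; last exact: (lact_rlinear S r).
by apply: eq_tmap => // w /=; rewrite copairingE.
Qed.

Lemma dagger_comatrix_iso : bijective dagger_can -> comatrix_iso copairing pairing.
Proof.
move=> canB; exists dagger_context.
pose J : dagger -> dual_bimod S := sub_incl (firm_part hR (dual_bimod S)).
have E t : dagger_tens dagger_context t = tmap J (@id S) t.
  apply: eq_tlift => x u; congr (_ ⊠ _); apply: rhom_eq => v; exact: pairingE.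
have canE t : can (dagger_tens dagger_context t) = dagger_can t.
  have fP : @rlinear R dagger (dual_bimod S) J by [].
  rewrite E; elim/tens_ind: t => [|s t hs ht|x u].
  - by rewrite (morph0 (tmapD fP _)) // (morph0 dagger_canD) [LHS](morph0 (@canD _ _ _ _)).
  - by rewrite (tmapD fP) // [LHS](@canD _ _ _ S) dagger_canD -hs -ht.
  - by rewrite tmapE // [LHS](@canE _ _ _ S) dagger_canE.
(* [J] includes [S^* R] into [S^*], and tensoring with the firm [S] does not see the difference. *)
split; first exact: (eq_bij (firm_part_tens hR (dual_bimod S) (bc_firm (bicomodP S))) (fsym E)).
have canE' : (fun t => can (dagger_tens dagger_context t)) = dagger_can by apply: funext.
rewrite canE'; split=> //.
- exact: dagger_can_bilinear.
- exact: counit_dagger_can.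
- exact: comult_dagger_can.
Qed.
End Dagger.

(** * Kernels of comodule maps, idempotents *)

Lemma runital_sub (A : pzRingType) (X : rmod A) (K : submod X) : runital X -> runital (sub_rmod K).
Proof. by move=> h x; apply: sub_incl_inj; rewrite rhomM h. Qed.
Lemma runital_quot (A : pzRingType) (X : rmod A) (K : submod X) :
  runital X -> runital (quot_rmod K).
Proof. by move=> h q; have [x <-] := quot_proj_surj q; rewrite -rhomM h. Qed.

Section FlatCoring.
Variables (A : pzRingType) (C : coring A).
Hypothesis Cflat : left_flat C.

Lemma flat_coring_inj (X Y : rmod A) (f : rhom X Y) : runital X -> runital Y ->
  injective f -> injective (tmap f (@id C)).
Proof. exact: (flat_inj Cflat (@runital_quot A)). Qed.

Lemma tens_runital (X : rmod A) : runital (X ⊗r C).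
Proof.
move=> t; elim/tens_ind: t => [|s t hs ht|x c]; first by rewrite ract0.
  by rewrite ractDl hs ht.
by rewrite tens_ractE (cg_runital (coringP C)).
Qed.

Section Kernel.
Variables (M N : comod C) (f : chom M N).
Let K := rker f.
Let i := sub_incl K.
Let Mu : runital M := cm_unital (comodP M).
Let Ku : runital (sub_rmod K) := @runital_sub A M K Mu.
Let iC := tmap i (@id C).
Let iCI : injective iC := flat_coring_inj Ku Mu (@sub_incl_inj _ _ K).

(** By flatness [K ⊗ C] is the kernel of [f ⊗ C], where [rho (i k)] lies by colinearity of [f]. *)
Lemma ker_rho_ex (k : sub_rmod K) : exists t : sub_rmod K ⊗ C, iC t = rho (i k).
Proof.
apply: (flat_ker Cflat (@runital_sub A) (@runital_quot A)) => //.
  exact: cm_unital (comodP N).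
by rewrite -(chP f) (sub_inclP k) (morph0 (@rhoD _ _ _)).
Qed.
Definition ker_rho k := proj1_sig (cid (ker_rho_ex k)).
Lemma ker_rhoE k : iC (ker_rho k) = rho (i k).
Proof. by rewrite /ker_rho; case: cid. Qed.

Lemma ker_is_comod : @is_comod A C (sub_rmod K) ker_rho.
Proof.
have idP : @bilinear_map A A C C id by split.
have [cl _] := comultP (coringP C).
have rP := rho_linear (comodP M).
have iP : @rlinear A (sub_rmod K ⊗r C) (M ⊗r C) iC by exact: tmap_rlinear.
have kP : @rlinear A (sub_rmod K) (sub_rmod K ⊗r C) ker_rho.
  split=> [x y|x a]; apply: iCI.
    by rewrite (proj1 iP) !ker_rhoE rhomD rhoD.
  by rewrite [RHS](proj2 iP) !ker_rhoE rhomM (proj2 rP).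
have idC : @llinear A (C ⊗l C) (C ⊗l C) (tmap (@id C) (@id C)) by exact: tmap_llinear.
split=> // [k|k].
- apply: (can_inj (@tassoc_invK _ _ _ _ _)).
  have I2 : injective (tmap (iC : sub_rmod K ⊗r C -> M ⊗r C) (@id C)).
    apply: (@flat_coring_inj _ _ (RHom iP)) => //; exact: tens_runital.
  apply: I2; apply: (can_inj (@tassocK _ _ _ _ _)).
  rewrite !tassoc_nat // !tassoc_invK -tassoc_nat // !tmap_comp //.
  rewrite (eq_tmap (f' := (@rho A C M : M -> M ⊗r C) \o i) (g' := @id C \o @id C)) //; last first.
    by move=> x; exact: ker_rhoE.
  rewrite -[in LHS]tmap_comp // [tmap i _ (ker_rho k)]ker_rhoE (rho_coassoc (comodP M)) -ker_rhoE.
  rewrite /iC tmap_comp //.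
  by apply: eq_tmap => // c /=; rewrite tmap_id.
- apply: (@sub_incl_inj _ _ K).
  by rewrite -[LHS](@tcounit_nat A C _ _ i) // [tmap _ _ _]ker_rhoE tcounit_rho.
Qed.
Definition ker_comod : comod C := Comod ker_is_comod.
Lemma ker_incl_colinear : @colinear A C ker_comod M i.
Proof. by move=> k; rewrite /= -ker_rhoE. Qed.
Definition ker_chom : chom ker_comod M := CHom ker_incl_colinear.
End Kernel.

(** The module kernel is a comodule when [C] is flat, so its inclusion can be compared with the zero
    map inside the category of comodules. *)
Lemma monic_chom_inj (M N : comod C) (f : chom M N) :
  @monomorphism (ComodCat C) M N f -> injective f.
Proof.
move=> fm; apply: additive_inj => [|x fx]; first exact: rhomD.
have e : ker_chom f = chom_zero (ker_comod f) M.
  apply: fm; apply: (@chom_eq A C (ker_comod f) N) => k /=.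
  by rewrite rhom0; apply: (sub_inclP k).
exact: (congr1 (fun h : chom (ker_comod f) M => h (sub_elt (K := rker f) fx)) e).
Qed.
End FlatCoring.

(** * The directed set of idempotents *)

Section Idempotents.
Variable R : rng.

Record idem_elt := IdemElt { idem_val :> R; idemP : idem_val ⋆ idem_val == idem_val }.
HB.instance Definition _ := [isSub for idem_val].
HB.instance Definition _ := [Choice of idem_elt by <:].

(** That is, [e] lies in [f R f]. This order indexes all three colimits. *)
Definition idem_le (e f : idem_elt) : bool := (f ⋆ e == e :> R) && (e ⋆ f == e :> R).

Lemma idem_le_refl : reflexive idem_le.
Proof. by move=> e; rewrite /idem_le (eqP (idemP e)) eqxx. Qed.
Lemma idem_le_anti : antisymmetric idem_le.
Proof.
move=> e f /andP[/andP[/eqP fe _] /andP[_ /eqP fe']].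
by apply: val_inj; rewrite /= -[LHS]fe fe'.
Qed.
Lemma idem_le_trans : transitive idem_le.
Proof.
move=> f e g /andP[/eqP fe /eqP ef] /andP[/eqP gf /eqP fg].
apply/andP; split; apply/eqP; first by rewrite -[in LHS]fe rmulA gf.
by rewrite -[in LHS]ef -rmulA fg.
Qed.
HB.instance Definition _ := Order.Le_isPOrder.Build (Order.Disp tt tt) idem_elt
  idem_le_refl idem_le_anti idem_le_trans.

Lemma idem_leP (e f : idem_elt) : (e <= f)%O -> f ⋆ e = e /\ e ⋆ f = e.
Proof. by case/andP=> /eqP -> /eqP ->. Qed.

Lemma idemE (e : idem_elt) : e ⋆ e = e.
Proof. exact/eqP/idemP. Qed.

Lemma idempotents_directed : has_idempotent_local_units R -> directed idem_elt.
Proof.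
move=> hR; split.
  by have [e ee _] := local_unit1 hR 0; split; apply: (@IdemElt e); apply/eqP.
move=> e f; have [g gg [ge eg gf fg]] := local_unit2 hR e f.
have gi : g ⋆ g == g by apply/eqP.
by exists (IdemElt gi); apply/andP; rewrite /= ?ge ?eg ?gf ?fg !eqxx.
Qed.

Lemma idem_above (hR : has_idempotent_local_units R) (e f : R) : exists g : idem_elt,
  [/\ g ⋆ e = e, e ⋆ g = e, g ⋆ f = f & f ⋆ g = f].
Proof.
have [g gg h] := local_unit2 hR e f.
have gi : g ⋆ g == g by apply/eqP.
by exists (IdemElt gi).
Qed.
End Idempotents.

(** * Split direct systems *)

Section SplitSystem.
Variables (A : pzRingType) (C : coring A) (R : rng).
Hypothesis hR : has_idempotent_local_units R.
Variables (S : bicomod R C) (P : idem_elt R -> comod C).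
Hypothesis Pfgp : forall z, finitely_generated (P z) /\ Defs.projective (P z).
Variables (i : forall z, chom (P z) S) (p : forall z, chom S (P z)).
Hypothesis pi : forall z x, p z (i z x) = x.
Hypothesis ip : forall z (u : S), i z (p z u) = (z : R) *> u.
Implicit Types z w : idem_elt R.

Lemma lact_sect z x : (z : R) *> (i z x : S) = i z x.
Proof. by rewrite -ip pi. Qed.
Lemma lact_sect_le z w x : (z <= w)%O -> (w : R) *> (i z x : S) = i z x.
Proof. by move=> /idem_leP[wz _]; rewrite -[in LHS]lact_sect lactA wz lact_sect. Qed.
Lemma retr_lact z (u : S) : p z ((z : R) *> u) = p z u.
Proof. by rewrite -ip pi. Qed.
Lemma retr_lact_le z w (u : S) : (z <= w)%O -> p z ((w : R) *> u) = p z u.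
Proof. by move=> /idem_leP[_ zw]; rewrite -[LHS]retr_lact lactA zw retr_lact. Qed.

Lemma system_unit (u : S) : exists z, (z : R) *> u = u.
Proof.
have [e ee eu] := proj1 (lfirmP hR S) (bc_firm (bicomodP S)) u.
have ei : e ⋆ e == e by apply/eqP.
by exists (IdemElt ei).
Qed.

Lemma system_unit2 (u v : S) : exists z, (z : R) *> u = u /\ (z : R) *> v = v.
Proof.
have [e eu] := system_unit u; have [f fv] := system_unit v.
have [g [ge _ gf _]] := idem_above hR e f.
by exists g; rewrite -{1}eu -{1}fv !lactA ge gf.
Qed.

Definition system_obj z : FgpComodCat C := @FullObj (ComodCat C) _ (P z) (Pfgp z).

(** [i w] after [p w] is multiplication by [w], which fixes the image of [i z] when [z <= w]. *)
Lemma system_retrK z w (zw : (z <= w)%O) :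
  chom_comp (chom_comp (p z) (i w)) (chom_comp (p w) (i z)) = chom_id (P z).
Proof. by apply: chom_eq => x /=; rewrite ip lact_sect_le // pi. Qed.

Definition system_hom z w (zw : (z <= w)%O) :
  @hom (split_category (FgpComodCat C)) (system_obj z) (system_obj w) :=
  @SplitHom (FgpComodCat C) (system_obj z) (system_obj w)
    (chom_comp (p w) (i z)) (chom_comp (p z) (i w)) (system_retrK zw).

Definition system : functor (poset_category (idem_elt R)) (split_category (FgpComodCat C)).
Proof.
refine (@Functor (poset_category (idem_elt R)) (split_category (FgpComodCat C))
  system_obj (fun z w zw => system_hom zw) _ _).
- by move=> z; apply: split_hom_eq; apply: (@chom_eq A C (P z) (P z)) => x /=; rewrite pi.
- move=> z w v wv zw; apply: split_hom_eq.
    by apply: (@chom_eq A C (P z) (P v)) => x /=; rewrite ip lact_sect_le.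
  by apply: (@chom_eq A C (P v) (P z)) => x /=; rewrite ip retr_lact_le.
Defined.

(** Firmness makes [S] the union of the summands [z S ≅ P z]. A cocone is glued by computing at any
    [z] that fixes the given element. *)
Lemma system_colim : @is_colim _ (ComodCat C) (fun_comp (split_underlying C) system) (bc_comod S).
Proof.
exists (fun z => i z : @hom (ComodCat C) (P z) (bc_comod S)) => [z w zw|X x xE].
  by apply: (@chom_eq A C (P z) S) => y /=; rewrite ip lact_sect_le.
have xE' z w (zw : (z <= w)%O) y : (x w : chom (P w) X) (p w (i z y)) = (x z : chom (P z) X) y.
  exact: (congr1 (fun h : chom (P z) X => h y) (xE z w zw)).
have [h hE] : exists h : S -> X, forall z (u : S), (z : R) *> u = u ->
    h u = (x z : chom (P z) X) (p z u).
  apply: glue; first exact: system_unit.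
  have aux z w (u : S) : (z <= w)%O -> (z : R) *> u = u ->
      (x z : chom (P z) X) (p z u) = (x w : chom (P w) X) (p w u).
    by move=> zw zu; rewrite -(xE' z w zw) ip zu.
  move=> z w u zu wu; have [g [gz zg gw wg]] := idem_above hR z w.
  rewrite (aux z g) ?(aux w g) //; apply/andP; rewrite ?gz ?zg ?gw ?wg !eqxx //.
(* The components of [rho u] need not be fixed by [z], so colinearity of [h] requires this formula,
   valid on all of [S]. *)
have hact z (u : S) : h ((z : R) *> u) = (x z : chom (P z) X) (p z u).
  by rewrite (hE z) ?retr_lact // lactA idemE.
have hP : rlinear h.
  split=> [u v|u a].
    have [z [zu zv]] := system_unit2 u v.
    by rewrite !(hE z) ?lactDl ?zu ?zv // !rhomD.
  have [z zu] := system_unit u.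
  by rewrite !(hE z) ?[LHS]bm_actC ?zu // !rhomM //; rewrite [LHS]bm_actC [bm_lact _ _]zu.
have hC : @colinear A C S X (RHom hP).
  move=> u; have [z zu] := system_unit u.
  have := bc_rho (bicomodP S) z u; rewrite [bc_act _ _]zu => ->.
  rewrite [LHS](congr1 (@rho A C X) (hE z u zu)) (chP (x z : chom (P z) X)) (chP (p z)).
  rewrite -[in RHS]/(tmap h (@id C) _) !tmap_comp //; last exact: (lact_rlinear S z).
  apply: eq_tmap => // v /=; symmetry; exact: hact.
exists (CHom hC); split.
  move=> z; apply: (@chom_eq A C (P z) X) => y /=.
  by rewrite (hE z) ?lact_sect // pi.
move=> h' h'E; apply: (@chom_eq A C S X) => u /=.
have [z zu] := system_unit u.
rewrite (hE z) // -[in RHS]zu -ip.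
by have /(congr1 (fun k : chom (P z) X => k (p z u))) := h'E z => /= <-.
Qed.

Section Dual.
Let D := dagger S hR.

Lemma dual_leg_ex z (f : dual (P z)) : exists x : D, functional x =1 (fun u => f (p z u)).
Proof.
exists (dagger_elt hR (rhom_comp f (p z)) z) => u.
by rewrite dagger_eltE /= retr_lact.
Qed.
Definition dual_leg_fun z (f : dual (P z)) : D := proj1_sig (cid (dual_leg_ex f)).
Lemma dual_legE z (f : dual (P z)) u : functional (dual_leg_fun f) u = f (p z u).
Proof. by rewrite /dual_leg_fun; case: cid => x /= ->. Qed.
Lemma dual_leg_linear z : @llinear A (dual (P z)) D (@dual_leg_fun z).
Proof.
split=> [f g|a f]; apply: functional_inj => u.
  by rewrite functionalD !dual_legE.
by rewrite functional_lact !dual_legE.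
Qed.
Definition dual_leg z : lhom (dual (P z)) D := LHom (@dual_leg_linear z).

Definition dual_restr z (x : D) : dual (P z) := rhom_comp (functional x) (i z).

Lemma dagger_unit2 (x y : D) : exists z, x <* (z : R) = x /\ y <* (z : R) = y.
Proof.
have [e _ xe] := dagger_unit x; have [f _ yf] := dagger_unit y.
have [g [_ eg _ fg]] := idem_above hR e f.
by exists g; rewrite -{1}xe -{1}yf !ractA eg fg.
Qed.

(** [S^* R] is the union of the [S^* z], identified with [P z ^*] by composing with [p z] and [i z].
    The proof [U] is arbitrary, to match the one carried by the bicomodule. *)
Lemma system_dual_colim (U : @lunital A D) :
  @is_colim _ (LModCat A) (fun_comp (split_dual C) system) (@ULmod A D U).
Proof.
exists (fun z => dual_leg z : @hom (LModCat A) (udual (P z)) (@ULmod A D U)) => [z w zw|X x xE].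
  apply: (@lhom_eq A (dual (P z)) D) => f; apply: functional_inj => u.
  rewrite [LHS]dual_legE [RHS]dual_legE /=.
  by rewrite ip retr_lact_le.
pose xf z : dual (P z) -> X := (x z : lhom (dual (P z)) X).
have xfD z f g : xf z (f + g) = xf z f + xf z g. exact: (proj1 (lhP (x z : lhom (dual (P z)) X))).
have xfZ z (a : A) f : xf z (@lact A (dual (P z)) a f) = @lact A X a (xf z f).
  exact: (proj2 (lhP (x z : lhom (dual (P z)) X))).
have xE' z w (zw : (z <= w)%O) f :
    xf w (rhom_comp f (chom_comp (p z) (i w))) = xf z f.
  exact: (congr1 (fun h : lhom (dual (P z)) X => h f) (xE z w zw)).
have [h hE] : exists h : D -> X, forall z (y : D), y <* (z : R) = y -> h y = xf z (dual_restr z y).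
  apply: glue => [y|].
    by have [z [yz _]] := dagger_unit2 y y; exists z.
  have aux z w (y : D) : (z <= w)%O -> y <* (z : R) = y ->
      xf z (dual_restr z y) = xf w (dual_restr w y).
    move=> zw yz; rewrite -(xE' z w zw); congr (xf w _); apply: rhom_eq => v.
    by rewrite /= ip -[in RHS]yz.
  move=> z w y yz yw; have [g [gz zg gw wg]] := idem_above hR z w.
  by rewrite (aux z g) ?(aux w g) //; apply/andP; rewrite ?gz ?zg ?gw ?wg !eqxx.
have hP : @llinear A D X h.
  split=> [y y'|a y].
    have [z [yz yz']] := dagger_unit2 y y'.
    rewrite !(hE z) ?ractDl ?yz ?yz' // -xfD; congr (xf z _); exact: rhom_eq.
  have [z [yz _]] := dagger_unit2 y y.
  rewrite (hE z); last by rewrite -[LHS](@bm_actC A R D) yz.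
  by rewrite (hE z) // -xfZ; congr (xf z _); exact: rhom_eq.
exists (LHom hP : @hom (LModCat A) (@ULmod A D U) X); split.
  move=> z; apply: (@lhom_eq A (dual (P z)) X) => f /=.
  rewrite (hE z); last by apply: functional_inj => u; rewrite functional_ract !dual_legE retr_lact.
  by congr (xf z _); apply: rhom_eq => v /=; rewrite dual_legE pi.
move=> h' h'E; apply: (@lhom_eq A D X) => y /=.
have [z [yz _]] := dagger_unit2 y y.
rewrite (hE z) // /xf -(h'E z) /=; congr ((h' : lhom D X) _); apply: functional_inj => u.
by rewrite dual_legE /= ip -[in RHS]yz.
Qed.
End Dual.

Hypothesis Sfaithful : forall r s : R, (forall u : S, r *> u = s *> u) -> r = s.
Hypothesis Sfull : forall (h : chom S S) z, 
  (forall u : S, h ((z : R) *> u) = h u) -> exists r : R, forall u : S, h u = r *> u.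

Section End.
Local Notation End z := (End_rng (P z)).

(** Extended to [S] through the splitting, [t] is a colinear endomorphism fixed by [z], hence
    multiplication by an element of [R]. This identifies [End^C(P z)] with [z R z]. *)
Lemma end_leg_ex z (t : End z) :
  exists r : R, forall u : S, r *> u = i z ((t : chom (P z) (P z)) (p z u)).
Proof.
have [u|r rE] := Sfull (h := chom_comp (i z) (chom_comp t (p z))) (z := z).
- by rewrite /= retr_lact.
- by exists r => u; rewrite -rE.
Qed.
Definition end_leg_fun z (t : End z) : R := proj1_sig (cid (end_leg_ex t)).
Lemma end_legE z (t : End z) (u : S) : end_leg_fun t *> u = i z ((t : chom (P z) (P z)) (p z u)).
Proof. by rewrite /end_leg_fun; case: cid. Qed.

Lemma end_legD z : {morph @end_leg_fun z : s t / s + t}.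
Proof. by move=> s t; apply: Sfaithful => u; rewrite lactDr !end_legE -rhomD. Qed.
Lemma end_legM z : {morph @end_leg_fun z : s t / s ⋆ t}.
Proof. by move=> s t; apply: Sfaithful => u; rewrite -lactA !end_legE pi. Qed.
Definition end_leg z : rng_hom (End z) R := RngHom (@end_legD z) (@end_legM z).

Lemma lact_colinear (r : R) : @colinear A C S S (RHom (lact_rlinear S r)).
Proof. move=> u; exact: (bc_rho (bicomodP S) r u). Qed.
Definition lact_chom r : chom S S := CHom (lact_colinear r).
Definition end_restr z (r : R) : End z := chom_comp (p z) (chom_comp (lact_chom r) (i z)).

Lemma end_restrK z (r : R) : (z : R) ⋆ r = r -> r ⋆ z = r -> end_leg_fun (end_restr z r) = r.
Proof.
move=> zr rz; apply: Sfaithful => u.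
by rewrite end_legE [LHS]ip -[LHS]/((z : R) *> (r *> (i z (p z u) : S))) ip !lactA zr rz.
Qed.

Lemma system_end_colim : @is_colim _ RngCat (fun_comp (split_end C) system) R.
Proof.
exists (fun z => end_leg z : @hom RngCat (End z) R) => [z w zw|X x xE].
  apply: rng_hom_eq => t; apply: Sfaithful => u.
  rewrite [LHS]end_legE [RHS]end_legE /=.
  by rewrite !ip lact_sect_le // retr_lact_le.
have xE' z w (zw : (z <= w)%O) (t : End z) :
    (x w : rng_hom (End w) X)
      (chom_comp (chom_comp (p w) (i z)) (chom_comp t (chom_comp (p z) (i w))))
    = (x z : rng_hom (End z) X) t.
  exact: (congr1 (fun h : rng_hom (End z) X => h t) (xE z w zw)).
(* [D z r] says that [r] lies in [z R z]; [R] is the directed union of these corners. *)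
pose D z (r : R) := (z : R) ⋆ r = r /\ r ⋆ z = r.
have Dex2 r s : exists z, D z r /\ D z s.
  have [e _ [er re]] := local_unit1 hR r; have [f _ [fs sf]] := local_unit1 hR s.
  have [g [ge eg gf fg]] := idem_above hR e f.
  exists g; split; split.
  - by rewrite -er rmulA ge.
  - by rewrite -re -rmulA eg.
  - by rewrite -fs rmulA gf.
  - by rewrite -sf -rmulA fg.
pose xf z (t : End z) : X := (x z : rng_hom (End z) X) t.
have [h hE] : exists h : R -> X, forall z (r : R), D z r -> h r = xf z (end_restr z r).
  apply: glue => [r|]; first by have [z [zr _]] := Dex2 r r; exists z.
  have aux z w r : (z <= w)%O -> D z r -> xf z (end_restr z r) = xf w (end_restr w r).
    move=> zw [zr rz]; rewrite -[LHS](xE' z w zw); congr (xf w _).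
    apply: (@chom_eq A C (P w) (P w)) => v /=; congr (p w _); rewrite ip.
    rewrite -[LHS]/((z : R) *> (r *> (i z (p z (i w v)) : S))) ip !lactA zr rz.
    by [].
  move=> z w r zr wr; have [g [gz zg gw wg]] := idem_above hR z w.
  by rewrite (aux z g) ?(aux w g) //; apply/andP; rewrite ?gz ?zg ?gw ?wg !eqxx.
have DD z r s : D z r -> D z s -> D z (r + s).
  by move=> [zr rz] [zs sz]; rewrite /D rmulDr rmulDl zr rz zs sz.
have DM z r s : D z r -> D z s -> D z (r ⋆ s).
  by move=> [zr rz] [zs sz]; rewrite /D rmulA zr -rmulA sz.
have hD : {morph h : r s / r + s}.
  move=> r s; have [z [zr zs]] := Dex2 r s.
  rewrite !(hE z) //; last exact: DD.
  rewrite -[RHS]rng_homD; congr (xf z _); apply: (@chom_eq A C (P z) (P z)) => v /=.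
  by rewrite -rhomD; congr (p z _); apply: (@lactDr R S).
have hM : {morph h : r s / r ⋆ s}.
  move=> r s; have [z [zr zs]] := Dex2 r s.
  rewrite !(hE z) //; last exact: DM.
  rewrite -[RHS]rng_homM; congr (xf z _); apply: (@chom_eq A C (P z) (P z)) => v /=.
  congr (p z _); rewrite ip -[LHS]/((r ⋆ s) *> (i z v : S)).
  rewrite -[RHS]/(r *> ((z : R) *> (s *> (i z v : S)))) !lactA.
  by case: zr => _ ->.
exists (RngHom hD hM : @hom RngCat R X); split.
  move=> z; apply: (@rng_hom_eq (End z) X) => t /=.
  rewrite (hE z); last first.
    split; apply: Sfaithful => u; rewrite -lactA !end_legE ?lact_sect //.
    by rewrite retr_lact.
  congr (xf z _); apply: (@chom_eq A C (P z) (P z)) => v /=.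
  by rewrite -[X in p z X]/(end_leg_fun t *> (i z v : S)) end_legE !pi.
move=> h' h'E; apply: (@rng_hom_eq R X) => r /=.
have [z [[zr rz] _]] := Dex2 r r.
rewrite (hE z) // /xf -(h'E z) /=; congr ((h' : rng_hom R X) _).
by rewrite end_restrK.
Qed.
End End.
End SplitSystem.

(** * Functors that are equivalences *)

Section Product.
Variables (R : rng) (M N : rmod R).

Definition prod_ract (p : (M * N)%type) (r : R) : (M * N)%type := (p.1 <* r, p.2 <* r).
Lemma prod_ractP : @right_action R (M * N)%type prod_ract.
Proof.
split=> [r [x y] [x' y']|[x y] r s|[x y] r s]; congr (_, _) => /=;
  by rewrite ?ractDl ?ractDr ?ractA.
Qed.
Definition prod_rmod : rmod R := Rmod prod_ractP.

Lemma prod_inl_linear : @rlinear R M prod_rmod (fun x => (x, 0)).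
Proof. by split=> [x y|x r]; congr (_, _); rewrite /= ?addr0 ?ract0. Qed.
Lemma prod_inr_linear : @rlinear R N prod_rmod (fun y => (0, y)).
Proof. by split=> [x y|x r]; congr (_, _); rewrite /= ?addr0 ?ract0. Qed.
Lemma prod_fst_linear : @rlinear R prod_rmod M fst. Proof. by []. Qed.
Lemma prod_snd_linear : @rlinear R prod_rmod N snd. Proof. by []. Qed.

Lemma prod_firm : has_idempotent_local_units R -> rfirm M -> rfirm N -> rfirm prod_rmod.
Proof.
move=> hR /(rfirmP _ hR) hM /(rfirmP _ hR) hN; apply/(rfirmP _ hR) => -[x y].
have [e ee ex] := hM x; have [f ff fy] := hN y.
have [g gg [_ eg _ fg]] := local_unit2 hR e f; exists g => //.
by congr (_, _) => /=; [rewrite -ex ractA eg | rewrite -fy ractA fg].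
Qed.
End Product.

(** An element of [M] as a map out of [R]; without a unit in [R], the element is recovered by
    evaluating at an idempotent that fixes it. *)
Definition hat (R : rng) (M : rmod R) (m : M) (r : reg R) : M := m <* r.
Lemma hat_linear (R : rng) (M : rmod R) (m : M) : rlinear (hat m).
Proof. by split=> [x y|x r]; rewrite /hat ?ractDr ?ractA. Qed.
Definition hat_rhom (R : rng) (M : rmod R) (m : M) : rhom (reg R) M := RHom (hat_linear m).

Lemma rmul0 (R : rng) (x : R) : x ⋆ 0 = 0.
Proof. exact: (morph0 (rmulDr x)). Qed.
Lemma rmulBr (R : rng) (x y z : R) : x ⋆ (y - z) = x ⋆ y - x ⋆ z.
Proof. exact: (morphB _ _ (rmulDr x)). Qed.

Section Corner.
Variables (R : rng) (e : R).

Lemma fixedB (x y : R) : e ⋆ x = x -> e ⋆ y = y -> e ⋆ (x - y) = x - y.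
Proof. by rewrite rmulBr => -> ->. Qed.
Lemma fixedM (x r : R) : e ⋆ x = x -> e ⋆ (x ⋆ r) = x ⋆ r.
Proof. by rewrite rmulA => ->. Qed.
Definition fixed_submod : submod (reg R) :=
  @Submod R (reg R) (fun x => e ⋆ x = x) (rmul0 e) fixedB fixedM.
(** For an idempotent [e] this is the right ideal [e R], split off from [R] by [corner_proj]. *)
Definition corner : rmod R := sub_rmod fixed_submod.
Definition corner_incl : rhom corner (reg R) := sub_incl fixed_submod.
End Corner.

Lemma corner_proj_ex (R : rng) (e : R) : e ⋆ e = e ->
  exists g : rhom (reg R) (corner e), forall x, corner_incl e (g x) = e ⋆ x.
Proof.
move=> ee; apply: (@sub_corestr _ _ (fixed_submod e) _ (lmul_rhom e)).
by move=> x /=; rewrite rmulA ee.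
Qed.
Definition corner_proj (R : rng) (e : R) (ee : e ⋆ e = e) : rhom (reg R) (corner e) :=
  proj1_sig (cid (corner_proj_ex ee)).
Lemma corner_projE (R : rng) (e : R) (ee : e ⋆ e = e) x :
  corner_incl e (corner_proj ee x) = e ⋆ x.
Proof. by rewrite /corner_proj; case: cid. Qed.

Lemma chom_bij_iso (A : pzRingType) (C : coring A) (M N : comod C) (f : chom M N) :
  bijective f -> @is_iso (ComodCat C) M N f.
Proof.
case=> g fg gf.
have gP : rlinear g.
  split=> [x y|x r]; last by rewrite -{1}(gf x) -rhomM fg.
  by rewrite -{1}(gf x) -{1}(gf y) -rhomD fg.
have gC : @colinear A C N M (RHom gP).
  move=> x; rewrite /= -{2}(gf x) (chP f) tmap_comp //.
  by rewrite (eq_tmap (f' := id) (g' := id)) // tmap_id.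
by exists (CHom gC); apply: chom_eq.
Qed.

Lemma rhom_bij_iso (R : rng) (M N : frmod R) (f : rhom M N) :
  bijective f -> @is_iso (FirmModCat R) M N f.
Proof.
case=> g fg gf.
have gP : rlinear g.
  split=> [x y|x r]; last by rewrite -{1}(gf x) -rhomM fg.
  by rewrite -{1}(gf x) -{1}(gf y) -rhomD fg.
by exists (RHom gP); apply: rhom_eq.
Qed.

Section Functors.
Variables (A : pzRingType) (C : coring A) (R : rng).
Hypothesis hR : has_idempotent_local_units R.
Variables (F : functor (FirmModCat R) (ComodCat C)) (G : functor (ComodCat C) (FirmModCat R)).

Definition Fmap (X Y : frmod R) (f : rhom X Y) : chom (F X) (F Y) := @fmap _ _ F X Y f.
Definition Gmap (M N : comod C) (f : chom M N) : rhom (G M : frmod R) (G N : frmod R) :=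
  @fmap _ _ G M N f.

Lemma Fmap_comp (X Y Z : frmod R) (g : rhom Y Z) (f : rhom X Y) u :
  Fmap (rhom_comp g f) u = Fmap g (Fmap f u).
Proof. by have := @fmapM _ _ F X Y Z g f; rewrite /Fmap => ->. Qed.
Lemma Fmap_id (X : frmod R) u : Fmap (rhom_id X) u = u.
Proof. by have := @fmap1 _ _ F X; rewrite /Fmap => ->. Qed.
Lemma Fmap_eq (X Y : frmod R) (f g : rhom X Y) : f =1 g -> Fmap f = Fmap g.
Proof. by move=> /rhom_eq ->. Qed.

Lemma Fmap_ext (X Y : frmod R) (f g : rhom X Y) u : f =1 g -> Fmap f u = Fmap g u.
Proof. by move/Fmap_eq->. Qed.

Hypothesis FG : inverse_equivalences F G.

Lemma Fmap_inj (X Y : frmod R) (f g : rhom X Y) : Fmap f =1 Fmap g -> f =1 g.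
Proof. by move/chom_eq => e; have := @equiv_faithful _ _ _ _ FG X Y f g e => ->. Qed.
Lemma Fmap_full (X Y : frmod R) (h : chom (F X) (F Y)) : exists f : rhom X Y, Fmap f = h.
Proof. exact: (equiv_full FG h). Qed.

(** By fullness the zero endomorphism of [F X] is some [F z], and [0 ∘ z = 0]. *)
Lemma Fmap0 (X Y : frmod R) u : Fmap (rhom_zero X Y) u = 0.
Proof.
have [z zE] := Fmap_full (chom_zero (F X) (F X)).
transitivity (Fmap (rhom_zero X Y) (chom_zero (F X) (F X) u)); last exact: rhom0.
by rewrite -zE -Fmap_comp; apply: Fmap_ext.
Qed.

(* F preserves the biproduct decomposition of Y × Y by fullness and faithfulness, *)
(* and the sum of two maps is computed through it.                                *)
Lemma Fmap_add (X Y : frmod R) (f g : rhom X Y) u :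
  Fmap (rhom_add f g) u = Fmap f u + Fmap g u.
Proof.
pose B : frmod R := FRmod (prod_firm hR (fr_firm Y) (fr_firm Y)).
pose i1 : rhom Y B := RHom (prod_inl_linear Y Y).
pose i2 : rhom Y B := RHom (prod_inr_linear Y Y).
pose p1 : rhom B Y := RHom (prod_fst_linear Y Y).
pose p2 : rhom B Y := RHom (prod_snd_linear Y Y).
pose psi := chom_add (chom_comp (Fmap i1) (Fmap p1)) (chom_comp (Fmap i2) (Fmap p2)).
have [chi chiE] := Fmap_full psi.
have psiE v : psi v = Fmap i1 (Fmap p1 v) + Fmap i2 (Fmap p2 v) by [].
have h1 : p1 \o chi =1 p1.
  apply: (@Fmap_inj B Y (rhom_comp p1 chi) p1) => v.
  rewrite Fmap_comp chiE psiE rhomD -!Fmap_comp.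
  rewrite (@Fmap_ext B Y (rhom_comp (rhom_comp p1 i1) p1) p1) //.
  by rewrite (@Fmap_ext B Y (rhom_comp (rhom_comp p1 i2) p2) (rhom_zero B Y)) // Fmap0 addr0.
have h2 : p2 \o chi =1 p2.
  apply: (@Fmap_inj B Y (rhom_comp p2 chi) p2) => v.
  rewrite Fmap_comp chiE psiE rhomD -!Fmap_comp addrC.
  rewrite (@Fmap_ext B Y (rhom_comp (rhom_comp p2 i2) p2) p2) //.
  by rewrite (@Fmap_ext B Y (rhom_comp (rhom_comp p2 i1) p1) (rhom_zero B Y)) // Fmap0 addr0.
have psi1 v : psi v = v.
  rewrite -chiE (@Fmap_ext B B _ (rhom_id B)) ?Fmap_id // => -[x y].
  by have := h1 (x, y); have := h2 (x, y) => /=; case: (chi _) => a b /= -> ->.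
pose dP : rhom X B := rhom_add (rhom_comp i1 f) (rhom_comp i2 g).
pose nab : rhom B Y := rhom_add p1 p2.
rewrite (@Fmap_ext X Y _ (rhom_comp nab dP)); last first.
  by move=> x /=; rewrite addr0 add0r.
rewrite Fmap_comp -[Fmap dP u]psi1 psiE rhomD -!Fmap_comp.
congr (_ + _).
  by apply: Fmap_ext => x /=; rewrite !addr0.
by apply: Fmap_ext => x /=; rewrite !add0r.
Qed.

Let Rg : frmod R := reg_frmod hR.
Let S0 : comod C := reg_image hR F.

Lemma reg_image_actE r (u : S0) : reg_image_act r u = Fmap (X := Rg) (Y := Rg) (lmul_rhom r) u.
Proof. by []. Qed.

Lemma reg_image_actM r s (u : S0) :
  reg_image_act r (reg_image_act s u) = reg_image_act (r ⋆ s) u.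
Proof.
rewrite !reg_image_actE -Fmap_comp.
by apply: Fmap_ext => x /=; rewrite rmulA.
Qed.
Lemma reg_image_actDl r (u v : S0) :
  reg_image_act r (u + v) = reg_image_act r u + reg_image_act r v.
Proof. exact: rhomD. Qed.
Lemma reg_image_actDr r s (u : S0) :
  reg_image_act (r + s) u = reg_image_act r u + reg_image_act s u.
Proof.
rewrite !reg_image_actE -Fmap_add.
by apply: Fmap_ext => x /=; rewrite rmulDl.
Qed.

Lemma reg_image_left_action : left_action (@reg_image_act A C R hR F).
Proof.
split=> [r u v|u r s|u r s].
- exact: reg_image_actDl.
- exact: reg_image_actDr.
- exact: reg_image_actM.
Qed.

Definition corner_frmod (e : R) : frmod R := FRmod (rfirm_sub hR (fixed_submod e) (reg_firm hR)).

Lemma idempotents_jointly_epi :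
  @jointly_epi (FirmModCat R) {e : R | e ⋆ e = e} (fun=> Rg) Rg
    (fun e => lmul_rhom (proj1_sig e)).
Proof.
move=> Z g h e; apply: (@rhom_eq R Rg Z) => r.
have [f ff [fr _]] := local_unit1 hR r.
have := congr1 (fun k : rhom Rg Z => k r) (e (exist _ f ff)).
by rewrite /= fr.
Qed.

(* The quotient of F(R) by the union of the e F(R) is a comodule, and it vanishes *)
(* since the left multiplications by the idempotents e are jointly epic on R.      *)
Lemma reg_image_unit (u : S0) : exists2 e : R, e ⋆ e = e & reg_image_act e u = u.
Proof.
pose P (u : S0) := exists2 e : R, e ⋆ e = e & reg_image_act e u = u.
have P0 : P 0 by have [e ee _] := local_unit1 hR 0; exists e => //; exact: rhom0.
have PB (v w : S0) : P v -> P w -> P (v - w).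
  move=> [e ee ev] [f ff fw]; have [g gg [ge _ gf _]] := local_unit2 hR e f.
  exists g => //; rewrite [LHS]rhomB -[in RHS]ev -[in RHS]fw.
  by rewrite -[Fmap _ v]/(reg_image_act g v) -{1}ev -{1}fw; congr (_ - _);
    rewrite [LHS]reg_image_actM ?ge ?gf.
have PM (v : S0) (a : A) : P v -> P (v <* (a : rng_of_pzRing A)).
  by move=> [e ee ev]; exists e => //; rewrite [LHS]rhomM [X in X <* _]ev.
pose K : submod S0 := @Submod A S0 P P0 PB PM.
have KP v : K v -> tmap (quot_proj K) (@id C) (rho v) = 0.
  case=> e ee ev.
  rewrite -ev [rho _](chP (Fmap (X := Rg) (Y := Rg) (lmul_rhom e))) tmap_comp //.
  rewrite /tmap /tlift big1 // => p _ /=.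
  rewrite -[X in X ⊠ _]/(quot_proj K (reg_image_act e p.1)).
  rewrite (proj2 (quot_proj_eq0 K _)) ?pure0l //; exists e => //.
  by rewrite reg_image_actM ee.
have q0 : quot_chom KP = chom_zero S0 (quot_comod KP).
  apply: (equiv_jointly_epi FG idempotents_jointly_epi) => -[e ee].
  apply: (@chom_eq A C S0 (quot_comod KP)) => v /=.
  apply/quot_proj_eq0; exists e => //.
  by rewrite [LHS]reg_image_actM ee.
have : quot_chom KP u = 0 by rewrite q0.
by move/quot_proj_eq0.
Qed.

Lemma reg_image_bicomod : is_bicomod (@reg_image_act A C R hR F).
Proof.
exists reg_image_left_action.
- by apply/lfirmP => // u; apply: reg_image_unit.
- by move=> r u a; apply: rhomM.
- move=> r u; exact: (chP (Fmap (X := Rg) (Y := Rg) (lmul_rhom r))).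
Qed.
End Functors.

(** * The image of the regular module *)

Section Watts.
Variables (A : pzRingType) (C : coring A) (R : rng).
Hypothesis hR : has_idempotent_local_units R.
Variables (F : functor (FirmModCat R) (ComodCat C)) (G : functor (ComodCat C) (FirmModCat R)).
Hypothesis FG : inverse_equivalences F G.
Let GF : inverse_equivalences G F := conj (proj2 FG) (proj1 FG).

Variable c : forall N : comod C, chom (F (G N)) N.
Hypothesis c_nat : forall (N P : comod C) (f : chom N P) u, c P (Fmap F (Gmap G f) u) = f (c N u).
Variable d : forall N : comod C, chom N (F (G N)).
Hypothesis cK : forall N, cancel (@c N) (@d N).
Hypothesis dK : forall N, cancel (@d N) (@c N).

Let Rg : frmod R := reg_frmod hR.
Let hS := reg_image_bicomod hR FG.
Let S : bicomod R C := Bicomod hS.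
Local Notation FmapF := (Fmap F).

Lemma Fmap_lmul (r : R) (u : S) : FmapF (X := Rg) (Y := Rg) (lmul_rhom r) u = r *> u.
Proof. by []. Qed.

Definition Fhat (M : frmod R) (m : M) : chom S (F M) := FmapF (X := Rg) (hat_rhom m).

Lemma FhatD (M : frmod R) (m n : M) (u : S) : Fhat (m + n) u = Fhat m u + Fhat n u.
Proof. by rewrite -(Fmap_add hR FG); apply: Fmap_ext => r; rewrite /= /hat ractDl. Qed.
Lemma Fhat_ract (M : frmod R) (m : M) r (u : S) : Fhat (m <* r) u = Fhat m (r *> u).
Proof.
rewrite -Fmap_lmul -Fmap_comp; apply: Fmap_ext => s.
by rewrite /= /hat ractA.
Qed.
Lemma Fhat_map (M N : frmod R) (f : rhom M N) (m : M) (u : S) : FmapF f (Fhat m u) = Fhat (f m) u.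
Proof. by rewrite -Fmap_comp; apply: Fmap_ext => s; rewrite /= /hat rhomM. Qed.

Section Phi.
Variable M : frmod R.

(** The Eilenberg-Watts comparison map. *)
Definition watts (t : (M : rmod R) ⊗ S) : F M := tlift (fun (m : M) (u : S) => Fhat m u) t.

Lemma watts_balanced : @balanced R M S (F M) (fun (m : M) (u : S) => Fhat m u).
Proof.
split=> [u m n|m u v|m r u]; first exact: FhatD.
- exact: rhomD.
- exact: Fhat_ract.
Qed.
Lemma wattsE (m : M) (u : S) : watts (m ⊠ u) = Fhat m u.
Proof. exact: tliftE watts_balanced _ _. Qed.
Lemma wattsD : {morph watts : x y / x + y}.
Proof. exact: tliftD watts_balanced. Qed.

Lemma watts_linear : @rlinear A ((M : rmod R) ⊗r S) (F M) watts.
Proof.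
split=> [|t a]; first exact: wattsD.
elim/tens_ind: t => [|s t hs ht|m u].
- by rewrite ract0 (morph0 wattsD) ract0.
- by rewrite ractDl !wattsD hs ht ractDl.
- by rewrite tens_ractE !wattsE rhomM.
Qed.

Lemma watts_colinear : @colinear A C (tens_comod S M) (F M) (RHom watts_linear).
Proof.
move=> t /=; have wD := tmapD watts_linear (@llinear_id _ C).
elim/tens_ind: t => [|s t hs ht|m u].
- by rewrite (morph0 wattsD) (morph0 (@rhoD _ C _)) (morph0 (@tens_rhoD _ _ _ _ _)) (morph0 wD).
- by rewrite wattsD rhoD hs ht (@tens_rhoD R A C S M s t) wD.
- rewrite wattsE (chP (Fhat m)) tens_rhoE tmap_comp //;
    try exact: pure_map_linear; last exact: watts_linear.
  by apply: eq_tmap => // v /=; rewrite wattsE.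
Qed.
Definition watts_chom : chom (tens_comod S M) (F M) := CHom watts_colinear.

Lemma hat_jointly_epi :
  @jointly_epi (FirmModCat R) M (fun=> Rg) M (fun m : M => hat_rhom m).
Proof.
move=> Z g h e; apply: (@rhom_eq R M Z) => m.
have [f ff mf] := proj1 (rfirmP _ hR) (fr_firm M) m.
have := congr1 (fun k : rhom Rg Z => k f) (e m).
by rewrite /= /hat mf.
Qed.

(* The comodule maps u |-> m ⊠ u come from maps R -> G (M ⊗ S), which glue to a map *)
(* M -> G (M ⊗ S) whose adjunct is inverse to [watts].                             *)
Lemma watts_bij : bijective watts.
Proof.
pose N : comod C := tens_comod S M.
have k_ex (m : M) : exists k : rhom Rg (G N : frmod R),
    forall u : S, c N (FmapF k u) = (m ⊠ u : N).
  have [k kE] := Fmap_full FG (X := Rg) (Y := G N) (chom_comp (d N) (pure_chom S m)).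
  by exists k => u; rewrite kE /= dK.
pose k m := proj1_sig (cid (k_ex m)).
have kE m (u : S) : c N (FmapF (k m) u) = (m ⊠ u : N) by rewrite /k; case: cid.
have k_eq m (h : rhom Rg (G N : frmod R)) :
    (forall u : S, c N (FmapF h u) = (m ⊠ u : N)) -> k m =1 h.
  move=> hE; apply: (Fmap_inj FG) => u.
  by apply: (can_inj (@cK N)); rewrite kE hE.
have kD m n : k (m + n) =1 rhom_add (k m) (k n).
  by apply: k_eq => u; rewrite (Fmap_add hR FG) rhomD !kE pureDl.
have kM m r x : k (m <* r) x = k m (r ⋆ x).
  apply: (@k_eq _ (rhom_comp (k m) (lmul_rhom r))) => u.
  by rewrite (@Fmap_comp _ _ _ _ Rg Rg) kE Fmap_lmul pure_bal.
(* Evaluation of [k m] at the missing unit is replaced by evaluation at any idempotent fixing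
   [m]. *)
have [K KE] : exists K : M -> G N, forall e m, e ⋆ e = e /\ m <* e = m -> K m = k m e.
  apply: (@glue M (G N : frmod R) R (fun e m => e ⋆ e = e /\ m <* e = m)
    (fun e m => k m e)) => [m|].
    by have [e ee me] := proj1 (rfirmP _ hR) (fr_firm M) m; exists e.
  have aux e g m : m <* e = m -> e ⋆ g = e -> k m g = k m e.
    by move=> me eg; rewrite -{1}me kM eg.
  move=> e f m [ee me] [ff mf].
  have [g gg [_ eg _ fg]] := local_unit2 hR e f.
  by rewrite -(aux e g) // -(aux f g).
have KP : rlinear K.
  split=> [m n|m r].
    have [e ee me] := proj1 (rfirmP _ hR) (fr_firm M) m.
    have [f ff nf] := proj1 (rfirmP _ hR) (fr_firm M) n.
    have [g gg [_ eg _ fg]] := local_unit2 hR e f.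
    have mg : m <* g = m by rewrite -me ractA eg.
    have ng : n <* g = n by rewrite -nf ractA fg.
    by rewrite !(KE g) ?ractDl ?mg ?ng // kD.
  have [e ee me] := proj1 (rfirmP _ hR) (fr_firm M) m.
  have [g gg [_ eg gr rg]] := local_unit2 hR e r.
  have mg : m <* g = m by rewrite -me ractA eg.
  rewrite (KE g (m <* r)); last by rewrite ractA rg.
  by rewrite (KE g m) // kM rg -[RHS]rhomM /= gr.
pose KK : rhom M (G N : frmod R) := RHom KP.
have psiE m (u : S) : c N (FmapF KK (Fhat m u)) = (m ⊠ u : N).
  rewrite Fhat_map -kE; congr (c N _); apply: Fmap_ext => r.
  have [e ee [er re]] := local_unit1 hR r.
  rewrite /= /hat -[LHS](rhomM KK) /= (KE e) ?ractA ?re //.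
  by rewrite kM re.
exists (fun x => c N (FmapF KK x)) => [t|].
  elim/tens_ind: t => [|s t hs ht|m u].
  - by rewrite (morph0 wattsD) !rhom0.
  - by rewrite wattsD !rhomD hs ht.
  - by rewrite wattsE psiE.
suff E : chom_comp watts_chom (chom_comp (c N) (FmapF KK)) = chom_id (F M : comod C).
  by move=> x; apply: (congr1 (fun h : chom (F M) (F M) => h x) E).
apply: (equiv_jointly_epi FG hat_jointly_epi) => m.
apply: (@chom_eq A C S (F M)) => u.
by have := psiE m u => /= ->; rewrite wattsE.
Qed.
End Phi.

(** The adjunct of [y : R -> G N]. It identifies [G N] with the colinear maps [S -> N] fixed by an
    idempotent. *)
Definition Theta (N : comod C) (y : G N : frmod R) : chom S N :=
  chom_comp (c N) (Fhat y).

Section ThetaTheory.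
Variable N : comod C.
Implicit Types y : (G N : frmod R).

Lemma ThetaD y z u : Theta (y + z) u = Theta y u + Theta z u.
Proof. by rewrite /Theta /= FhatD rhomD. Qed.
Lemma Theta_ract y r u : Theta (y <* r) u = Theta y (r *> u).
Proof. by rewrite /Theta /= Fhat_ract. Qed.
Lemma Theta_watts y u : c N (watts (y ⊠ u)) = Theta y u.
Proof. by rewrite wattsE. Qed.
Lemma Theta_inj y z : Theta y =1 Theta z -> y = z.
Proof.
move=> e; have E : hat_rhom y =1 hat_rhom z.
  by apply: (@Fmap_inj _ _ _ _ _ FG Rg) => u; apply: (can_inj (@cK N)); apply: e.
have [e0 _ y0] := proj1 (rfirmP _ hR) (fr_firm (G N)) y.
have [f0 _ z0] := proj1 (rfirmP _ hR) (fr_firm (G N)) z.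
have [g _ [_ eg _ fg]] := local_unit2 hR e0 f0.
by have := E g; rewrite /= /hat -{1}y0 -{1}z0 !ractA eg fg y0 z0.
Qed.
(** The adjunct [k : R -> G N] of [g] satisfies [k (e r) = k r], so it is given by the element
    [k e]. *)
Lemma Theta_surj (g : chom S N) (e : R) : e ⋆ e = e ->
  (forall u : S, g (e *> u) = g u) -> exists y, Theta y =1 g.
Proof.
move=> ee ge.
have [k kE] := Fmap_full FG (X := Rg) (Y := G N) (chom_comp (d N) g).
have ke (r : R) : k (e ⋆ r) = k r.
  apply: (@Fmap_inj _ _ _ _ _ FG Rg _ (rhom_comp k (lmul_rhom e)) k) => u.
  by rewrite (@Fmap_comp _ _ _ _ Rg Rg) Fmap_lmul kE /= ge.
exists (k e) => u.
transitivity (c N (FmapF k u)); last by rewrite kE /= dK.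
congr (c N _); apply: Fmap_ext => r.
by rewrite /= /hat -rhomM ke.
Qed.
End ThetaTheory.

Lemma Theta_nat (N P : comod C) (h : chom N P) (y : G N : frmod R) u :
  Theta (Gmap G h y) u = h (Theta y u).
Proof. by rewrite /Theta /= -Fhat_map c_nat. Qed.

Lemma pure_chom_jointly_epi (N : rmod A) :
  @jointly_epi (ComodCat C) N (fun=> reg_comod C) (cofree C N)
    (fun n : N => pure_chom (reg_bicomod C) n).
Proof.
move=> Z g h e; apply: (@chom_eq A C (cofree C N) Z).
apply: tens_ext => [x y|x y|n x]; [exact: rhomD|exact: rhomD|].
exact: (congr1 (fun k : chom (reg_comod C) Z => k x) (e n)).
Qed.

Lemma counit_linear : @rlinear A C (reg A) (@counit A C).
Proof. exact: (proj2 (counitP (coringP C))). Qed.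

(* The maps x |-> n ⊠ x from C to N ⊗ C are jointly epic, so G(N ⊗ C), which is       *)
(* Hom_A(S, N) R, is the sum of their images n Hom_A(S, A) R.                          *)
Lemma dual_basis (N : rmod A) (f : rhom S N) (e : R) : e ⋆ e = e ->
  (forall u : S, f (e *> u) = f u) ->
  exists s : seq (N * rhom S (reg A)), forall u, f u = \sum_(p <- s) p.1 <* (p.2 u : A).
Proof.
move=> ee fe; pose X := cofree C N.
have [y yE] : exists y, Theta y =1 cofree_lift f.
  apply: (Theta_surj ee) => u /=.
  have := bc_rho hS e u; rewrite [rho _]/= => -> .
  rewrite tmap_comp //; last exact: (lact_rlinear S e).
  by apply: eq_tmap => // v /=; apply: fe.
pose D : frmod R := G (reg_comod C).
pose P (y : G X : frmod R) :=
  exists s : seq (N * D),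
    y = \sum_(p <- s) Gmap G (pure_chom (reg_bicomod C) p.1 : chom (reg_comod C) X) p.2.
have P0 : P 0 by exists [::]; rewrite big_nil.
have PB x z : P x -> P z -> P (x - z).
  move=> [s ->] [t ->]; exists (s ++ [seq (p.1, - p.2) | p <- t]).
  rewrite big_cat big_map /= -sumrN; congr (_ + _); apply: eq_bigr => p _.
  by rewrite (morphN _ (@rhomD _ _ _ _)).
have PM x r : P x -> P (x <* r).
  case=> s ->; exists [seq (p.1, p.2 <* r) | p <- s].
  rewrite big_map (morph_sumr _ _ (f := fun x => x <* r)) => [|v w]; last exact: ractDl.
  by apply: eq_bigr => p _; rewrite rhomM.
pose K : submod (G X : frmod R) := @Submod R (G X : frmod R) P P0 PB PM.
pose Q : frmod R := FRmod (rfirm_quot hR K (fr_firm (G X))).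
(* [G] keeps the maps [n ⊠ -] jointly epic, so the quotient of [G X] by the sum of their images is
   zero. *)
have q0 : (quot_proj K : rhom (G X : frmod R) Q) = rhom_zero _ _.
  apply: (equiv_jointly_epi GF (@pure_chom_jointly_epi N)) => n.
  apply: (@rhom_eq R D Q) => z /=.
  apply/quot_proj_eq0; exists [:: (n, z)]; by rewrite big_seq1.
have [s ys] : K y.
  by apply/quot_proj_eq0; rewrite -[quot_proj K]/(quot_proj K : rhom (G X : frmod R) Q) q0.
(* Each [Theta p.2] is a comodule map [S -> C]; its counit is the wanted functional. *)
exists [seq (p.1, @rhom_comp A S (reg_comod C) (reg A) (RHom counit_linear) (Theta p.2))
  | p : N * D <- s] => u.
rewrite -(cofree_liftK f) -yE ys big_map.
rewrite (morph_sumr _ _ (f := fun y => Theta y u)) => [|v w]; last exact: ThetaD.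
rewrite (morph_sumr _ _ (@cofree_counitD A C N)); apply: eq_bigr => p _.
by rewrite Theta_nat /= cofree_counitE.
Qed.

Section Corner.
Variables (e : R) (ee : e ⋆ e = e).
Let E := corner_frmod hR e.

Definition corner_sect : chom (F E) S := FmapF (X := E) (Y := Rg) (corner_incl e).
Definition corner_retr : chom S (F E) := FmapF (X := Rg) (Y := E) (corner_proj ee).

Lemma corner_sectK x : corner_retr (corner_sect x) = x.
Proof.
rewrite -Fmap_comp (@Fmap_ext _ _ _ _ E E _ (rhom_id E)) ?Fmap_id // => y.
apply: sub_incl_inj; rewrite [LHS]corner_projE; exact: (sub_inclP y).
Qed.
Lemma corner_retrK (u : S) : corner_sect (corner_retr u) = e *> u.
Proof.
rewrite -Fmap_lmul -[LHS]Fmap_comp; apply: (@Fmap_ext _ _ _ _ Rg Rg) => y.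
exact: (corner_projE ee y).
Qed.

(** A dual basis for multiplication by [e] on [S], moved along the splitting, is a finite dual basis
    of [F (e R)]; it gives generators and lifts at once. *)
Lemma corner_fgp : finitely_generated (F E : comod C) /\ Defs.projective (F E : comod C).
Proof.
pose i := corner_sect; pose p := corner_retr.
have pi_id x : p (i x) = x by exact: corner_sectK.
have ei x : i x = e *> i x by rewrite -corner_retrK -/p pi_id.
have [s sE] : exists s : seq (S * rhom S (reg A)),
    forall u, e *> u = \sum_(p <- s) p.1 <* (p.2 u : A).
  apply: (@dual_basis S (RHom (lact_rlinear S e)) e ee) => u /=.
  by rewrite [LHS]lactA ee.
have basis x : x = \sum_(q <- s) p q.1 <* (q.2 (i x) : A).
  rewrite -{1}(pi_id x) [in LHS]ei sE rhom_sum; apply: eq_bigr => q _.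
  by rewrite rhomM.
split.
  exists (size s), (fun j => p (tnth (in_tuple s) j).1) => x.
  exists (fun j => (tnth (in_tuple s) j).2 (i x)).
  by rewrite {1}(basis x) (big_tnth _ _ s).
move=> X Y q f _ _ qs.
pose lift (y : Y) := proj1_sig (cid (qs y)).
have liftE y : q (lift y) = y by rewrite /lift; case: cid.
have gP : @rlinear A (F E : comod C) X (fun x => \sum_(r <- s) lift (f (p r.1)) <* (r.2 (i x) : A)).
  split=> [x y|x a].
    rewrite -big_split; apply: eq_bigr => r _ /=.
    by rewrite !rhomD ractDr.
  rewrite (morph_sumr _ _ (f := fun y : X => y <* (a : rng_of_pzRing A))) => [|v w];
    last exact: ractDl.
  by apply: eq_bigr => r _; rewrite !rhomM ractA.
exists (RHom gP) => x /=; rewrite {2}(basis x) !rhom_sum; apply: eq_bigr => r _.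
by rewrite !rhomM liftE.
Qed.
End Corner.
End Watts.

(** * From an equivalence to the comatrix coring *)

Section Forward.
Variables (A : pzRingType) (C : coring A) (R : rng).
Hypothesis hR : has_idempotent_local_units R.
Variables (F : functor (FirmModCat R) (ComodCat C)) (G : functor (ComodCat C) (FirmModCat R)).
Hypothesis FG : inverse_equivalences F G.

Variable c : forall N : comod C, chom (F (G N)) N.
Hypothesis c_nat : forall (N P : comod C) (f : chom N P) u, c P (Fmap F (Gmap G f) u) = f (c N u).
Variable d : forall N : comod C, chom N (F (G N)).
Hypothesis cK : forall N, cancel (@c N) (@d N).
Hypothesis dK : forall N, cancel (@d N) (@c N).

Let Rg : frmod R := reg_frmod hR.
Let hS := reg_image_bicomod hR FG.
Let S : bicomod R C := Bicomod hS.
Local Notation FmapF := (Fmap F).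
Local Notation Th := (Theta hR FG c).

Let D := dagger S hR.
Local Notation evt N := (@ev R A S D (@pairing A C R S hR) N).
Let epsP := @pairing_bilinear A C R S hR.

(** Apply [dual_basis] to multiplication by [r], with [r e = r]; precomposing its functionals with
    [e] puts them in [S^* R]. *)
Lemma reg_image_basis (r : R) : exists t : S ⊗ D, forall u : S, evt S t u = r *> u.
Proof.
have [e ee [_ re]] := local_unit1 hR r.
have [|s sE] := @dual_basis _ _ _ hR _ _ FG _ c_nat _ dK S (RHom (lact_rlinear S r)) e ee.
  by move=> u; rewrite /= [LHS]lactA re.
exists (\sum_(p <- s) p.1 ⊠ dagger_elt hR p.2 e) => u.
rewrite (morph_sumr _ _ (evD epsP u)).
transitivity ((r ⋆ e) *> u); last by rewrite re.
rewrite -lactA -[RHS]/((RHom (lact_rlinear S r) : rhom S S) (e *> u)) sE.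
by apply: eq_bigr => p _; rewrite evE // pairingE.
Qed.
Let basis := reg_image_basis.
Local Notation evI := (ev_inj epsP (copairing_unitSd basis) hR (dagger_firm S hR)).

Lemma lact_inj (r s : R) : (forall u : S, r *> u = s *> u) -> r = s.
Proof.
move=> e; have E : lmul_rhom r =1 lmul_rhom s by apply: (@Fmap_inj _ _ _ _ _ FG Rg Rg); exact: e.
have [g _ [_ rg _ sg]] := local_unit2 hR r s.
by have := E g; rewrite /= rg sg.
Qed.

Lemma lact_full (h : chom S S) (e : R) : (forall u : S, h (e *> u) = h u) ->
  exists r : R, forall u : S, h u = r *> u.
Proof.
move=> he; have [k kE] := Fmap_full FG (X := Rg) (Y := Rg) h.
have ke x : k (e ⋆ x) = k x.
  apply: (@Fmap_inj _ _ _ _ _ FG Rg Rg (rhom_comp k (lmul_rhom e)) k) => u.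
  by rewrite (@Fmap_comp _ _ _ _ Rg Rg) kE; apply: he.
exists (k e : R) => u; rewrite -[in LHS]kE; apply: (@Fmap_ext _ _ _ _ Rg Rg) => x.
by rewrite -ke rhomM.
Qed.

Section DaggerG.
Let CN : comod C := reg_comod C.

Lemma theta_dual_ex (y : G CN : frmod R) : exists x : D, functional x =1 (fun u => counit (Th y u)).
Proof.
have [e ee ye] := proj1 (rfirmP _ hR) (fr_firm (G CN)) y.
exists (dagger_elt hR (@rhom_comp A S CN (reg A) (RHom (counit_linear C)) (Th y)) e) => u.
by rewrite -[in RHS]ye Theta_ract.
Qed.
(** The comparison [G C -> S^* R], from [Hom^C(S, C) ≅ S^*]. *)
Definition theta_dual y : D := proj1_sig (cid (theta_dual_ex y)).
Lemma theta_dualE y u : functional (theta_dual y) u = counit (Th y u).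
Proof. by rewrite /theta_dual; case: cid => x /= ->. Qed.

Lemma theta_dual_coact y : dual_coact (functional (theta_dual y)) =1 Th y.
Proof. by apply: dual_coact_counit => u; apply: theta_dualE. Qed.

Lemma theta_dual_linear : @rlinear R (G CN : frmod R) D theta_dual.
Proof.
have [[eD _] _] := counitP (coringP C).
split=> [x y|x r]; apply: functional_inj => u.
  by rewrite functionalD !theta_dualE (@ThetaD _ _ _ _ _ _ FG c CN) eD.
by rewrite functional_ract !theta_dualE Theta_ract.
Qed.

Lemma theta_dual_surj (x : D) : exists y, theta_dual y = x.
Proof.
pose g : chom S CN := @CHom A C S CN (RHom (dual_coact_rlinear (functional x)))
   (comult_dual_coact (functional x)).
have [e ee xe] := dagger_unit x.
have [|y yE] := @Theta_surj _ _ _ hR F G FG c d dK CN g e ee.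
  move=> u; rewrite -[LHS](dual_coact_act (S := S)).
  rewrite -[RHS]/(dual_coact (functional x) u) -[in RHS]xe.
  by congr (dual_coact _ u); apply: rhom_eq.
exists y; apply: functional_inj => u.
by rewrite theta_dualE yE counit_dual_coact.
Qed.

(** Along the surjection [theta_dual], the canonical map becomes [watts] followed by the counit
    [F (G C) -> C], and both of these are bijective. *)
Lemma reg_image_can_bij : bijective (@dagger_can A C R S hR).
Proof.
have tD := tmapD theta_dual_linear (@llinear_id _ S).
have E (t : (G CN : frmod R) ⊗ S) :
    dagger_can (tmap theta_dual (@id S) t : D ⊗ S) = c CN (watts t).
  elim/tens_ind: t => [|s t hs ht|y u].
  - rewrite (morph0 tD) (morph0 (@dagger_canD _ _ _ _ _)).
    by rewrite (morph0 (@wattsD _ _ _ _ _ _ _ _)) rhom0.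
  - by rewrite tD dagger_canD hs ht wattsD rhomD.
  - rewrite tmapE //; last exact: theta_dual_linear.
    by rewrite dagger_canE theta_dual_coact Theta_watts.
have wB := watts_bij hR FG cK dK (G CN : frmod R).
apply: inj_surj_bij => [|x].
  apply: additive_inj => [|t]; first exact: dagger_canD.
  have [s <-] := tmap_surj (f := RHom theta_dual_linear) theta_dual_surj t.
  rewrite [X in X = _ -> _]E => e; suff -> : s = 0 by rewrite [LHS](morph0 tD).
  apply: (bij_inj wB); apply: (can_inj (@cK CN)).
  by rewrite e (morph0 (@wattsD _ _ _ _ _ _ _ _)) rhom0.
have [w _ wK] := wB.
by exists (tmap theta_dual (@id S) (w (d CN x))); rewrite E wK dK.
Qed.
End DaggerG.

Lemma watts_nat (X Y : frmod R) (f : rhom X Y) (t : (X : rmod R) ⊗ S) :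
  watts (tmap f (@id S) t : (Y : rmod R) ⊗ S) = FmapF f (watts t).
Proof.
have fD := tmapD (rhP f) (@llinear_id _ S).
elim/tens_ind: t => [|s t hs ht|x u].
- by rewrite (morph0 fD) !(morph0 (@wattsD _ _ _ _ _ _ _ _)) rhom0.
- by rewrite fD !wattsD rhomD hs ht.
- by rewrite tmapE // !wattsE Fhat_map.
Qed.

Lemma watts_iso : nat_iso F (tens_functor S).
Proof.
apply: nat_iso_sym; exists (fun M : FirmModCat R => watts_chom hR FG M) => [X Y f|X].
  apply: (@chom_eq A C (tens_comod S (X : frmod R)) (F Y)) => t.
  exact: watts_nat.
exact: (@chom_bij_iso A C (tens_comod S (X : frmod R)) (F X)
  (watts_chom hR FG X) (watts_bij hR FG cK dK X)).
Qed.

(** An injection of firm modules is monic, [F] keeps it monic, and over a flat coring monic means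
    injective. Faithfulness is that of [F]. *)
Lemma reg_image_faithfully_flat : left_flat C -> faithfully_flat S.
Proof.
move=> Cflat; split.
  apply: (flat_firm hR (bc_firm hS)) => X Y f hX hY fI.
  pose X' : frmod R := FRmod hX; pose Y' : frmod R := FRmod hY.
  have fm : @monomorphism (FirmModCat R) X' Y' f.
    move=> Z g h e; apply: (@rhom_eq R (Z : frmod R) X') => z; apply: fI.
    exact: (congr1 (fun k : rhom (Z : frmod R) Y' => k z) e).
  have FI := monic_chom_inj Cflat (equiv_monic FG fm).
  move=> s t e; apply: (bij_inj (watts_bij hR FG cK dK X')); apply: FI.
  by rewrite -[LHS](@watts_nat X' Y' f) -[RHS](@watts_nat X' Y' f) e.
move=> X Y f g hX hY e.
pose X' : frmod R := FRmod hX; pose Y' : frmod R := FRmod hY.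
apply: (@Fmap_inj _ _ _ _ _ FG X' Y') => x.
have [w _ wK] := watts_bij hR FG cK dK X'.
by rewrite -(wK x) -!watts_nat e.
Qed.

(** If [y e = y], then [Th y] factors through multiplication by [e] and is represented by its image
    of [copairing e]; colinearity is the cotensor condition. *)
Lemma theta_cotensor_ex (N : comod C) (y : G N : frmod R) :
  exists x : cotensor_rmod (dagger_lbicomod basis) N, evt N (ct_val x) =1 Th y.
Proof.
have [e ee ye] := proj1 (rfirmP _ hR) (fr_firm (G N)) y.
have E : evt N (tmap (Th y) (@id D) (copairing basis e)) =1 Th y.
  by move=> u; rewrite (ev_tmap epsP) // copairingE -Theta_ract ye.
have P : @in_cotensor A C R (dagger_lbicomod basis) N (tmap (Th y) (@id D) (copairing basis e)).
  apply/in_cotensorP => u; rewrite E (chP (Th y)).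
  by apply: eq_tmap => // v; rewrite E.
by exists (Cotensor P).
Qed.

Lemma cotensor_iso : nat_iso G (cotensor_functor (dagger_lbicomod basis) hR).
Proof.
pose L := dagger_lbicomod basis.
pose k (N : comod C) (y : G N : frmod R) : cotensor_rmod L N :=
  proj1_sig (cid (theta_cotensor_ex y)).
have kE (N : comod C) (y : G N : frmod R) : evt N (ct_val (k N y)) =1 Th y by rewrite /k; case: cid.
have ct_inj (N : comod C) (x y : cotensor_rmod L N) : evt N (ct_val x) =1 evt N (ct_val y) -> x = y.
  by move=> e; apply: cotensor_eq; apply: evI.
have kP (N : comod C) : @rlinear R (G N : frmod R) (cotensor_rmod L N) (k N).
  split=> [x y|x r]; apply: ct_inj => u.
    by rewrite [RHS](evD epsP) !kE (@ThetaD _ _ _ _ _ _ FG c N).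
  by rewrite [RHS](ev_ract epsP) !kE Theta_ract.
exists (fun N : ComodCat C => RHom (kP N)) => [N P f|N].
  apply: (@rhom_eq R (G N : frmod R) (cotensor_rmod L P)) => y.
  apply: ct_inj => u; rewrite [LHS]kE [LHS](Theta_nat c_nat).
  by rewrite [RHS](ev_tmap epsP) // [X in _ = _ X]kE.
apply: (@rhom_bij_iso R (G N) (FRmod (@cotensor_firm A C R L N hR)) (RHom (kP N))).
apply: inj_surj_bij => [y z e|x].
  by apply: (Theta_inj (c := c) cK) => u; rewrite -!kE -[k N y]/(RHom (kP N) y) e.
have [e ee xe] := tens_firm_unit (ct_val x) hR (dagger_firm S hR).
pose g : chom S N := @CHom A C S N (ev_rhom epsP (ct_val x)) (proj1 (in_cotensorP basis _) (ctP x)).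
have [|y yE] := @Theta_surj _ _ _ hR F G FG c d dK N g e ee.
  by move=> u; rewrite -[LHS](ev_ract epsP) xe.
by exists y; apply: ct_inj => u; rewrite [LHS]kE yE.
Qed.
End Forward.

(** * From the comatrix coring to an equivalence *)

Lemma tmap_id_bij (R : rng) (M : rmod R) (N N' : lmod R) (g : N -> N') :
  llinear g -> bijective g -> bijective (tmap (@id M) g).
Proof.
move=> gP [g' gK g'K].
have g'P : llinear g'.
  by split=> [x y|r x]; apply: (can_inj gK); rewrite ?(proj1 gP) ?(proj2 gP) !g'K.
exists (tmap (@id M) g') => t; rewrite tmap_comp //.
  by rewrite (eq_tmap (f' := id) (g' := id)) // tmap_id.
by rewrite (eq_tmap (f' := id) (g' := id)) // tmap_id.
Qed.

Lemma tassoc_bij (R S : rng) (M : rmod R) (N : bimod R S) (P : lmod S) :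
  bijective (@tassoc R S M N P).
Proof. by exists (@tassoc_inv R S M N P); [exact: tassocK | exact: tassoc_invK]. Qed.

Lemma rmul_map_linear (R : rng) (M : rmod R) : @rlinear R (M ⊗r reg R) M (@rmul_map R M).
Proof.
split=> [|t r]; first exact: rmul_mapD.
elim/tens_ind: t => [|s t hs ht|m s].
- by rewrite ract0 (morph0 (@rmul_mapD _ _)) ract0.
- by rewrite ractDl !rmul_mapD hs ht ractDl.
- by rewrite tens_ractE !rmul_mapE ractA.
Qed.
Definition rmul_rhom (R : rng) (M : rmod R) : rhom (M ⊗r reg R) M := RHom (@rmul_map_linear R M).

(** [(M ⊗ R) ⊗ S ≅ M ⊗ (R ⊗ S) ≅ M ⊗ S]: the factor [R] of [hom_functor] disappears after tensoring
    with [S]. *)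
Lemma rmul_tens_bij (R : rng) (M : rmod R) (S : lmod R) : lfirm S ->
  bijective (tmap (@rmul_map R M : M ⊗r reg R -> M) (@id S)).
Proof.
move=> hS.
have lP : @llinear R (reg R ⊗l S) S (@lmul_map R S).
  split=> [|r t]; first exact: lmul_mapD.
  elim/tens_ind: t => [|s t hs ht|s m].
  - rewrite (morph0 (fun b c => @lactDl R (reg R ⊗l S) b c r)) (morph0 (@lmul_mapD _ _)).
    by rewrite (morph0 (fun b c => @lactDl R S b c r)).
  - by rewrite lactDl !lmul_mapD hs ht lactDl.
  - by rewrite tens_lactE !lmul_mapE lactA.
have lB := tmap_id_bij M lP hS.
apply: (eq_bij (bij_comp lB (tassoc_bij M (reg R) S))).
have mP := rmul_map_linear M.
apply: tens_ext => [s t|s t|x u].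
- by rewrite /= tassocD (tmapD _ lP).
- exact: tmapD.
elim/tens_ind: x => [|x y hx hy|m r].
- rewrite /= !pure0l (morph0 (@tassocD _ _ _ _ _)) (morph0 (tmapD (@rlinear_id _ M) lP)).
  by rewrite (morph0 (tmapD mP _)).
- rewrite !pureDl [RHS](tmapD mP (@llinear_id _ S)) -hx -hy /= tassocD.
  by rewrite (tmapD (@rlinear_id _ M) lP).
- by rewrite /= tassocE !tmapE // rmul_mapE lmul_mapE pure_bal.
Qed.

Section HomModule.
Variables (R A : rng) (S : bimod R A) (N : rmod A).

Definition homA_ract (f : rhom S N) (r : R) : rhom S N :=
  RHom (rlinear_comp (rhP f) (lact_rlinear S r)).
Lemma homA_ractP : right_action homA_ract.
Proof.
split=> [r f g|f r s|f r s]; apply: rhom_eq => m /=.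
- by [].
- by rewrite -rhomD; congr (f _); apply: (@lactDr R S).
- by congr (f _); apply: (@lactA R S).
Qed.
Definition homA_rmod : rmod R := Rmod homA_ractP.
End HomModule.

Section Converse.
Variables (A : pzRingType) (C : coring A) (R : rng) (S : bicomod R C).
Hypothesis hR : has_idempotent_local_units R.
Variables (Sd : bimod A R) (eta : R -> S ⊗ Sd) (eps : Sd ⊗ S -> A).
Hypothesis ctx : comatrix_context eta eps.
Let epsP := ctx_eps ctx.

Definition comatrix_can (t : Sd ⊗b S) : C := can (dagger_tens ctx t).

Lemma dagger_dual_linear : @rlinear R Sd (dual_bimod S) (dagger_dual ctx).
Proof.
split=> [x y|x r]; apply: rhom_eq => u /=; first by rewrite (pairDl epsP).
by rewrite pure_bal.
Qed.

Lemma comatrix_canE (x : Sd) (u : S) : comatrix_can (x ⊠ u) = dual_coact (dagger_dual ctx x) u.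
Proof. by rewrite /comatrix_can /dagger_tens tmapE ?canE //; exact: dagger_dual_linear. Qed.

Hypothesis can_bij : bijective comatrix_can.
Hypothesis can_bilinear : @bilinear_map A A (Sd ⊗b S) C comatrix_can.
Hypothesis Sff : faithfully_flat S.
Let Sflat := proj1 Sff.
Let canl : @llinear A (Sd ⊗l S) C comatrix_can := proj1 can_bilinear.

Lemma tens_flat_inj (X Y : rmod R) (f : rhom X Y) : injective f -> injective (tmap f (@id S)).
Proof. exact: (flat_inj Sflat). Qed.

(* C is isomorphic to Sd ⊗ S, where S is flat over R and Sd is flat over A because   *)
(* X ⊗ Sd embeds into Hom_A(S, X).                                                   *)
Lemma context_coring_flat : left_flat C.
Proof.
move=> X Y Z f g _ _ _ fg; apply: short_exact_tens => //.
have fI : injective f by case: fg.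
have fSI := dagger_flat epsP (ctx_unitSd ctx) hR (ctx_rfirmSd ctx) fI.
have fSP : @rlinear R (X ⊗r Sd) (Y ⊗r Sd) (tmap f (@id Sd)) by apply: tmap_rlinear => //; split.
have II := @tens_flat_inj _ _ (RHom fSP) fSI.
apply: additive_inj => [|t ft]; first exact: tmapD.
have [k _ kK] := tmap_id_bij X canl can_bij.
rewrite -(kK t) in ft *; move: {t kK}(k t) ft => t.
rewrite -(tassoc_invK t); move: (tassoc_inv t) => {}t.
have idSP : @bilinear_map A R Sd Sd id by split.
have idP : @llinear A (Sd ⊗l S) (Sd ⊗l S) (tmap (@id Sd) (@id S)) by exact: tmap_llinear.
have E : tmap f (@id C) (tmap (@id X) comatrix_can (tassoc t))
    = tmap (@id Y) comatrix_can
        (tassoc (tmap (tmap f (@id Sd) : X ⊗r Sd -> Y ⊗r Sd) (@id S) t)).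
  rewrite tassoc_nat // !tmap_comp //.
  by apply: eq_tmap => // s /=; rewrite tmap_id.
rewrite E => e; suff -> : t = 0.
  by rewrite (morph0 (@tassocD _ _ _ _ _)) (morph0 (tmapD _ canl)).
apply: II; rewrite [RHS](morph0 (tmapD fSP (@llinear_id _ S))).
apply: (can_inj (@tassocK _ _ _ _ _)); apply: (bij_inj (tmap_id_bij Y canl can_bij)).
by rewrite e (morph0 (@tassocD _ _ _ _ _)) (morph0 (tmapD _ canl)).
Qed.

Section HomCoact.
Variable N : rmod A.
Let H := homA_rmod S N.

Definition hom_coact (t : H ⊗ S) : N ⊗ C :=
  tlift (fun (g : H) (u : S) => tmap (g : rhom S N) (@id C) (rho u)) t.
Lemma hom_coact_balanced :
  @balanced R H S (N ⊗ C) (fun (g : H) (u : S) => tmap (g : rhom S N) (@id C) (rho u)).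
Proof.
split=> [u f g|g u v|g r u].
- by rewrite /tmap /tlift -big_split; apply: eq_bigr => p _ /=; rewrite pureDl.
- by rewrite rhoD tmapD.
- have := bc_rho (bicomodP S) r u => /= ->; rewrite tmap_comp //; exact: (lact_rlinear S r).
Qed.
Lemma hom_coactE (g : rhom S N) (u : S) : hom_coact ((g : H) ⊠ u) = tmap g (@id C) (rho u).
Proof. exact: tliftE hom_coact_balanced _ _. Qed.
Lemma hom_coactD : {morph hom_coact : s t / s + t}.
Proof. exact: tliftD hom_coact_balanced. Qed.

Let evH (t : N ⊗r Sd) : H := ev_rhom epsP t.
Lemma evH_linear : @rlinear R (N ⊗r Sd) H evH.
Proof.
split=> [s t|t r]; apply: rhom_eq => u /=; first by rewrite (evD epsP).
exact: (ev_ract epsP).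
Qed.

Lemma hom_coact_ev (t : (N ⊗r Sd) ⊗ S) :
  hom_coact (tmap evH (@id S) t) = tmap (@id N) comatrix_can (tassoc t).
Proof.
have eD := tmapD evH_linear (@llinear_id _ S); have kD := tmapD (@rlinear_id _ N) canl.
elim/tens_ind: t => [|s t hs ht|x u].
- by rewrite (morph0 eD) (morph0 hom_coactD) (morph0 (@tassocD _ _ _ _ _)) (morph0 kD).
- by rewrite eD hom_coactD hs ht tassocD kD.
elim/tens_ind: x => [|x y hx hy|n x].
- by rewrite pure0l (morph0 eD) (morph0 hom_coactD) (morph0 (@tassocD _ _ _ _ _)) (morph0 kD).
- by rewrite pureDl eD hom_coactD hx hy tassocD kD.
rewrite tassocE !tmapE //; last exact: evH_linear.
rewrite comatrix_canE hom_coactE /dual_coact.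
have gD := tmapD (ev_rlinear epsP (n ⊠ x : N ⊗ Sd)) (@llinear_id _ C).
elim/tens_ind: (rho u) => [|s t hs ht|v c].
- by rewrite (morph0 gD) (morph0 (sliceD _)) pure0r.
- by rewrite [LHS]gD sliceD pureDr -hs -ht.
- by rewrite tmapE // sliceE [X in X ⊠ _](evE epsP) pure_bal.
Qed.

(** [g ⊠ u = (g e) ⊠ u] when [e u = u], and [g e] is the evaluation of [(g ⊗ Sd) (eta e)]. *)
Lemma evH_tens_surj (t : H ⊗ S) : exists s, tmap evH (@id S) s = t.
Proof.
have eD := tmapD evH_linear (@llinear_id _ S).
elim/tens_ind: t => [|_ _ [s <-] [t <-]|g u].
- by exists 0; rewrite (morph0 eD).
- by exists (s + t); rewrite eD.
have [e ee eu] := proj1 (lfirmP hR S) (ctx_lfirmS ctx) u.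
exists ((tmap (g : rhom S N) (@id Sd) (eta e) : N ⊗r Sd) ⊠ u).
rewrite tmapE //; last exact: evH_linear.
rewrite -[in RHS]eu -pure_bal; congr (_ ⊠ _); apply: rhom_eq => v.
exact: (ev_eta epsP (ctx_unitS ctx)).
Qed.

(** The bijection [N ⊗ can] factors as the surjection [evH ⊗ S] followed by [hom_coact], so both
    factors are bijective. *)
Lemma hom_coact_bij : bijective hom_coact.
Proof.
have cB := bij_comp (tmap_id_bij N canl can_bij) (tassoc_bij N Sd S).
apply: inj_surj_bij => [|x].
  apply: additive_inj => [|t]; first exact: hom_coactD.
  have [s <-] := evH_tens_surj t; rewrite hom_coact_ev => e.
  suff -> : s = 0 by rewrite (morph0 (tmapD evH_linear (@llinear_id _ S))).
  apply: (bij_inj cB); rewrite /= e (morph0 (@tassocD _ _ _ _ _)).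
  by rewrite (morph0 (tmapD _ canl)).
have [k _ kK] := cB.
by exists (tmap evH (@id S) (k x)); rewrite hom_coact_ev [LHS]kK.
Qed.
End HomCoact.

Section Counit.
Variable N : comod C.
Let H := homA_rmod S N.
Let K := hom_rmod S N.

Lemma chom_incl_linear : @rlinear R K H (fun g : chom S N => g : rhom S N).
Proof. by split=> [f g|f r]; apply: rhom_eq. Qed.
Definition chom_incl : rhom K H := RHom chom_incl_linear.
Lemma chom_incl_inj : injective chom_incl.
Proof. by move=> f g e; apply: chom_eq => u; rewrite -[f u]/(chom_incl f u) e. Qed.

Definition hom_counit (t : K ⊗ S) : N := tlift (fun (g : K) (u : S) => (g : chom S N) u) t.
Lemma hom_counit_balanced : @balanced R K S N (fun (g : K) (u : S) => (g : chom S N) u).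
Proof. by split=> // g u v; apply: rhomD. Qed.
Lemma hom_counitE (g : chom S N) (u : S) : hom_counit ((g : K) ⊠ u) = g u.
Proof. exact: tliftE hom_counit_balanced _ _. Qed.
Lemma hom_counitD : {morph hom_counit : s t / s + t}.
Proof. exact: tliftD hom_counit_balanced. Qed.
Lemma hom_counit_linear : @rlinear A (K ⊗r S) N hom_counit.
Proof.
split=> [|t a]; first exact: hom_counitD.
elim/tens_ind: t => [|s t hs ht|g u].
- by rewrite ract0 (morph0 hom_counitD) ract0.
- by rewrite ractDl !hom_counitD hs ht ractDl.
- by rewrite tens_ractE !hom_counitE rhomM.
Qed.

Lemma hom_counit_colinear : @colinear A C (tens_comod S K) N (RHom hom_counit_linear).
Proof.
move=> t /=; have cD := tmapD hom_counit_linear (@llinear_id _ C).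
elim/tens_ind: t => [|s t hs ht|g u].
- rewrite (morph0 hom_counitD) (morph0 (@rhoD _ C _)) (morph0 (@tens_rhoD _ _ _ S K)).
  by rewrite (morph0 cD).
- by rewrite hom_counitD rhoD hs ht (@tens_rhoD R A C S K s t) cD.
- rewrite hom_counitE (chP (g : chom S N)) tens_rhoE tmap_comp //;
    try exact: pure_map_linear; last exact: hom_counit_linear.
  by apply: eq_tmap => // v /=; rewrite hom_counitE.
Qed.
Definition hom_counit_chom : chom (tens_comod S K) N := CHom hom_counit_colinear.

Lemma rho_hom_counit (t : K ⊗ S) :
  rho (hom_counit t) = hom_coact (tmap chom_incl (@id S) t).
Proof.
have jD := tmapD chom_incl_linear (@llinear_id _ S).
elim/tens_ind: t => [|s t hs ht|g u].
- rewrite (morph0 hom_counitD) (morph0 (@rhoD _ C _)) [X in hom_coact X](morph0 jD).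
  by rewrite (morph0 (@hom_coactD _)).
- by rewrite hom_counitD rhoD hs ht [X in _ = hom_coact X]jD hom_coactD.
- by rewrite hom_counitE tmapE // [RHS]hom_coactE (chP (g : chom S N)).
Qed.

Lemma hom_defect_linear (g : rhom S N) :
  @rlinear A S (N ⊗r C) (fun u : S => rho (g u) - tmap g (@id C) (rho u)).
Proof.
have rS := rho_linear (comodP S); have rN := rho_linear (comodP N).
have [gD gM] : @rlinear A (S ⊗r C) (N ⊗r C) (tmap g (@id C)).
  by apply: tmap_rlinear => //; split.
split=> [u v|u a].
  by rewrite rhomD (proj1 rS) (proj1 rN) gD opprD addrACA.
by rewrite rhomM (proj2 rS) (proj2 rN) gM ractDl ractN.
Qed.
Definition hom_defect_fun (g : H) : homA_rmod S (N ⊗r C) := RHom (hom_defect_linear g).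

Lemma hom_defect_rlinear : @rlinear R H (homA_rmod S (N ⊗r C)) hom_defect_fun.
Proof.
split=> [f g|g r]; apply: rhom_eq => u /=.
  rewrite rhoD addrACA -opprD; congr (_ - _).
  by rewrite /tmap /tlift -big_split; apply: eq_bigr => p _ /=; rewrite pureDl.
congr (_ - _).
have := bc_rho (bicomodP S) r u => /= ->; rewrite tmap_comp //; exact: (lact_rlinear S r).
Qed.
Definition hom_defect : rhom H (homA_rmod S (N ⊗r C)) := RHom hom_defect_rlinear.

(** Writing [rho u] as [u0 ⊗ u1], the subtracted terms agree because [g u0 ⊗ Δ u1] is
    [(g ⊗ C)(rho u0) ⊗ u1] by coassociativity of [S]. *)
Lemma hom_coact_defect (t : H ⊗ S) :
  hom_coact (tmap hom_defect (@id S) t)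
  = tmap (@rho A C N : N -> N ⊗r C) (@id C) (hom_coact t)
    - tassoc_inv (tmap (@id N) (@comult A C : C -> C ⊗l C) (hom_coact t)).
Proof.
have rN := rho_linear (comodP N); have [cl _] := comultP (coringP C).
have dD := tmapD hom_defect_rlinear (@llinear_id _ S).
have rD := tmapD rN (@llinear_id _ C); have cD := tmapD (@rlinear_id _ N) cl.
elim/tens_ind: t => [|s t hs ht|g u].
- rewrite [X in hom_coact X](morph0 dD) !(morph0 (@hom_coactD _)) (morph0 rD) (morph0 cD).
  by rewrite (morph0 (@tassoc_invD _ _ _ _ _)) subr0.
- rewrite [X in hom_coact X]dD !hom_coactD hs ht rD cD tassoc_invD opprD.
  by rewrite addrACA.
rewrite tmapE // !hom_coactE.
have gP : @rlinear A (S ⊗r C) (N ⊗r C) (tmap (g : rhom S N) (@id C)).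
  by apply: tmap_rlinear => //; split.
have idP : @bilinear_map A A C C id by split.
have idC : @llinear A (C ⊗l C) (C ⊗l C) (tmap (@id C) (@id C)) by exact: tmap_llinear.
have -> : tmap (@id N) (@comult A C : C -> C ⊗l C) (tmap (g : rhom S N) (@id C) (rho u))
   = tassoc (tmap (tmap (g : rhom S N) (@id C) : S ⊗r C -> N ⊗r C) (@id C)
       (tmap (@rho A C S : S -> S ⊗r C) (@id C) (rho u))).
  rewrite tassoc_nat // (rho_coassoc (comodP S)) !tmap_comp //.
  by apply: eq_tmap => // c' /=; rewrite tmap_id.
have rS := rho_linear (comodP S).
rewrite tassocK !tmap_comp //.
rewrite /tmap /tlift -sumrB; apply: eq_bigr => p _ /=.
by rewrite (morphB _ _ (pureDl _)).
Qed.

(* Hom^C(S, N) is the kernel of [hom_defect] on Hom_A(S, N). Tensored with the flat   *)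
(* module S, and with Hom_A(S, N) ⊗ S identified with N ⊗ C by [hom_coact], this     *)
(* kernel is that of ρ ⊗ C - N ⊗ Δ, which is N.                                       *)
Lemma hom_counit_bij : bijective hom_counit.
Proof.
apply: inj_surj_bij => [|n].
  apply: additive_inj => [|t t0]; first exact: hom_counitD.
  have jI := tens_flat_inj chom_incl_inj.
  apply: jI; apply: (bij_inj (@hom_coact_bij N)).
  rewrite -rho_hom_counit t0 (morph0 (@rhoD _ C _)).
  by rewrite [X in hom_coact X](morph0 (tmapD chom_incl_linear _)) // (morph0 (@hom_coactD _)).
have [k _ kK] := @hom_coact_bij N.
have e0 : tmap hom_defect (@id S) (k (rho n)) = 0.
  apply: (bij_inj (@hom_coact_bij (N ⊗r C))).
  rewrite hom_coact_defect kK -(rho_coassoc (comodP N)) tassocK subrr.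
  by rewrite (morph0 (@hom_coactD _)).
have [s sE] := flat_ker Sflat (fun _ _ _ => I) (fun _ _ _ => I) I I e0.
pose c0 (x : sub_rmod (rker hom_defect)) : rhom S N := sub_incl (rker hom_defect) x.
have cP x : @colinear A C S N (c0 x).
  move=> u; apply/eqP; rewrite -subr_eq0; apply/eqP.
  exact: (congr1 (fun h : rhom S (N ⊗r C) => h u) (sub_inclP x)).
pose j x : K := CHom (cP x).
have jP : @rlinear R (sub_rmod (rker hom_defect)) K j.
  by split=> [x y|x r]; apply: chom_eq => u.
exists (tmap j (@id S) s).
rewrite -[LHS](@tcounit_rho A C N) rho_hom_counit tmap_comp //.
rewrite (eq_tmap (f' := sub_incl (rker hom_defect)) (g' := @id S)) //.
rewrite -[RHS](@tcounit_rho A C N) -[in RHS](kK (rho n)); congr (tcounit (hom_coact _)).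
exact: sE.
Qed.

Lemma comp_bij_counit :
  bijective (fun t : tens_comod S (K ⊗r reg R) => hom_counit (tmap (@rmul_map R K) (@id S) t)).
Proof. exact: (bij_comp hom_counit_bij (rmul_tens_bij K (ctx_lfirmS ctx))). Qed.

Definition adj_counit : chom (tens_comod S (K ⊗r reg R)) N :=
  chom_comp hom_counit_chom (tens_chom S (rmul_rhom K)).
Lemma adj_counit_bij : bijective adj_counit.
Proof. exact: comp_bij_counit. Qed.
End Counit.

Lemma hom_counit_nat (N P : comod C) (f : chom N P) (t : hom_rmod S N ⊗ S) :
  hom_counit (tmap (chom_comp f : hom_rmod S N -> hom_rmod S P) (@id S) t) = f (hom_counit t).
Proof.
have fP := @hom_map_linear R A C S N P f.
elim/tens_ind: t => [|s t hs ht|g u].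
- by rewrite (morph0 (tmapD fP _)) // !(morph0 (@hom_counitD _)) rhom0.
- by rewrite (tmapD fP) // !hom_counitD rhomD hs ht.
- by rewrite tmapE // !hom_counitE.
Qed.

Lemma counit_iso :
  nat_iso (fun_comp (tens_functor S) (hom_functor S hR)) (fun_id (ComodCat C)).
Proof.
exists (fun N : ComodCat C => adj_counit N) => [N P f|N]; last first.
  exact: (@chom_bij_iso A C _ _ (adj_counit N) (@adj_counit_bij N)).
apply: (@chom_eq A C (tens_comod S (hom_rmod S N ⊗r reg R)) P) => t.
have fP := @hom_map_linear R A C S N P f.
have idR : @bilinear_map R R (reg R) (reg R) id by split.
have mN := rmul_map_linear (hom_rmod S N); have mP := rmul_map_linear (hom_rmod S P).
have fRP : @rlinear R (hom_rmod S N ⊗r reg R) (hom_rmod S P ⊗r reg R)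
   (tmap (chom_comp f : hom_rmod S N -> hom_rmod S P) (@id (reg R))) by exact: tmap_rlinear.
rewrite -[RHS](hom_counit_nat f (tmap (@rmul_map R (hom_rmod S N)) (@id S) t)).
rewrite -[LHS]/(hom_counit (tmap (@rmul_map R (hom_rmod S P)) (@id S)
  (tmap (tmap (chom_comp f : hom_rmod S N -> hom_rmod S P) (@id (reg R))) (@id S) t))).
congr hom_counit; rewrite !tmap_comp //; apply: eq_tmap => //.
apply: tens_ext => [x y|x y|g r].
- by rewrite /= (proj1 fRP) rmul_mapD.
- by rewrite /= rmul_mapD (proj1 fP).
- by rewrite /= tmapE // !rmul_mapE (proj2 fP).
Qed.

Section Unit.
Variable M : frmod R.
Let H := hom_rmod S (tens_comod S M).

Lemma pure_chom_linear : @rlinear R M H (fun m : M => pure_chom S m).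
Proof.
split=> [m n|m r]; apply: chom_eq => u; first exact: pureDl.
exact: pure_bal.
Qed.

(** Built through [M ≅ M ⊗ R], so that linearity involves no choice of a local unit. *)
Lemma adj_unit_ex : exists h : rhom M (H ⊗r reg R), forall (m : M) (e : R), m <* e = m ->
  h m = (pure_chom S m : H) ⊠ (e : reg R).
Proof.
have [g gK Kg] := fr_firm M.
have gP : @rlinear R M (M ⊗r reg R) g.
  have mP := rmul_map_linear M.
  by split=> [x y|x r]; apply: (can_inj gK); rewrite ?(proj1 mP) ?(proj2 mP) !Kg.
have pP := pure_chom_linear.
have tP : @rlinear R (M ⊗r reg R) (H ⊗r reg R)
    (tmap (fun m : M => pure_chom S m : H) (@id (reg R))).
  by apply: tmap_rlinear => //; split.
exists (RHom (rlinear_comp tP gP)) => m e me /=.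
have -> : g m = m ⊠ (e : reg R) by apply: (can_inj gK); rewrite Kg rmul_mapE.
by rewrite tmapE.
Qed.
Definition adj_unit : rhom M (H ⊗r reg R) := proj1_sig (cid adj_unit_ex).
Lemma adj_unitE (m : M) (e : R) : m <* e = m ->
  adj_unit m = (pure_chom S m : H) ⊠ (e : reg R).
Proof. by rewrite /adj_unit; case: cid => h /= hE /hE. Qed.

(** A triangle identity: with the counit bijective, [adj_unit ⊗ S] must be its inverse. *)
Lemma adj_unitK (t : M ⊗r S) :
  hom_counit (tmap (@rmul_map R H) (@id S) (tmap adj_unit (@id S) t)) = t.
Proof.
have mP := rmul_map_linear H.
rewrite tmap_comp //.
have cP : @rlinear R M H (@rmul_map R H \o adj_unit) by exact: rlinear_comp.
elim/tens_ind: t => [|s t hs ht|m u].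
- by rewrite (morph0 (tmapD cP _)) // (morph0 (@hom_counitD _)).
- by rewrite (tmapD cP) // hom_counitD hs ht.
have [e _ me] := proj1 (rfirmP _ hR) (fr_firm M) m.
rewrite tmapE // [X in X ⊠ _]/= (adj_unitE me) rmul_mapE -(proj2 pure_chom_linear) me.
exact: hom_counitE.
Qed.

(* The faithful functor - ⊗ S reflects monomorphisms and epimorphisms, and the unit  *)
(* becomes inverse to the counit under it.                                            *)
Lemma adj_unit_bij : bijective adj_unit.
Proof.
have [_ Sf] := Sff.
have [k kK Kk] := @comp_bij_counit (tens_comod S M).
have uk t : k t = tmap adj_unit (@id S) t by rewrite -{1}(adj_unitK t) kK.
apply: inj_surj_bij => [|y].
  apply: additive_inj => [|m um]; first exact: rhomD.
  have Kf : rfirm (sub_rmod (rker adj_unit)) by apply: rfirm_sub (fr_firm M).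
  have E : sub_incl (rker adj_unit) =1 rhom_zero _ M.
    apply: Sf Kf (fr_firm M) _ => t; apply: (can_inj Kk); rewrite !uk !tmap_comp //.
    by apply: eq_tmap => // x /=; rewrite rhom0; apply: (sub_inclP x).
  exact: (E (sub_elt (K := rker adj_unit) um)).
have Hf : rfirm (H ⊗r reg R) by exact: tens_reg_firm.
have Qf : rfirm (quot_rmod (rim adj_unit)) by exact: rfirm_quot.
have E : quot_proj (rim adj_unit) =1 rhom_zero _ _.
  apply: Sf Hf Qf _ => t; rewrite -(kK t) uk !tmap_comp //.
  by apply: eq_tmap => // m /=; apply/quot_proj_eq0; exists m.
by have /quot_proj_eq0 := E y.
Qed.
End Unit.

Lemma unit_iso :
  nat_iso (fun_comp (hom_functor S hR) (tens_functor S)) (fun_id (FirmModCat R)).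
Proof.
apply: nat_iso_sym; exists (fun M : FirmModCat R => adj_unit M) => [M N f|M].
  apply: (@rhom_eq R (M : frmod R)) => m.
  have [e _ me] := proj1 (rfirmP _ hR) (fr_firm (M : frmod R)) m.
  pose f' : rhom (M : frmod R) (N : frmod R) := f.
  have fme : f' m <* e = f' m by rewrite -rhomM me.
  rewrite [LHS](adj_unitE fme) [RHS]/= (adj_unitE me) tmapE //; last exact: hom_map_linear.
  congr (_ ⊠ _); apply: chom_eq => u /=.
  by rewrite /pure_map /tens_map tmapE.
exact: (@rhom_bij_iso R (M : frmod R)
  (FRmod (tens_reg_firm (hom_rmod S (tens_comod S (M : frmod R))) hR))
  (adj_unit M) (@adj_unit_bij M)).
Qed.
End Converse.

Theorem corollary3p6 (A : pzRingType) (C : coring A) (R : rng)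
    (hR : has_idempotent_local_units R) :
  (forall (F : functor (FirmModCat R) (ComodCat C))
      (G : functor (ComodCat C) (FirmModCat R)),
    inverse_equivalences F G ->
    exists hS : is_bicomod (@reg_image_act A C R hR F),
    let S : bicomod R C := Bicomod hS in
    (exists (d : Order.disp_t) (Z : porderType d)
        (P : functor (poset_category Z) (split_category (FgpComodCat C)))
        (Sd : lbicomod C R) (sigma : R -> S ⊗ Sd) (tau : Sd ⊗ S -> A),
      [/\ directed Z,
          (* (i) *)
          @is_colim _ (ComodCat C) (fun_comp (split_underlying C) P) (bc_comod S),
          (* (ii) *)
          [/\ nat_iso F (tens_functor S), nat_iso G (cotensor_functor Sd hR),
              dagger_coaction sigma
            & @is_colim _ (LModCat A) (fun_comp (split_dual C) P) (lbicomod_ulmod Sd)],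
          (* (iii) *)
          comatrix_iso sigma tau
        & (* (iv) *)
          @is_colim _ RngCat (fun_comp (split_end C) P) R])
    /\ (* (v) *) (left_flat C -> faithfully_flat S))
  /\
  (forall S : bicomod R C,
    (exists (d : Order.disp_t) (Z : porderType d)
        (P : functor (poset_category Z) (split_category (FgpComodCat C))),
      directed Z /\
      @is_colim _ (ComodCat C) (fun_comp (split_underlying C) P) (bc_comod S)) ->
    (exists (Sd : bimod A R) (sigma : R -> S ⊗ Sd) (tau : Sd ⊗ S -> A),
      comatrix_iso sigma tau) ->
    faithfully_flat S ->
    left_flat C /\ inverse_equivalences (tens_functor S) (hom_functor S hR)).
Proof.
split=> [F G FG|S _ [Sd [eta [eps [ctx [_ [canB canP _ _]]]]]] Sff]; last first.
  split; first exact: (context_coring_flat hR canB canP Sff).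
  by split; [apply: unit_iso canB canP Sff | apply: counit_iso canB canP Sff].
have [c0 c0n c0i] := proj2 FG.
pose c (N : comod C) : chom (F (G N)) N := c0 N.
have dP (N : comod C) : {d : chom N (F (G N)) | cancel (c N) d /\ cancel d (c N)}.
  apply: cid; have [d dc cd] := c0i N; exists d; split=> x.
    exact: (congr1 (fun h : chom (F (G N)) (F (G N)) => h x) dc).
  exact: (congr1 (fun h : chom N N => h x) cd).
pose d (N : comod C) := proj1_sig (dP N).
have cK (N : comod C) : cancel (c N) (d N) by rewrite /d; case: (dP N) => ? [].
have dK (N : comod C) : cancel (d N) (c N) by rewrite /d; case: (dP N) => ? [].
have c_nat (N P : comod C) (f : chom N P) u : c P (Fmap F (Gmap G f) u) = f (c N u).
  exact: (congr1 (fun h : chom (F (G N)) P => h u) (c0n N P f)).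
pose hS := reg_image_bicomod hR FG; exists hS => /=.
pose S : bicomod R C := Bicomod hS; rewrite -/S.
split; last exact: (reg_image_faithfully_flat hR FG cK dK).
pose basis := reg_image_basis hR FG c_nat dK : forall r : R, exists t : S ⊗ dagger S hR,
  forall u : S, ev (pairing (hR:=hR)) t u = r *> u.
(* The system consists of the images of the right ideals [z R], which are the summands [z S]. *)
pose P (z : idem_elt R) : comod C := F (corner_frmod hR z).
have Pfgp z := corner_fgp hR FG c_nat dK (idemE z).
pose i z : chom (P z) S := @corner_sect _ _ _ hR _ _ FG z.
pose p z : chom S (P z) := @corner_retr _ _ _ hR _ _ FG z (idemE z).
have pi z x : p z (i z x) = x by exact: corner_sectK.
have ip z (u : S) : i z (p z u) = (z : R) *> u by exact: corner_retrK.
exists (Order.Disp tt tt), (idem_elt R), (system Pfgp pi ip), (dagger_lbicomod basis),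
  (copairing basis), (pairing (hR:=hR)).
split.
- exact: (idempotents_directed hR).
- exact: system_colim.
- split.
  + exact: (watts_iso hR FG cK dK).
  + exact: (cotensor_iso hR FG c_nat cK dK).
  + exact: dagger_coactionP.
  + exact: system_dual_colim.
- apply: dagger_comatrix_iso; exact: (reg_image_can_bij hR FG cK dK).
- apply: system_end_colim => // [r s|h z]; first exact: (lact_inj (FG := FG)).
  exact: lact_full.
Qed.
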